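(* Assume $F^1,\dots,F^k$ and $a$ are $C^2$ and let $\beta>0$. For every $u_0\in\mathcal{U}$, the Cauchy problem $\partial_tU_t=-\mathcal{G}^\beta[U_t]$, $U_0=u_0$, admits a unique, globally defined, continuously differentiable solution $U:[0,+\infty)\to\mathcal{U}$.
   Context: $F:\mathbb{R}^n\to\mathbb{R}^{n\times k}$ is globally Lipschitz with columns $F^1,\dots,F^k$; $x_0\in\mathbb{R}^n$ fixed; $\mathcal{U}=L^2([0,1],\mathbb{R}^k)$; $x_u$ solves $\dot x_u=F(x_u)u$, $x_u(0)=x_0$. $a:\mathbb{R}^n\to[0,\infty)$. For $\beta>0$, $\mathcal{F}^\beta:\mathcal{U}\to[0,\infty)$, $\mathcal{F}^\beta(u)=\frac12\|u\|_{L^2}^2+\beta a(x_u(1))$, and $\mathcal{G}^\beta:\mathcal{U}\to\mathcal{U}$ is the Riesz representative of its differential: $\langle\mathcal{G}^\beta[u],v\rangle_{L^2}=d_u\mathcal{F}^\beta(v)$ for all $u,v\in\mathcal{U}$. Derivatives of curves $t\mapsto U_t\in\mathcal{U}$ are strong (norm) derivatives. *)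

(* Defs.v *)
From HB Require Import structures.
From mathcomp Require Import all_boot all_order all_algebra.
From mathcomp Require Import all_classical all_reals all_analysis.
Set Implicit Arguments. Unset Strict Implicit. Unset Printing Implicit Defensive.
Import Order.TTheory GRing.Theory Num.Theory.
Import numFieldNormedType.Exports.
Local Open Scope classical_set_scope.
Local Open Scope ring_scope.

Section Defs.
Variable R : realType.
Local Notation mu := (@lebesgue_measure R).
Local Notation I01 := (`[0%R, 1%R]%classic : set R).

Definition dotv (m : nat) (x y : 'cV[R]_m) : R := \sum_(i < m) x i 0 * y i 0.

(* Controls: functions [0,1] -> R^k (represented as R -> 'cV_k, only the
   values on [0,1] matter). *)
Definition ctrl (k : nat) := R -> 'cV[R]_k.

Definition inL2 (k : nat) (u : ctrl k) : Prop :=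
  forall i : 'I_k, measurable_fun I01 (fun s => u s i 0) /\
    mu.-integrable I01 (fun s => ((u s i 0) ^+ 2)%:E).

Definition ipL2 (k : nat) (u v : ctrl k) : R :=
  Rintegral mu I01 (fun s => dotv (u s) (v s)).
Definition normL2 (k : nat) (u : ctrl k) : R := Num.sqrt (ipL2 u u).

Definition caddL2 (k : nat) (u v : ctrl k) : ctrl k := fun s => u s + v s.
Definition coppL2 (k : nat) (u : ctrl k) : ctrl k := fun s => - u s.
Definition cscaleL2 (k : nat) (c : R) (u : ctrl k) : ctrl k := fun s => c *: u s.

Definition eqL2 (k : nat) (u v : ctrl k) : Prop :=
  normL2 (caddL2 u (coppL2 v)) = 0.

(* x is a (Caratheodory) solution on [0,1] of x' = F(x) u, x(0) = x0:
   continuous, and satisfies the integral equation. *)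
Definition is_traj (n k : nat) (F : 'cV[R]_n -> 'M[R]_(n, k)) (x0 : 'cV[R]_n)
    (u : ctrl k) (x : R -> 'cV[R]_n) : Prop :=
  {within `[0%R, 1%R], continuous x} /\
  forall t, 0 <= t <= 1 ->
    x t = x0 + \col_(i < n)
             Rintegral mu (`[0%R, t]%classic : set R) (fun s => (F (x s) *m u s) i 0).

(* x_u(1): the endpoint of the (unique) trajectory *)
Definition xend (n k : nat) (F : 'cV[R]_n -> 'M[R]_(n, k)) (x0 : 'cV[R]_n)
    (u : ctrl k) : 'cV[R]_n :=
  xget 0 [set y | exists x, is_traj F x0 u x /\ x 1 = y].

Definition Fbeta (n k : nat) (F : 'cV[R]_n -> 'M[R]_(n, k)) (x0 : 'cV[R]_n)
    (a : 'cV[R]_n -> R) (beta : R) (u : ctrl k) : R :=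
  2^-1 * ipL2 u u + beta * a (xend F x0 u).

Definition is_grad (n k : nat) (F : 'cV[R]_n -> 'M[R]_(n, k)) (x0 : 'cV[R]_n)
    (a : 'cV[R]_n -> R) (beta : R) (G : ctrl k -> ctrl k) : Prop :=
  forall u, inL2 u ->
    inL2 (G u) /\
    forall eps : R, 0 < eps -> exists2 delta : R, 0 < delta &
      forall v, inL2 v -> normL2 v < delta ->
        `| Fbeta F x0 a beta (caddL2 u v) - Fbeta F x0 a beta u - ipL2 (G u) v |
          <= eps * normL2 v.

Definition C1_curve_with_deriv (k : nat) (U V : R -> ctrl k) : Prop :=
  (forall t, 0 <= t -> inL2 (U t) /\ inL2 (V t)) /\
  (forall t, 0 <= t -> forall eps : R, 0 < eps -> exists2 delta : R, 0 < delta &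
     forall h, h != 0 -> `|h| < delta -> 0 <= t + h ->
       normL2 (caddL2 (cscaleL2 h^-1 (caddL2 (U (t + h)) (coppL2 (U t))))
                      (coppL2 (V t))) <= eps) /\
  (forall t, 0 <= t -> forall eps : R, 0 < eps -> exists2 delta : R, 0 < delta &
     forall s, 0 <= s -> `|s - t| < delta -> normL2 (caddL2 (V s) (coppL2 (V t))) <= eps).

Definition is_flow_solution (k : nat) (G : ctrl k -> ctrl k) (u0 : ctrl k)
    (U : R -> ctrl k) : Prop :=
  exists V : R -> ctrl k,
    C1_curve_with_deriv U V /\
    eqL2 (U 0) u0 /\
    forall t, 0 <= t -> eqL2 (V t) (coppL2 (G (U t))).

End Defs.

(* C^1 and C^2 maps between normed spaces (used on finite-dimensional spaces,
   where continuity of x |-> 'd f x v for every v is continuity of the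
   differential). *)
Definition isC1 (R : realType) (V W : normedModType R) (f : V -> W) : Prop :=
  (forall x, differentiable f x) /\ forall v, continuous (fun x => 'd f x v).
Definition isC2 (R : realType) (V W : normedModType R) (f : V -> W) : Prop :=
  isC1 f /\ forall v, isC1 (fun x => 'd f x v).

(* Main.v *)
(* If lam solves the adjoint equation
     lam(t) = grad a (x_u(1)) + int_t^1 (DF(x_u) u)^T lam,
   then B u := beta F(x_u)^T lam represents the differential of
   u |-> beta a (x_u(1)), so the gradient of F^beta is u + B u. Since u is only
   L^2, the equations of x_u and lam are Volterra equations with an L^2 weight;
   by Cauchy-Schwarz, exponentially weighted sup norms give contraction and
   Gronwall estimates whose constants are uniform over L^2 balls. It follows
   that B maps L^2 balls to bounded, uniformly 1/2-Hoelder functions and is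
   Lipschitz on them from the L^2 norm to the sup norm. Hence the flow has the
   form U_t = e^-t u_0 + Y_t with Y continuous in both variables, and only
   pointwise time integrals are needed: no Bochner integral, no completeness of
   L^2. After cutting B off outside a ball the flow is global; along it F^beta
   decreases and dominates |U_t|^2 / 2, so the cut-off is never reached.
   Uniqueness is Gronwall's lemma for |U_t - U'_t|^2. *)

Require Import Defs.
From HB Require Import structures.
From mathcomp Require Import all_boot all_order all_algebra.
From mathcomp Require Import all_classical all_reals all_analysis.
From mathcomp Require Import measurable_realfun ring lra.
Import Order.TTheory GRing.Theory Num.Theory.
Import numFieldNormedType.Exports.
Local Open Scope classical_set_scope.
Local Open Scope ring_scope.
Set Implicit Arguments. Unset Strict Implicit. Unset Printing Implicit Defensive.

(** * Integrals over [0, 1] *)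

(** Neither the linearised equation nor the differential of u |-> x_u is ever formed. The exact
    increment z of the trajectory is paired with the adjoint state of u; what is left over contains
    either a Taylor remainder of F or an increment of F multiplied by v, hence is O(|v|^2). From C^2
    regularity only two facts survive: on each ball the gradients are Lipschitz and the first order
    Taylor remainders are quadratic. The state equation runs forwards and the adjoint one backwards;
    a boolean in the kernel [ker] lets one existence theorem and one Gronwall lemma cover both.
    Controls are bare functions, and [is_grad] fixes G only up to L^2 equality. The flow is
    therefore built for one explicit field, where identities hold pointwise, and carried to an
    arbitrary G by uniqueness of the Riesz representative. Limits of Picard iterates are pointwise
    limits in (t, s), so the invariant class is described by bounds that survive such limits:
    explicit moduli of continuity instead of bare continuity or measurability in s. *)

Section Int01.
Variable R : realType.
Local Notation mu := (@lebesgue_measure R).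
Local Notation I01 := (`[0%R, 1%R]%classic : set R).
Implicit Types (f g h : R -> R) (s t : R).

Definition int01 f : R := Rintegral mu I01 f.
Definition L1 f := mu.-integrable I01 (EFin \o f).
Definition L2 f := measurable_fun I01 f /\
  mu.-integrable I01 (fun s => ((f s) ^+ 2)%:E).
(** Multipliers of both [L1] and [L2]: kernels and continuous functions belong to this class, so
    their products with an integrable control need no separate argument. *)
Definition bmeas f := measurable_fun I01 f /\
  exists C : R, forall s, 0 <= s <= 1 -> `|f s| <= C.

Lemma I01P s : I01 s <-> 0 <= s <= 1.
Proof. by rewrite /= in_itv. Qed.

Lemma measurable_I01 : measurable I01. Proof. exact: measurable_itv. Qed.
Hint Resolve measurable_I01 : core.

Lemma mu_I01 : mu I01 = 1%:E.
Proof. by rewrite lebesgue_measure_itv/= lte_fin ltr01 oppr0 adde0. Qed.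

Lemma L1_meas f : L1 f -> measurable_fun I01 f.
Proof. by move=> /measurable_int/measurable_EFinP. Qed.

Lemma L1_dom f g : measurable_fun I01 f -> L1 g ->
  (forall s, 0 <= s <= 1 -> `|f s| <= g s) -> L1 f.
Proof.
move=> mf ig fg; apply: (@le_integrable _ _ _ mu I01 measurable_I01 (EFin \o f) (EFin \o g)) ig.
  exact/measurable_EFinP.
by move=> s /I01P s01 /=; rewrite lee_fin (le_trans (fg _ s01))// ler_norm.
Qed.

Lemma L1_cst c : L1 (fun=> c).
Proof.
apply/integrableP; split; first exact/measurable_EFinP/measurable_cst.
by rewrite /= integral_cst//= mu_I01 mule1 ltry.
Qed.

Lemma L1D f g : L1 f -> L1 g -> L1 (fun s => f s + g s).
Proof. exact: (@integrableD _ _ _ mu I01 measurable_I01 (EFin \o f) (EFin \o g)). Qed.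

Lemma L1Z c f : L1 f -> L1 (fun s => c * f s).
Proof.
exact: (@integrableZl _ _ _ mu I01 measurable_I01 c (EFin \o f)).
Qed.

Lemma L1B f g : L1 f -> L1 g -> L1 (fun s => f s - g s).
Proof.
exact: (@integrableB _ _ _ mu I01 measurable_I01 (EFin \o f) (EFin \o g)).
Qed.

Lemma L1_abs f : L1 f -> L1 (fun s => `|f s|).
Proof. exact: (@integrable_abse _ _ _ mu I01 (EFin \o f)). Qed.

(** [big_cons] as an identity between functions, so that inductions on sums can rewrite the
    integrand as a whole. *)
Lemma sum_consE (I : Type) (i : I) (r : seq I) (P : pred I) (F : I -> R -> R) :
  (fun s => \sum_(j <- i :: r | P j) F j s) =
  if P i then (fun s => F i s + \sum_(j <- r | P j) F j s)
  else (fun s => \sum_(j <- r | P j) F j s).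
Proof. by case: ifP => Pi; apply/funext => s; rewrite big_cons Pi. Qed.

Lemma sum_nilE (I : Type) (P : pred I) (F : I -> R -> R) :
  (fun s => \sum_(j <- [::] | P j) F j s) = (fun=> 0).
Proof. by apply/funext => s; rewrite big_nil. Qed.

Lemma L1_sum (I : Type) (r : seq I) (P : pred I) (F : I -> R -> R) :
  (forall i, L1 (F i)) -> L1 (fun s => \sum_(i <- r | P i) F i s).
Proof.
move=> iF; elim: r => [|i r IH].
  rewrite sum_nilE; exact: L1_cst.
rewrite sum_consE; case: ifP => // _; exact: L1D.
Qed.

Lemma eq_L1 f g : (forall s, 0 <= s <= 1 -> f s = g s) -> L1 f -> L1 g.
Proof.
move=> fg; apply: (@eq_integrable _ _ _ mu I01 measurable_I01 (EFin \o f)) => s /set_mem /I01P s01.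
by rewrite /= fg.
Qed.

Lemma eq_int01 f g : (forall s, 0 <= s <= 1 -> f s = g s) -> int01 f = int01 g.
Proof. by move=> fg; apply: eq_Rintegral => s /set_mem/I01P; exact: fg. Qed.

Lemma int01_cst c : int01 (fun=> c) = c.
Proof.
transitivity (c * fine (mu I01)); first exact: Rintegral_cst.
by rewrite mu_I01 mulr1.
Qed.

Lemma int01D f g : L1 f -> L1 g -> int01 (fun s => f s + g s) = int01 f + int01 g.
Proof. by move=> ? ?; exact: RintegralD. Qed.

Lemma int01B f g : L1 f -> L1 g -> int01 (fun s => f s - g s) = int01 f - int01 g.
Proof. by move=> ? ?; exact: RintegralB. Qed.

Lemma int01Z c f : L1 f -> int01 (fun s => c * f s) = c * int01 f.
Proof. by move=> ?; exact: RintegralZl. Qed.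

Lemma int01_sum (I : Type) (r : seq I) (P : pred I) (F : I -> R -> R) :
  (forall i, L1 (F i)) ->
  int01 (fun s => \sum_(i <- r | P i) F i s) = \sum_(i <- r | P i) int01 (F i).
Proof.
move=> iF; elim: r => [|i r IH].
  by rewrite sum_nilE big_nil int01_cst.
rewrite sum_consE big_cons -IH.
by case: ifP => // _; rewrite int01D//; exact: L1_sum.
Qed.

Lemma le_int01 f g : L1 f -> L1 g -> (forall s, 0 <= s <= 1 -> f s <= g s) ->
  int01 f <= int01 g.
Proof.
by move=> ? ? fg; apply: le_Rintegral => // s /I01P; exact: fg.
Qed.

Lemma int01_ge0 f : (forall s, 0 <= s <= 1 -> 0 <= f s) -> 0 <= int01 f.
Proof. by move=> f0; apply: Rintegral_ge0 => s /I01P; exact: f0. Qed.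

Lemma int01_abs_le f g : L1 f -> L1 g ->
  (forall s, 0 <= s <= 1 -> `|f s| <= g s) -> `|int01 f| <= int01 g.
Proof.
move=> fi gi fg; apply: (@le_trans _ _ (int01 (fun s => `|f s|))).
  exact: le_normr_Rintegral.
by apply: le_int01 => //; exact: L1_abs.
Qed.

Lemma bmeas_cst c : bmeas (fun=> c).
Proof. by split; [exact: measurable_cst|exists `|c|]. Qed.

Lemma bmeasD f g : bmeas f -> bmeas g -> bmeas (fun s => f s + g s).
Proof.
move=> [mf [C fC]] [mg [D gD]]; split; first exact: measurable_funD.
by exists (C + D) => s s01; rewrite (le_trans (ler_normD _ _))// lerD ?fC ?gD.
Qed.

Lemma bmeasM f g : bmeas f -> bmeas g -> bmeas (fun s => f s * g s).
Proof.
move=> [mf [C fC]] [mg [D gD]]; split; first exact: measurable_funM.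
by exists (C * D) => s s01; rewrite normrM ler_pM ?fC ?gD.
Qed.

Lemma bmeas_sum (I : Type) (r : seq I) (P : pred I) (F : I -> R -> R) :
  (forall i, bmeas (F i)) -> bmeas (fun s => \sum_(i <- r | P i) F i s).
Proof.
move=> iF; elim: r => [|i r IH].
  rewrite sum_nilE; exact: bmeas_cst.
rewrite sum_consE; case: ifP => // _; exact: bmeasD.
Qed.

Lemma bmeas_continuous f : continuous f -> bmeas f.
Proof.
move=> cf; split.
  by apply: measurable_funTS; exact: continuous_measurable_fun.
have /(compact_bounded)[M [_ HM]] : compact (f @` I01).
  apply: continuous_compact; last exact: segment_compact.
  exact: continuous_subspaceT.
exists (M + 1) => s s01; apply: HM; first by rewrite ltrDl.
by exists s => //; exact/I01P.
Qed.

Lemma bmeas_L1 f g : bmeas f -> L1 g -> L1 (fun s => f s * g s).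
Proof.
move=> [mf [C fC]] gi.
apply: (@L1_dom _ (fun s => C * `|g s|)).
- by apply: measurable_funM => //; exact: L1_meas.
- exact/L1Z/L1_abs.
- by move=> s s01; rewrite normrM ler_wpM2r ?fC.
Qed.

Lemma L1_bmeas f : bmeas f -> L1 f.
Proof.
move=> /bmeas_L1 /(_ (L1_cst 1)); apply: eq_L1 => s _; exact: mulr1.
Qed.

Lemma L2_sq f : L2 f -> L1 (fun s => f s ^+ 2).
Proof. by case. Qed.

Lemma L2_mul f g : L2 f -> L2 g -> L1 (fun s => f s * g s).
Proof.
move=> [mf f2] [mg g2].
apply: (@L1_dom _ (fun s => f s ^+ 2 + g s ^+ 2)).
- exact: measurable_funM.
- exact: L1D.
move=> s _; rewrite ler_norml; apply/andP; split.
  by have := sqr_ge0 (f s + g s); have := sqr_ge0 (f s - g s); nra.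
by have := sqr_ge0 (f s + g s); have := sqr_ge0 (f s - g s); nra.
Qed.

Lemma bmeas_L2 f : bmeas f -> L2 f.
Proof.
move=> bf; split; first by case: bf.
by have := L1_bmeas (bmeasM bf bf); apply: eq_L1 => s _; rewrite expr2.
Qed.

Lemma L2_cst c : L2 (fun=> c). Proof. exact/bmeas_L2/bmeas_cst. Qed.

Lemma L2_L1 f : L2 f -> L1 f.
Proof.
by move=> /L2_mul/(_ (L2_cst 1)); apply: eq_L1 => s _; exact: mulr1.
Qed.

Lemma L2D f g : L2 f -> L2 g -> L2 (fun s => f s + g s).
Proof.
move=> Lf Lg; split; first by apply: measurable_funD; [case: Lf|case: Lg].
have : L1 (fun s => f s ^+ 2 + (2 * (f s * g s) + g s ^+ 2)).
  by apply: L1D; [exact: L2_sq|apply: L1D;[exact/L1Z/L2_mul|exact: L2_sq]].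
by apply: eq_L1 => s _; ring.
Qed.

Lemma L2M f g : bmeas f -> L2 g -> L2 (fun s => f s * g s).
Proof.
move=> bf [mg g2]; split; first by apply: measurable_funM => //; case: bf.
have := bmeas_L1 (bmeasM bf bf) g2.
by apply: eq_L1 => s _; ring.
Qed.

Lemma L2Z c f : L2 f -> L2 (fun s => c * f s).
Proof. exact/L2M/bmeas_cst. Qed.

Lemma L2B f g : L2 f -> L2 g -> L2 (fun s => f s - g s).
Proof.
move=> Lf Lg; have := L2D Lf (L2Z (-1) Lg).
by congr L2; apply/funext => s; rewrite mulN1r.
Qed.

Lemma L2_sum (I : Type) (r : seq I) (P : pred I) (F : I -> R -> R) :
  (forall i, L2 (F i)) -> L2 (fun s => \sum_(i <- r | P i) F i s).
Proof.
move=> iF; elim: r => [|i r IH].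
  rewrite sum_nilE; exact: L2_cst.
rewrite sum_consE; case: ifP => // _; exact: L2D.
Qed.

Lemma L2_abs f : L2 f -> L2 (fun s => `|f s|).
Proof.
move=> [mf f2]; split; first exact: measurableT_comp.
by apply: eq_L1 f2 => s _; rewrite real_normK ?num_real.
Qed.

(** The Cauchy-Schwarz argument freed of its inner product; it serves for scalar functions in
    [int01_CS] and for controls in [ipL2_CS]. *)
Lemma quadratic_discriminant (x y p : R) : 0 <= x -> 0 <= y ->
  (forall a b, 0 <= a ^+ 2 * x + 2 * a * b * p + b ^+ 2 * y) -> p ^+ 2 <= x * y.
Proof.
move=> f0 g0 quad.
have [n0|n0] := eqVneq (y) 0.
  have [p0|p0] := eqVneq p 0; first by rewrite p0 expr0n mulr_ge0.
  (* With y = 0 the form is linear in b; this b makes the cross term -(x + 1), so the form would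
     take the value -1. *)
  have := quad 1 (- (x + 1) / (2 * p)).
  rewrite n0 mulr0 addr0 expr1n mul1r.
  have -> : 2 * 1 * (- (x + 1) / (2 * p)) * p = - (x + 1) by field.
  by move=> ?; lra.
have gp : 0 < y by rewrite lt_neqAle eq_sym n0.
(* The minimiser up to scale: a = y, b = -p turns the form into y (x y - p^2). *)
have := quad (y) (- p).
have -> : y ^+ 2 * x + 2 * y * - p * p + (- p) ^+ 2 * y =
  y * (x * y - p ^+ 2) by ring.
by rewrite pmulr_rge0// subr_ge0.
Qed.

Definition n2 f : R := int01 (fun s => f s ^+ 2).

Lemma n2_ge0 f : 0 <= n2 f.
Proof. by apply: int01_ge0 => s _; exact: sqr_ge0. Qed.

Lemma int01_CS f g : L2 f -> L2 g -> int01 (fun s => f s * g s) ^+ 2 <= n2 f * n2 g.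
Proof.
move=> Lf Lg; set p := int01 (fun s => f s * g s).
have quad a b : 0 <= a ^+ 2 * n2 f + 2 * a * b * p + b ^+ 2 * n2 g.
  have -> : a ^+ 2 * n2 f + 2 * a * b * p + b ^+ 2 * n2 g =
            int01 (fun s => (a * f s + b * g s) ^+ 2).
    have i1 := L1Z (a ^+ 2) (L2_sq Lf).
    have i2 := L1Z (2 * a * b) (L2_mul Lf Lg).
    have i3 := L1Z (b ^+ 2) (L2_sq Lg).
    rewrite (@eq_int01 _ (fun s => a ^+ 2 * f s ^+ 2 +
      (2 * a * b * (f s * g s) + b ^+ 2 * g s ^+ 2))); last by move=> s _; ring.
    rewrite int01D//; last exact: L1D.
    rewrite int01D// !int01Z ?addrA//; [exact: L2_sq|exact: L2_mul|exact: L2_sq].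
  by apply: int01_ge0 => s _; exact: sqr_ge0.
by apply: quadratic_discriminant quad; exact: n2_ge0.
Qed.

Lemma int01_CS_abs f g a b : L2 f -> L2 g -> 0 <= a -> 0 <= b ->
  n2 f <= a ^+ 2 -> n2 g <= b ^+ 2 -> `|int01 (fun s => f s * g s)| <= a * b.
Proof.
move=> Lf Lg a0 b0 fa gb.
have h : int01 (fun s => f s * g s) ^+ 2 <= (a * b) ^+ 2.
  by rewrite exprMn (le_trans (int01_CS Lf Lg))// ler_pM// n2_ge0.
by rewrite -ler_sqr ?nnegrE ?mulr_ge0// real_normK ?num_real.
Qed.

End Int01.

(** * Weighted Volterra estimates *)

Section Kernel.
Variable R : realType.
Local Notation mu := (@lebesgue_measure R).
Local Notation I01 := (`[0%R, 1%R]%classic : set R).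
Implicit Types (f g h m : R -> R) (s t : R) (b : bool).

Lemma le_of_sqr_le (x y : R) : 0 <= y -> x ^+ 2 <= y ^+ 2 -> x <= y.
Proof. by move=> y0 h; rewrite leNgt; apply/negP => yx; nra. Qed.

Lemma is_derive_expR_affine (k d s : R) :
  is_derive s 1 (fun s => expR (k * s + d)) (k * expR (k * s + d)).
Proof.
have h1 : is_derive s 1 (fun s => k * s + d) k.
  have : is_derive s 1 ((k *: (@id R)) + cst d) (k *: 1 + 0).
    by apply: is_deriveD; apply: is_deriveZ.
  by rewrite addr0 /GRing.scale/= mulr1.
have := @is_derive1_comp _ expR (fun s => k * s + d) s _ _ (is_derive_expR _) h1.
by rewrite mulrC.
Qed.

Lemma continuous_expR_affine (k d : R) : continuous (fun s => expR (k * s + d)).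
Proof.
move=> s; apply: differentiable_continuous; apply/derivable1_diffP.
by have [] := is_derive_expR_affine k d s.
Qed.

Lemma Rintegral_expR_affine (k d x y : R) : k != 0 -> x <= y ->
  Rintegral mu `[x, y]%classic (fun s => expR (k * s + d)) =
  k^-1 * (expR (k * y + d) - expR (k * x + d)).
Proof.
move=> k0; rewrite le_eqVlt => /predU1P[->|xy].
  by rewrite subrr mulr0 set_itv1 Rintegral_set1.
have dG s : is_derive s 1 (fun s => k^-1 * expR (k * s + d)) (expR (k * s + d)).
  have : is_derive s 1 (k^-1 *: (fun s => expR (k * s + d)))
     (k^-1 *: (k * expR (k * s + d))).
    by apply: is_deriveZ; exact: is_derive_expR_affine.
  by rewrite /GRing.scale/= mulKf.
have cG : continuous (fun s => k^-1 * expR (k * s + d)).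
  move=> s; apply: differentiable_continuous; apply/derivable1_diffP.
  by have [] := dG s.
rewrite /Rintegral (@continuous_FTC2 _ _ (fun s => k^-1 * expR (k * s + d)))//.
- by rewrite -EFinB/= mulrBr.
- by apply: continuous_subspaceT; exact: continuous_expR_affine.
- split.
  + by move=> s _; have [] := dG s.
  + by apply: cvg_at_right_filter; exact: cG.
  + by apply: cvg_at_left_filter; exact: cG.
- by move=> s _; rewrite derive1E; have [] := dG s.
Qed.

(** On [0, 1], [true] integrates over [0, t] and [false] over [t, 1]: state and adjoint equations
    share their estimates through this boolean. *)
Definition ker b t s : R := (if b then s <= t else t <= s)%:R.

Lemma ker_ge0 b t s : 0 <= ker b t s. Proof. exact: ler0n. Qed.

Lemma ker_le1 b t s : ker b t s <= 1. Proof. by rewrite /ker lern1 leq_b1. Qed.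

Lemma kerX b t s : ker b t s ^+ 2 = ker b t s.
Proof. by rewrite /ker; case: (if _ then _ else _); rewrite ?expr1n ?expr0n. Qed.

Definition kitv b t : set R := if b then `]-oo, t]%classic else `[t, +oo[%classic.

Lemma ker_indic b t s : ker b t s = \1_(kitv b t) s.
Proof.
rewrite indicE /ker /kitv; congr (nat_of_bool _)%:R; apply/idP/idP.
  by case: b => h; rewrite inE/= in_itv/= ?andbT.
by case: b => /set_mem; rewrite /= in_itv/= ?andbT.
Qed.

Lemma bmeas_ker b t : bmeas (ker b t).
Proof.
split; last first.
  by exists 1 => s _; rewrite ger0_norm ?ker_ge0 ?ker_le1.
rewrite (_ : ker b t = \1_(kitv b t)); last by apply/funext => s; rewrite ker_indic.
by apply: measurable_indic; rewrite /kitv; case: b; exact: measurable_itv.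
Qed.

Lemma int01_ker b t f : 0 <= t <= 1 ->
  int01 (fun s => ker b t s * f s) =
  Rintegral mu (if b then `[0, t]%classic else `[t, 1]%classic) f.
Proof.
move=> /andP[t0 t1].
have -> : (if b then `[0, t]%classic else `[t, 1]%classic : set R) = I01 `&` kitv b t.
  rewrite /kitv; case: b; apply/seteqP; split => s /=; rewrite !in_itv/= ?andbT.
  - by move=> /andP[s0 st]; rewrite s0 st (le_trans st t1).
  - by move=> [/andP[-> _] ->].
  - by move=> /andP[ts s1]; rewrite s1 ts (le_trans t0 ts).
  - by move=> [/andP[_ ->] ->].
rewrite Rintegral_mkcondr; apply: eq_Rintegral => s _.
rewrite ker_indic indicE patchE; case: ifP => _; first by rewrite mul1r.
by rewrite mul0r.
Qed.

(** The weight grows in the direction of integration: away from 0 for [true], away from 1 for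
    [false]. *)
Definition weight b (lam s : R) : R := expR (lam * (if b then s else 1 - s)).

Lemma continuous_weight b lam : continuous (weight b lam).
Proof.
case: b.
  rewrite (_ : weight true lam = fun s => expR (lam * s + 0)).
    exact: continuous_expR_affine.
  by apply/funext => s; rewrite /weight addr0.
rewrite (_ : weight false lam = fun s => expR ((- lam) * s + lam)).
  exact: continuous_expR_affine.
by apply/funext => s; rewrite /weight; congr expR; ring.
Qed.

Lemma weight_bounds b lam s : 0 <= lam -> 0 <= s <= 1 ->
  1 <= weight b lam s <= expR lam.
Proof.
move=> l0 /andP[s0 s1]; rewrite /weight.
by apply/andP; split; [rewrite -[leLHS]expR0 ler_expR|rewrite ler_expR]; case: b; nra.
Qed.

(** The squared weight is integrated up to its peak at t, which costs only 1/(2 lam) of the peak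
    value: this is the smallness that a large lam buys. The boundary term at the other end has a
    favourable sign and is dropped. *)
Lemma int01_ker_weight b lam t : 0 < lam -> 0 <= t <= 1 ->
  int01 (fun s => (ker b t s * weight b lam s) ^+ 2) <=
  weight b lam t ^+ 2 / (2 * lam).
Proof.
move=> l0 t01; have /andP[t0 t1] := t01.
have E : int01 (fun s => (ker b t s * weight b lam s) ^+ 2) =
   int01 (fun s => ker b t s * expR ((if b then 2 * lam else - (2 * lam)) * s +
          (if b then 0 else 2 * lam))).
  apply: eq_int01 => s _; rewrite exprMn kerX /weight expr2 -expRD.
  by congr (_ * expR _); case: b; ring.
have EW : weight b lam t ^+ 2 = expR ((if b then 2 * lam else - (2 * lam)) * t +
          (if b then 0 else 2 * lam)).
  by rewrite /weight expr2 -expRD; congr expR; case: (b); ring.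
rewrite E EW int01_ker// {E EW}; case: b.
- rewrite Rintegral_expR_affine ?mulf_neq0 ?gt_eqF//.
  rewrite mulrC; apply: ler_wpM2r; first by rewrite invr_ge0 mulr_ge0// ltW.
  by rewrite lerBlDr lerDl expR_ge0.
- rewrite Rintegral_expR_affine ?oppr_eq0 ?mulf_neq0 ?gt_eqF//.
  rewrite invrN mulNr -mulrN opprB mulrC; apply: ler_wpM2r; first by rewrite invr_ge0 mulr_ge0// ltW.
  by rewrite lerBlDr lerDl expR_ge0.
Qed.

(* Taking lam = 2 M + 1 makes the Volterra operator with kernel m a
   1/2-contraction for the weight, by Cauchy-Schwarz. *)
Lemma int01_ker_weight_contraction b (M : R) m t : 0 <= M -> L2 m -> n2 m <= M ->
  0 <= t <= 1 ->
  int01 (fun s => ker b t s * (m s * weight b (2 * M + 1) s)) <=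
  weight b (2 * M + 1) t / 2.
Proof.
move=> M0 Lm mM t01; set lam := 2 * M + 1; have l0 : 0 < lam by rewrite /lam; lra.
set w := weight b lam.
have Lkw : L2 (fun s => ker b t s * w s).
  by apply/bmeas_L2/bmeasM; [exact: bmeas_ker|exact/bmeas_continuous/continuous_weight].
have w0 : 0 < w t by exact: expR_gt0.
rewrite (@eq_int01 _ _ (fun s => m s * (ker b t s * w s))); last by move=> s _; ring.
apply: le_of_sqr_le; first by rewrite divr_ge0 ?ltW.
apply: (le_trans (int01_CS Lm Lkw)).
apply: (@le_trans _ _ (M * (w t ^+ 2 / (2 * lam)))).
  by apply: ler_pM => //; rewrite ?n2_ge0//; exact: int01_ker_weight.
have -> : M * (w t ^+ 2 / (2 * lam)) = (w t) ^+ 2 * (M / (2 * lam)) by ring.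
rewrite expr_div_n; apply: ler_wpM2l; first exact: sqr_ge0.
rewrite ler_pdivrMr; last by rewrite mulr_gt0.
by rewrite /lam; nra.
Qed.
End Kernel.

(** * Contraction principle for weighted sup distances *)

Section FixedPoint.
Variable R : realType.

Lemma continuous_distP (V W : normedModType R) (f : V -> W) :
  continuous f <-> forall x (e : R), 0 < e -> exists2 d : R, 0 < d &
    forall y, `|y - x| < d -> `|f y - f x| <= e.
Proof.
split=> [cf x e e0|H x].
  have /cvgrPdistC_le /(_ e e0) /nbhs_ballP[d /= d0 Hd] := cf x.
  exists d => // y yx; apply: Hd.
  by rewrite -ball_normE /ball_/= distrC.
apply/cvgrPdistC_le => e e0; have [d d0 Hd] := H x e e0.
apply/nbhs_ballP; exists d => //= y.
by rewrite -ball_normE /ball_/= distrC => /Hd.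
Qed.

(** Completeness through order: 2 C / 2^m bounds all the steps still to come, so x_m minus it
    increases, x_m plus it decreases, and the supremum of the former lies between the two. *)
Lemma geometric_limit (x : nat -> R) (C : R) :
  (forall m, `|x m.+1 - x m| <= C / 2 ^+ m) ->
  exists l, forall m, `|x m - l| <= 2 * C / 2 ^+ m.
Proof.
move=> xC.
have C0 : 0 <= C by have := xC 0%N; rewrite expr0 divr1; apply: le_trans.
pose r m := 2 * C / 2 ^+ m.
have r0 m : 0 <= r m by rewrite divr_ge0 ?mulr_ge0// exprn_ge0.
have rS m : r m = r m.+1 + C / 2 ^+ m.
  by rewrite /r exprS; field; rewrite expf_neq0.
pose a m := x m - r m; pose c m := x m + r m.
have aS m : a m <= a m.+1.
  by have := xC m; rewrite ler_norml /a (rS m) => /andP[? ?]; lra.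
have cS m : c m.+1 <= c m.
  by have := xC m; rewrite ler_norml /c (rS m) => /andP[? ?]; lra.
have ai m p : a m <= a (m + p)%N.
  by elim: p => [|p IH]; rewrite ?addn0// addnS (le_trans IH).
have ci m p : c (m + p)%N <= c m.
  by elim: p => [|p IH]; rewrite ?addn0// addnS (le_trans _ IH).
have ac m p : a m <= c p.
  apply: (le_trans (ai m p)); apply: (le_trans _ (ci p m)).
  by rewrite addnC /a /c; have := r0 (p + m)%N; lra.
have hs : has_sup (range a).
  by split; [exists (a 0%N), 0%N|exists (c 0%N) => _ [m _ <-]].
exists (sup (range a)) => m.
have h1 : a m <= sup (range a) by apply: ub_le_sup; [case: hs|exists m].
have h2 : sup (range a) <= c m.
  by apply: ge_sup; [case: hs|move=> _ [p _ <-]].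
by rewrite ler_norml; move: h1 h2; rewrite /a /c /r => ? ?; apply/andP; split; lra.
Qed.

Lemma mx_subE p q (A B : 'M[R]_(p, q)) i j : (A - B) i j = A i j - B i j.
Proof. by rewrite !mxE. Qed.

Lemma mx_entry_le p q (A : 'M[R]_(p, q)) i j : `|A i j| <= `|A|.
Proof.
rewrite (_ : `|A| = mx_norm A)// mx_normrE.
by apply/bigmax_geP; right => /=; exists (i, j).
Qed.

Lemma mx_norm_le p q (A : 'M[R]_(p, q)) (c : R) : 0 <= c ->
  (forall i j, `|A i j| <= c) -> `|A| <= c.
Proof.
move=> c0 Ac; rewrite (_ : `|A| = mx_norm A)// mx_normrE; apply/bigmax_leP.
by split => // -[i j] _ /=.
Qed.

Lemma cV_norm_le p (A : 'cV[R]_p) (c : R) : 0 <= c ->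
  (forall i, `|A i 0| <= c) -> `|A| <= c.
Proof. by move=> c0 Ac; apply: mx_norm_le => // i j; rewrite (ord1 j). Qed.

Lemma continuous_entry (V : normedModType R) p (h : V -> 'cV[R]_p) i :
  continuous h -> continuous (fun x => h x i 0 : R).
Proof.
move=> ch; apply/continuous_distP => x e e0.
have [d d0 Hd] := (continuous_distP h).1 ch x e e0.
exists d => // y yx; apply: le_trans (Hd y yx).
by have := mx_entry_le (h y - h x) i 0; rewrite !mxE.
Qed.

Lemma geometric_limit_cV p (x : nat -> 'cV[R]_p) (C : R) : 0 <= C ->
  (forall m, `|x m.+1 - x m| <= C / 2 ^+ m) ->
  exists l, forall m, `|x m - l| <= 2 * C / 2 ^+ m.
Proof.
move=> C0 xC.
have /choice[l Hl] (i : 'I_p) : exists l, forall m, `|x m i 0 - l| <= 2 * C / 2 ^+ m.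
  apply: geometric_limit => m; apply: le_trans (xC m).
  by have := mx_entry_le (x m.+1 - x m) i 0; rewrite !mxE.
exists (\col_i l i) => m; apply: cV_norm_le => [|i].
  by rewrite divr_ge0 ?mulr_ge0// exprn_ge0.
by rewrite !mxE.
Qed.

Lemma exists_half_pow (C e : R) : 0 < e -> exists m : nat, C / 2 ^+ m <= e.
Proof.
move=> e0; exists (Num.truncn (`|C| / e)).+1.
set m := (Num.truncn _).+1.
have hm : `|C| / e <= m%:R by rewrite ltW// /m truncnS_gt.
have h2 : (m%:R : R) <= 2 ^+ m by rewrite -natrX ler_nat ltnW// ltn_expl.
rewrite ler_pdivrMr ?exprn_gt0// (le_trans (ler_norm _))// mulrC -ler_pdivrMr//.
exact: le_trans h2.
Qed.

(** Banach's theorem for the distance sup |x - y| / w, on an arbitrary index set and without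
    building a metric space. [X] is a closed invariant class: continuous functions for Volterra
    equations, [regular] functions of (t, s) for the flow. *)
Lemma weighted_fixpoint (S : Type) p (w : S -> R) (X : (S -> 'cV[R]_p) -> Prop)
    (T : (S -> 'cV[R]_p) -> S -> 'cV[R]_p) (x0 : S -> 'cV[R]_p) (D : R) :
  (forall s, 0 < w s) -> 0 <= D -> X x0 ->
  (forall x, X x -> X (T x)) ->
  (forall s, `|T x0 s - x0 s| <= D * w s) ->
  (forall x y C, 0 <= C -> X x -> X y -> (forall s, `|x s - y s| <= C * w s) ->
     forall s, `|T x s - T y s| <= C / 2 * w s) ->
  (forall x, (forall e, 0 < e -> exists2 y, X y & forall s, `|y s - x s| <= e * w s) ->
     X x) ->
  exists2 x, X x & forall s, T x s = x s.
Proof.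
move=> w0 D0 X0 XT TD Tc Xcl.
pose xs m := iter m T x0.
have Xxs m : X (xs m) by elim: m => // m IH; exact: XT.
have step m s : `|xs m.+1 s - xs m s| <= D / 2 ^+ m * w s.
  elim: m s => [|m IH] s; first by rewrite expr0 divr1; exact: TD.
  have -> : D / 2 ^+ m.+1 = D / 2 ^+ m / 2.
    by rewrite exprS; field; rewrite expf_neq0.
  by apply: (Tc (xs m.+1) (xs m)) => //; rewrite divr_ge0// exprn_ge0.
have /choice[x Hx] s : exists l, forall m, `|xs m s - l| <= 2 * (D * w s) / 2 ^+ m.
  apply: geometric_limit_cV => [|m]; first by rewrite mulr_ge0// ltW.
  by rewrite mulrAC; exact: step.
have cx e : 0 < e -> exists m, forall s, `|xs m s - x s| <= e * w s.
  move=> e0; have [m Hm] := exists_half_pow (2 * D) e0; exists m => s.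
  by rewrite (le_trans (Hx s m))// mulrA mulrAC ler_wpM2r// ltW.
have Xx : X x by apply: Xcl => e /cx[m Hm]; exists (xs m).
(* Only a pointwise identity is left, so the index m may depend on s: both T x - x_(m+1) and x_(m+1)
   - x are small at s. *)
exists x => // s; apply/eqP; rewrite -subr_eq0 -normr_le0; apply/ler_addgt0Pr => e e0.
rewrite add0r.
have e4 : 0 < e / 4 / w s by rewrite !divr_gt0.
have [m Hm] := exists_half_pow (2 * D) e4.
have h m' s' : `|xs m' s' - x s'| <= (2 * D / 2 ^+ m') * w s'.
  by rewrite (le_trans (Hx s' m'))// mulrA mulrAC.
have h1 : `|T x s - xs m.+1 s| <= 2 * D / 2 ^+ m / 2 * w s.
  rewrite distrC; apply: (Tc (xs m) x) => //.
  by rewrite divr_ge0 ?mulr_ge0// exprn_ge0.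
have h2 := h m.+1 s.
have a0 : 0 <= 2 * D / 2 ^+ m by rewrite divr_ge0 ?mulr_ge0// exprn_ge0.
have h3 : 2 * D / 2 ^+ m.+1 = 2 * D / 2 ^+ m / 2.
  by rewrite exprS; field; rewrite expf_neq0.
rewrite h3 in h2.
have h4 : 2 * D / 2 ^+ m * w s <= e / 4 by rewrite -ler_pdivlMr.
have := ler_distD (xs m.+1 s) (T x s) (x s).
by move: h1 h2 h4; set A := 2 * D / 2 ^+ m; move=> h1 h2 h4 h5; lra.
Qed.

End FixedPoint.

(** * Hoelder and Gronwall estimates for Volterra kernels *)

Section Volterra.
Variable R : realType.
Local Notation mu := (@lebesgue_measure R).
Local Notation I01 := (`[0%R, 1%R]%classic : set R).
Implicit Types (s t : R) (b : bool).

(** Projection onto [0, 1]. Precomposition with it extends a function from [0, 1] to the line and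
    keeps its modulus of continuity; it later doubles as a cut-off profile. *)
Definition clamp t : R := Num.min 1 (Num.max 0 t).

Lemma clamp01 t : 0 <= clamp t <= 1.
Proof. by rewrite /clamp le_min ler01 le_max lexx/= ge_min lexx. Qed.

Lemma clamp_id t : 0 <= t <= 1 -> clamp t = t.
Proof. by move=> /andP[t0 t1]; rewrite /clamp max_r// min_r. Qed.

Lemma clamp_lip t s : `|clamp t - clamp s| <= `|t - s|.
Proof.
rewrite /clamp /Num.min /Num.max.
have H1 := ler_norm (t - s); have H2 := ler_norm (- (t - s)); rewrite normrN in H2.
case: (ltP 0 t) => ?; case: (ltP 0 s) => ?; case: (ltP 1 t) => ?; case: (ltP 1 s) => ?;
  by rewrite ?ltr10 ler_norml; apply/andP; split; lra.
Qed.

Lemma holder_continuous (V : normedModType R) (f : R -> V) (C : R) :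
  (forall t s, `|f t - f s| <= C * Num.sqrt `|t - s|) -> continuous f.
Proof.
move=> fC; apply/continuous_distP => x e e0.
have c0 : 0 < `|C| + 1 by rewrite ltr_wpDl.
exists ((e / (`|C| + 1)) ^+ 2); first by rewrite exprn_gt0// divr_gt0.
move=> y yx; apply: (le_trans (fC _ _)).
have h : Num.sqrt `|y - x| <= e / (`|C| + 1).
  have ec0 : 0 <= e / (`|C| + 1) by rewrite ltW// divr_gt0.
  apply: (@le_trans _ _ (Num.sqrt ((e / (`|C| + 1)) ^+ 2))).
    by rewrite ler_wsqrtr// ltW.
  by rewrite sqrtr_sqr ger0_norm.
apply: (@le_trans _ _ ((`|C| + 1) * (e / (`|C| + 1)))); last first.
  by rewrite mulrCA mulfV ?gt_eqF// mulr1.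
apply: (le_trans _ (ler_wpM2l (ltW c0) h)).
by rewrite ler_wpM2r ?sqrtr_ge0// (le_trans (ler_norm _))// lerDl.
Qed.

(** The two kernels differ by the indicator of an interval of length |t - s|, up to sign, and its
    L^2 norm is the square root of that length; Cauchy-Schwarz does the rest. The 1/2-Hoelder bounds
    on trajectories and adjoint states originate here. *)
Lemma int01_ker_holder b (f : R -> R) (a : R) t s : L2 f -> 0 <= a -> n2 f <= a ^+ 2 ->
  0 <= t <= 1 -> 0 <= s <= 1 ->
  `|int01 (fun r => ker b t r * f r) - int01 (fun r => ker b s r * f r)|
    <= a * Num.sqrt `|t - s|.
Proof.
move=> Lf a0 fa; wlog st : t s / s <= t => [H t01 s01|t01 s01].
  have [/H|/ltW/H] := leP s t; first exact.
  by rewrite distrC (distrC t); apply.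
have i1 (r : R) := bmeas_L1 (bmeas_ker b r) (L2_L1 Lf).
have Lk (r : R) : L1 (ker b r) by exact/L1_bmeas/bmeas_ker.
rewrite -int01B// (@eq_int01 _ _ (fun r => f r * (ker b t r - ker b s r))); last first.
  by move=> r _; ring.
apply: int01_CS_abs => //; first by apply: L2B; exact/bmeas_L2/bmeas_ker.
rewrite sqr_sqrtr// ger0_norm ?subr_ge0//.
have intk (r : R) : 0 <= r <= 1 -> int01 (ker b r) = if b then r else 1 - r.
  move=> r01; have /andP[r0 r1] := r01.
  rewrite (@eq_int01 _ _ (fun s => ker b r s * 1)); last by move=> ? _; rewrite mulr1.
  rewrite int01_ker//; case: (b).
    transitivity (1 * fine (mu `[0, r]%classic)); first exact: Rintegral_cst.
    rewrite lebesgue_measure_itv/= lte_fin; case: ltP; rewrite ?mul1r/= ?subr0// => ?.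
    by apply/eqP; rewrite eq_le r0.
  transitivity (1 * fine (mu `[r, 1]%classic)); first exact: Rintegral_cst.
  rewrite lebesgue_measure_itv/= lte_fin; case: ltP; rewrite ?mul1r//= => ?.
  by apply/eqP; rewrite eq_le subr_ge0 r1/= subr_le0.
(* The difference of the two indicators has a constant sign, fixed by [b], and values of modulus 0
   or 1: its square is itself or its opposite. *)
rewrite /n2 (@eq_int01 _ _ (fun r => if b then ker b t r - ker b s r else ker b s r - ker b t r)).
  by case: (b) in intk i1 Lk *; rewrite int01B// !intk//; lra.
move=> r _; rewrite /ker; case: (b).
  have [rt|rt] := leP r t; have [rs|rs] := leP r s; rewrite ?subrr ?expr0n ?subr0 ?expr1n//.
  by have := le_lt_trans rs (le_lt_trans st rt); rewrite ltxx.
have [rt|rt] := leP t r; have [rs|rs] := leP s r; rewrite ?subrr ?expr0n ?subr0 ?sub0r ?sqrrN ?expr1n//.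
by have := le_lt_trans st (le_lt_trans rt rs); rewrite ltxx.
Qed.

(** Absorption at a maximum instead of iteration: where h / w attains its maximum S, the integral is
    at most half of S w, so S w <= 2 A there. Since 1 <= w <= exp(lam), the constant is 2 exp(lam);
    it depends on [m] only through [M]. *)
Lemma gronwall b (M : R) : 0 <= M -> exists2 C : R, 0 <= C &
  forall (m h : R -> R) (A : R), L2 m -> (forall s, 0 <= s <= 1 -> 0 <= m s) -> n2 m <= M ->
  continuous h -> 0 <= A ->
  (forall t, 0 <= t <= 1 -> h t <= A + int01 (fun s => ker b t s * (m s * h s))) ->
  forall t, 0 <= t <= 1 -> h t <= C * A.
Proof.
move=> M0; set lam := 2 * M + 1; have l0 : 0 <= lam by rewrite /lam; lra.
pose w := weight b lam; have wb s := @weight_bounds R b lam s l0.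
have w0 s : 0 < w s by exact: expR_gt0.
have cw : continuous w by exact: continuous_weight.
exists (2 * expR lam); first by rewrite mulr_ge0// expR_ge0.
move=> m h A Lm m0 mM ch A0 Hh.
have chw : continuous (fun s => h s / w s).
  move=> x; apply: cvgM; first exact: ch.
  by apply: cvgV; [rewrite gt_eqF|exact: cw].
have [c] := EVT_max ler01 (continuous_subspaceT chw).
rewrite in_itv/= => c01 Hc; set S := h c / w c in Hc.
have hS s : 0 <= s <= 1 -> h s <= S * w s.
  by move=> s01; rewrite -ler_pdivrMr//; apply: Hc; rewrite in_itv.
have bh : bmeas h by exact: bmeas_continuous.
have bw : bmeas w by exact: bmeas_continuous.
have Li f : bmeas f -> L1 (fun s => ker b c s * (m s * f s)).
  move=> bf; apply: bmeas_L1; first exact: bmeas_ker.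
  by apply: eq_L1 (bmeas_L1 bf (L2_L1 Lm)) => s _; rewrite mulrC.
have SA : S * w c <= A + S * int01 (fun s => ker b c s * (m s * w s)).
  rewrite {1}/S divfK ?gt_eqF//; apply: (le_trans (Hh c c01)).
  rewrite lerD2l -int01Z; last exact: Li.
  apply: le_int01; [exact: Li|exact/L1Z/Li|] => s s01.
  rewrite [leRHS]mulrCA; apply: ler_wpM2l; first exact: ker_ge0.
  by rewrite [leRHS]mulrCA; apply: ler_wpM2l; [exact: m0|exact: hS].
(* If S <= 0 then h <= 0 on [0, 1]; otherwise S may multiply the contraction estimate. *)
move=> t t01; have [S0|S0] := leP S 0.
  apply: (le_trans (hS t t01)); apply: (@le_trans _ _ 0).
    by rewrite pmulr_lle0.
  by rewrite !mulr_ge0// expR_ge0.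
have hw := int01_ker_weight_contraction b M0 Lm mM c01.
have S2 : S * w c <= 2 * A.
  have : S * w c <= A + S * (w c / 2).
    by apply: (le_trans SA); rewrite lerD2l; apply: ler_wpM2l => //; exact: ltW.
  by move=> ?; lra.
apply: (le_trans (hS t t01)).
have /andP[wc1 _] := wb c c01; have /andP[_ wt] := wb t t01.
have SS : S <= 2 * A by apply: le_trans S2; rewrite ler_peMr// ltW.
rewrite [leRHS]mulrAC; apply: ler_pM => //; [exact: ltW|exact: ltW (w0 t)].
Qed.

Variable k : nat.

(** The l^1 norm of a control value: it is dual to the maximum of entries that norms matrices here,
    so [mulmx_le] holds without a dimensional constant. *)
Definition en (v : 'cV[R]_k) : R := \sum_(j < k) `|v j 0|.

Lemma en_ge0 v : 0 <= en v. Proof. by apply: sumr_ge0. Qed.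

Lemma mulmx_le n (A : 'M[R]_(n, k)) v i : `|(A *m v) i 0| <= `|A| * en v.
Proof.
rewrite mxE (le_trans (ler_norm_sum _ _ _))// /en mulr_sumr ler_sum// => j _.
by rewrite normrM ler_wpM2r// mx_entry_le.
Qed.

Lemma L2_en (u : ctrl R k) : inL2 u -> L2 (fun s => en (u s)).
Proof. by move=> Lu; apply: L2_sum => j; exact: L2_abs. Qed.

(** Cauchy-Schwarz against the constant vector, by induction: given S^2 <= P Q, the new cross term
    satisfies P (2 S x) <= P (Q + P x^2) because (S - P x)^2 >= 0. *)
Lemma sqr_sum_le p (a : 'I_p -> R) :
  (\sum_(i < p) a i) ^+ 2 <= p%:R * \sum_(i < p) a i ^+ 2.
Proof.
elim: p a => [|p IH] a; first by rewrite !big_ord0 expr0n mul0r.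
rewrite !big_ord_recr/=; set S := \sum_(i < p) _; set Q := \sum_(i < p) _ ^+ 2.
have SQ : S ^+ 2 <= p%:R * Q by exact: IH.
have Q0 : 0 <= Q by apply: sumr_ge0 => i _; exact: sqr_ge0.
rewrite -natr1; have : (0 : R) <= p%:R by [].
move: SQ; set P := p%:R; set x := a _; clearbody S Q => SQ.
rewrite le_eqVlt => /predU1P[P0|p0].
  have S0 : S = 0 by apply/eqP; rewrite -sqrf_eq0 eq_le sqr_ge0 andbT; move: SQ; rewrite -P0 mul0r.
  by rewrite S0 -P0; nra.
suff : 2 * S * x <= Q + P * x ^+ 2 by move: SQ; nra.
rewrite -(ler_pM2l p0).
by have := sqr_ge0 (S - P * x); nra.
Qed.

Lemma ipL2_ge0 (u : ctrl R k) : 0 <= ipL2 u u.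
Proof. by apply: int01_ge0 => s _; apply: sumr_ge0 => j _; rewrite -expr2 sqr_ge0. Qed.

Lemma normL2_ge0 (u : ctrl R k) : 0 <= normL2 u. Proof. exact: sqrtr_ge0. Qed.

Lemma normL2_sqr (u : ctrl R k) : normL2 u ^+ 2 = ipL2 u u.
Proof. by rewrite sqr_sqrtr// ipL2_ge0. Qed.

(** [sqr_sum_le] gives the factor k on squares; it is weakened to k^2 so that the bound is the
    square of k |u|. *)
Lemma n2_en (u : ctrl R k) : inL2 u -> n2 (fun s => en (u s)) <= (k%:R * normL2 u) ^+ 2.
Proof.
move=> Lu; rewrite exprMn normL2_sqr.
have i2 : L1 (fun s => \sum_(j < k) (u s j 0) ^+ 2).
  by apply: L1_sum => j; exact: L2_sq.
have -> : ipL2 u u = int01 (fun s => \sum_(j < k) (u s j 0) ^+ 2).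
  by apply: eq_int01 => s _; apply: eq_bigr => j _; rewrite expr2.
rewrite -int01Z//; apply: le_int01; [exact/L2_sq/L2_en|exact: L1Z|] => s _.
rewrite /en (le_trans (sqr_sum_le _))//.
under eq_bigr do rewrite real_normK ?num_real//.
apply: ler_wpM2r; first by apply: sumr_ge0 => j _; exact: sqr_ge0.
by rewrite -natrX ler_nat; case: (k) => // p; rewrite expnS expn1 leq_pmulr.
Qed.

Lemma int01_en (u : ctrl R k) : inL2 u -> int01 (fun s => en (u s)) <= k%:R * normL2 u.
Proof.
move=> Lu; have := int01_CS_abs (L2_cst 1) (L2_en Lu) ler01
  (mulr_ge0 (ler0n _ k) (normL2_ge0 u)).
rewrite mul1r => H; apply: (le_trans (ler_norm _)).
rewrite (@eq_int01 _ _ (fun s => 1 * en (u s))); last by move=> ? _; rewrite mul1r.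
apply: H; last exact: n2_en.
by rewrite /n2 (@eq_int01 _ _ (fun=> 1)) ?int01_cst ?expr1n// => s _; rewrite expr1n.
Qed.

End Volterra.

(** * Volterra equations with an L^2 control *)

Section VolterraExistence.
Variables (R : realType) (k n : nat) (b : bool).
Variables (M : R -> 'cV[R]_n -> 'M[R]_(n, k)) (u : ctrl R k).
Hypothesis Lu : inL2 u.

(** [M] depends on time and state: with [F] this is the state equation, with [Madj x] the adjoint
    one. The clamp makes the result a function on the whole line, Hoelder there as well. *)
Definition volterra (y0 : 'cV[R]_n) (y : R -> 'cV[R]_n) (t : R) : 'cV[R]_n :=
  \col_i (y0 i 0 + int01 (fun s => ker b (clamp t) s * (M s (y s) *m u s) i 0)).

Definition bmeas_mx (y : R -> 'cV[R]_n) := forall i j, bmeas (fun s => M s (y s) i j).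

Lemma L2_mulmx y i : bmeas_mx y -> L2 (fun s => (M s (y s) *m u s) i 0).
Proof.
move=> bM.
rewrite (_ : (fun s => _) = (fun s => \sum_j M s (y s) i j * u s j 0)); last first.
  by apply/funext => s; rewrite mxE.
by apply: L2_sum => j; exact: L2M.
Qed.

Lemma L1_ker_mulmx y t i : bmeas_mx y ->
  L1 (fun s => ker b t s * (M s (y s) *m u s) i 0).
Proof. by move=> bM; apply: bmeas_L1; [exact: bmeas_ker|exact/L2_L1/L2_mulmx]. Qed.

Lemma n2_mulmx y (C : R) i : bmeas_mx y -> 0 <= C ->
  (forall s, 0 <= s <= 1 -> `|M s (y s)| <= C) ->
  n2 (fun s => (M s (y s) *m u s) i 0) <= (C * (k%:R * normL2 u)) ^+ 2.
Proof.
move=> bM C0 MC; rewrite exprMn.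
apply: le_trans (ler_wpM2l (sqr_ge0 C) (n2_en Lu)).
have Le := L2_sq (L2_en Lu).
rewrite -int01Z//; apply: le_int01; [exact/L2_sq/L2_mulmx|exact: L1Z|] => s s01.
rewrite -exprMn -[leLHS]real_normK ?num_real// ler_pXn2r ?nnegrE//; last first.
  by rewrite mulr_ge0// en_ge0.
by apply: (le_trans (mulmx_le _ _ _)); rewrite ler_wpM2r ?en_ge0// MC.
Qed.

Lemma volterra_holder y0 y (C : R) : bmeas_mx y -> 0 <= C ->
  (forall s, 0 <= s <= 1 -> `|M s (y s)| <= C) ->
  forall t s, `|volterra y0 y t - volterra y0 y s| <=
    C * (k%:R * normL2 u) * Num.sqrt `|t - s|.
Proof.
move=> bM C0 MC t s.
have a0 : 0 <= C * (k%:R * normL2 u) by rewrite !mulr_ge0// normL2_ge0.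
apply: cV_norm_le => [|i]; first by rewrite mulr_ge0// sqrtr_ge0.
rewrite !mxE opprD addrACA subrr add0r.
apply: (le_trans (int01_ker_holder b (L2_mulmx i bM) a0 (n2_mulmx i bM C0 MC)
  (clamp01 t) (clamp01 s))).
by rewrite ler_wpM2l// ler_wsqrtr// clamp_lip.
Qed.

Lemma volterra_bound y0 y (C : R) : bmeas_mx y -> 0 <= C ->
  (forall s, 0 <= s <= 1 -> `|M s (y s)| <= C) ->
  forall t, `|volterra y0 y t - y0| <= C * (k%:R * normL2 u).
Proof.
move=> bM C0 MC t.
have a0 : 0 <= C * (k%:R * normL2 u) by rewrite !mulr_ge0// normL2_ge0.
apply: cV_norm_le => // i; rewrite !mxE addrAC subrr add0r.
apply: le_trans (ler_wpM2l C0 (int01_en Lu)).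
have Le := L2_L1 (L2_en Lu).
rewrite -int01Z//; apply: int01_abs_le; [exact: L1_ker_mulmx|exact: L1Z|] => s s01.
rewrite normrM (ger0_norm (ker_ge0 _ _ _)).
apply: (@le_trans _ _ (`|(M s (y s) *m u s) i 0|)).
  by rewrite ler_piMl// ker_le1.
by apply: (le_trans (mulmx_le _ _ _)); rewrite ler_wpM2r ?en_ge0// MC.
Qed.

Lemma bmeas_mx_bounded y : bmeas_mx y ->
  exists2 C : R, 0 <= C & forall s, 0 <= s <= 1 -> `|M s (y s)| <= C.
Proof.
move=> bM.
have /choice[c Hc] (ij : 'I_n * 'I_k) : exists C : R, forall s, 0 <= s <= 1 ->
    `|M s (y s) ij.1 ij.2| <= C.
  by have [_] := bM ij.1 ij.2.
exists (\sum_ij `|c ij|); first exact: sumr_ge0.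
move=> s s01; apply: mx_norm_le; first exact: sumr_ge0.
move=> i j; rewrite (bigD1 (i, j))//= (le_trans (Hc (i, j) s s01))//.
by rewrite (le_trans (ler_norm _))// lerDl sumr_ge0.
Qed.

(** The Lipschitz kernel is m = L |u|_1, which is only square integrable: exactly what the weighted
    contraction estimate admits. *)
Theorem volterra_exists (L : R) (y0 : 'cV[R]_n) : 0 <= L ->
  (forall s x y, 0 <= s <= 1 -> `|M s x - M s y| <= L * `|x - y|) ->
  (forall y, continuous y -> bmeas_mx y) ->
  exists2 y, continuous y & forall t, y t = volterra y0 y t.
Proof.
move=> L0 ML bM.
pose m s := L * en (u s).
have Lm : L2 m by exact/L2Z/L2_en.
set lam := 2 * n2 m + 1; have l0 : 0 <= lam by rewrite addr_ge0// mulr_ge0// n2_ge0.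
(* Frozen outside [0, 1], the weight stays between 1 and [expR lam] on the line, so weighted
   convergence is uniform and preserves continuity. *)
pose w t := weight b lam (clamp t).
have wb t := weight_bounds b l0 (clamp01 t).
have w0 t : 0 < w t by exact: expR_gt0.
have ccst : continuous (fun _ : R => y0) by move=> ?; exact: cvg_cst.
have [C C0 MC] := bmeas_mx_bounded (bM _ ccst).
have a0 : 0 <= C * (k%:R * normL2 u) by rewrite !mulr_ge0// normL2_ge0.
have [||||y cy Hy] := @weighted_fixpoint R R n w (fun y => continuous y)
  (volterra y0) (fun=> y0) (C * (k%:R * normL2 u))
  w0 a0 ccst; last by exists y => // t; rewrite Hy.
- move=> y /bM by_; have [C' C'0 MC'] := bmeas_mx_bounded by_.
  exact: holder_continuous (volterra_holder _ by_ C'0 MC').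
- move=> s; apply: (le_trans (volterra_bound _ (bM _ ccst) C0 MC s)).
  by rewrite ler_peMr//; case/andP: (wb s).
- move=> x y c c0 cx cy xy t.
  have h := int01_ker_weight_contraction b (n2_ge0 m) Lm (lexx _) (clamp01 t).
  apply: (@le_trans _ _ (c * (w t / 2))); last by rewrite mulrA mulrAC.
  apply: (le_trans _ (ler_wpM2l c0 h)).
  have i1 : L1 (fun s => ker b (clamp t) s * (m s * weight b lam s)).
    apply: bmeas_L1; first exact: bmeas_ker.
    have := bmeas_L1 (bmeas_continuous (@continuous_weight R b lam)) (L2_L1 Lm).
    by apply: eq_L1 => s _; rewrite mulrC.
  rewrite -int01Z//.
  apply: cV_norm_le => [|i].
    apply: int01_ge0 => s s01; rewrite !mulr_ge0 ?ker_ge0 ?en_ge0//.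
    exact: expR_ge0.
  rewrite !mxE opprD addrACA subrr add0r.
  have bx := bM _ cx; have by_ := bM _ cy.
  rewrite -int01B; [|exact: L1_ker_mulmx..].
  apply: int01_abs_le; [by apply: L1B; exact: L1_ker_mulmx|exact: L1Z|] => s s01.
  rewrite -mulrBr normrM (ger0_norm (ker_ge0 _ _ _)) mulrCA.
  apply: ler_wpM2l; first exact: ker_ge0.
  have -> : (M s (x s) *m u s) i 0 - (M s (y s) *m u s) i 0 =
    ((M s (x s) - M s (y s)) *m u s) i 0 by rewrite mulmxBl !mxE.
  apply: (le_trans (mulmx_le _ _ _)).
  have -> : c * (m s * weight b lam s) = L * (c * w s) * en (u s).
    by rewrite /m /w clamp_id//; ring.
  apply: ler_wpM2r; first exact: en_ge0.
  by apply: (le_trans (ML _ _ _ s01)); apply: ler_wpM2l.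
- move=> x Hx; apply/continuous_distP => t e e0.
  have d0 : 0 < e / 3 / expR lam by rewrite !divr_gt0// expR_gt0.
  have [y cy yx] := Hx _ d0.
  have yx' s : `|y s - x s| <= e / 3.
    apply: (le_trans (yx s)); rewrite mulrAC ler_pdivrMr ?expR_gt0//.
    by apply: ler_wpM2l; [rewrite divr_ge0// ltW|case/andP: (wb s)].
  have [d dp Hd] := (continuous_distP y).1 cy t (e / 3) (divr_gt0 e0 (ltr0n _ 3)).
  exists d => // s st.
  have := Hd s st; have := yx' s; have := yx' t.
  have := ler_distD (y s) (x s) (x t); have := ler_distD (y t) (y s) (x t).
  by rewrite (distrC (x s) (y s)) => *; lra.
Qed.

End VolterraExistence.

(** * Exchange of integrals over a triangle *)

Section Fubini01.
Variable R : realType.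
Local Notation mu := (@lebesgue_measure R).
Local Notation I01 := (`[0%R, 1%R]%classic : set R).
Implicit Types (f g : R -> R).

Let patched f (q : R -> R) :
  (\int[mu]_x (((f \_ I01) x * q x)%:E) = \int[mu]_(x in I01) ((f x * q x)%:E))%E.
Proof.
rewrite [RHS]integral_mkcond; apply: eq_integral => x _.
by rewrite !patchE; case: ifP => // _; rewrite mul0r.
Qed.

Let integral_int01 f : L1 f -> (\int[mu]_(x in I01) (f x)%:E = (int01 f)%:E)%E.
Proof.
move=> Lf; rewrite /int01 /Rintegral fineK//.
exact: (@integrable_fin_num _ _ _ mu I01 (measurable_itv _) (EFin \o f) Lf).
Qed.

(** Fubini for f(t) g(s) on s <= t, whose indicator is both [ker true t s] and [ker false s t]. It
    takes the place of integration by parts and needs no derivative. *)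
Lemma int01_triangle f g : L1 f -> L1 g ->
  int01 (fun t => f t * int01 (fun s => ker true t s * g s)) =
  int01 (fun s => g s * int01 (fun t => ker false s t * f t)).
Proof.
move=> Lf Lg; pose f0 := f \_ I01; pose g0 := g \_ I01.
pose h (p : R * R) := f0 p.1 * (g0 p.2 * ker true p.1 p.2).
have mp (q : R -> R) : L1 q -> measurable_fun setT (q \_ I01).
  by move=> /L1_meas; apply: (measurable_restrictT _ _).1; exact: measurable_itv.
have mk : measurable_fun setT (fun p : R * R => ker true p.1 p.2).
  rewrite (_ : (fun p => _) = \1_(`[0, +oo[%classic) \o (fun p : R * R => p.1 - p.2)).
    apply: measurableT_comp; first exact: measurable_indic.
    exact: measurable_funB.
  apply/funext => -[x y] /=; rewrite indicE /ker; congr (nat_of_bool _)%:R.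
  by apply/idP/idP; rewrite inE/= in_itv/= andbT subr_ge0.
have mh : measurable_fun setT h.
  apply: measurable_funM; first by apply: measurableT_comp => //; exact: mp.
  by apply: measurable_funM => //; apply: measurableT_comp => //; exact: mp.
have L1k b (t : R) (q : R -> R) : L1 q -> L1 (fun s => ker b t s * q s).
  by move=> ?; apply: bmeas_L1 => //; exact: bmeas_ker.
have ip (q : R -> R) : L1 q -> mu.-integrable setT (EFin \o (q \_ I01)).
  move=> Lq; rewrite -restrict_EFin.
  by apply/(integrable_mkcond _ _).1 => //; exact: measurable_itv.
have ih : (mu \x mu)%E.-integrable setT (EFin \o h).
  apply/integrable12ltyP; first exact/measurable_EFinP.
  have mabs (q : R -> R) : L1 q -> measurable_fun setT (fun x => `|(q \_ I01) x|%:E).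
    by move=> Lq; apply/measurable_EFinP/measurableT_comp => //; exact: mp.
  set Cg := (\int[mu]_y `|g0 y|%:E)%E.
  have Cgoo : (Cg < +oo)%E by have /integrableP[] := ip _ Lg.
  have Cfoo : (\int[mu]_y `|f0 y|%:E < +oo)%E by have /integrableP[] := ip _ Lf.
  have Cg0 : (0 <= Cg)%E by apply: integral_ge0 => y _; rewrite lee_fin.
  (* The kernel is at most 1, so |h| is dominated by the tensor product |f0| |g0|, whose integral is
     finite. *)
  apply: (@le_lt_trans _ _ (\int[mu]_x (`|f0 x|%:E * Cg))%E).
    apply: ge0_le_integral => //.
    - by move=> x _; apply: integral_ge0 => y _; rewrite lee_fin.
    - apply: (@measurable_fun_fubini_tonelli_F _ _ _ _ R mu (abse \o (EFin \o h))).
        by apply: measurableT_comp => //; exact/measurable_EFinP.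
      by move=> p; rewrite /= lee_fin.
    - by apply: emeasurable_funM => //; exact: mabs.
    - move=> x _; rewrite -ge0_integralZl//; [|exact: mabs].
      apply: ge0_le_integral => //.
      + apply: measurableT_comp => //; apply/measurable_EFinP.
        have := @measurable_fun_pair2 _ _ _ _ _ _ h x mh; exact.
      + by apply: emeasurable_funM => //; exact: mabs.
      + move=> y _; rewrite /= -EFinM lee_fin !normrM ler_wpM2l//.
        by rewrite ler_piMr// ger0_norm ?ker_ge0// ker_le1.
  rewrite ge0_integralZr//; last exact: mabs.
  by apply: lte_mul_pinfty => //; rewrite ?integral_ge0// ge0_fin_numE// integral_ge0.
have E1 x : (\int[mu]_y (h (x, y))%:E = (f0 x * int01 (fun s => ker true x s * g s))%:E)%E.
  rewrite EFinM -integral_int01 ?L1k// [in RHS]integral_mkcond.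
  have ix : mu.-integrable setT (EFin \o (fun y => g0 y * ker true x y)).
    have := ip _ (L1k true x g Lg); apply: eq_integrable => // y _ /=.
    by rewrite /g0 !patchE; case: ifP; rewrite ?mul0r// mulrC.
  rewrite /h /=; under eq_integral do rewrite EFinM.
  rewrite integralZl//; congr (_ * _)%E; apply: eq_integral => y _.
  by rewrite /g0 !patchE; case: ifP; rewrite ?mul0r// mulrC.
have E2 y : (\int[mu]_x (h (x, y))%:E = (g0 y * int01 (fun t => ker false y t * f t))%:E)%E.
  rewrite EFinM -integral_int01 ?L1k// [in RHS]integral_mkcond.
  have ix : mu.-integrable setT (EFin \o (fun x => f0 x * ker false y x)).
    have := ip _ (L1k false y f Lf); apply: eq_integrable => // x _ /=.
    by rewrite /f0 !patchE; case: ifP; rewrite ?mul0r// mulrC.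
  rewrite /h /=; under eq_integral do rewrite mulrCA EFinM.
  rewrite integralZl//; congr (_ * _)%E; apply: eq_integral => x _.
  by rewrite /f0 !patchE; case: ifP; rewrite ?mul0r// mulrC.
have := Fubini ih; rewrite /=.
under eq_integral do rewrite E1.
under [X in _ = X]eq_integral do rewrite E2.
by rewrite !patched// /int01 /Rintegral => ->.
Qed.
End Fubini01.

(** * The control space and the trajectories *)

Section CtrlL2.
Variables (R : realType) (k : nat).
Implicit Types (u v w : ctrl R k) (c : R).

Definition csubL2 u v := caddL2 u (coppL2 v).

(** Controls are functions, not classes: linear identities between them are proved pointwise by
    [ring] and can be rewritten as equalities. *)
Lemma ctrl_ext u v : (forall s i, u s i 0 = v s i 0) -> u = v.
Proof. by move=> H; apply/funext => s; apply/matrixP => i j; rewrite (ord1 j). Qed.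

Lemma inL2D u v : inL2 u -> inL2 v -> inL2 (caddL2 u v).
Proof.
move=> Lu Lv i; have := L2D (Lu i) (Lv i).
by rewrite (_ : (fun s => u s i 0 + v s i 0) = (fun s => caddL2 u v s i 0))//;
  apply/funext => s; rewrite mxE.
Qed.

Lemma inL2Z c u : inL2 u -> inL2 (cscaleL2 c u).
Proof.
move=> Lu i; have := L2Z c (Lu i).
by rewrite (_ : (fun s => c * u s i 0) = (fun s => cscaleL2 c u s i 0))//;
  apply/funext => s; rewrite mxE.
Qed.

Lemma coppE u : coppL2 u = cscaleL2 (-1) u.
Proof. by apply/funext => s; rewrite /cscaleL2 scaleN1r. Qed.

Lemma inL2N u : inL2 u -> inL2 (coppL2 u).
Proof. by rewrite coppE; exact: inL2Z. Qed.

Lemma inL2B u v : inL2 u -> inL2 v -> inL2 (csubL2 u v).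
Proof. by move=> Lu Lv; apply: inL2D => //; exact: inL2N. Qed.

Lemma L1_dot u v : inL2 u -> inL2 v -> L1 (fun s => dotv (u s) (v s)).
Proof. by move=> Lu Lv; apply: L1_sum => j; exact: L2_mul. Qed.

Lemma ipL2C u v : ipL2 u v = ipL2 v u.
Proof. by apply: eq_int01 => s _; apply: eq_bigr => i _; rewrite mulrC. Qed.

Lemma ipL2Dl u v w : inL2 u -> inL2 v -> inL2 w ->
  ipL2 (caddL2 u v) w = ipL2 u w + ipL2 v w.
Proof.
move=> Lu Lv Lw; rewrite -[RHS]int01D; [|exact: L1_dot..].
apply: eq_int01 => s _; rewrite /dotv -big_split/=; apply: eq_bigr => i _.
by rewrite mxE mulrDl.
Qed.

Lemma ipL2Zl c u w : inL2 u -> inL2 w -> ipL2 (cscaleL2 c u) w = c * ipL2 u w.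
Proof.
move=> Lu Lw; rewrite -[RHS]int01Z; last exact: L1_dot.
apply: eq_int01 => s _; rewrite /dotv mulr_sumr; apply: eq_bigr => i _.
by rewrite mxE mulrA.
Qed.

Lemma ipL2Dr u v w : inL2 u -> inL2 v -> inL2 w ->
  ipL2 w (caddL2 u v) = ipL2 w u + ipL2 w v.
Proof. by move=> Lu Lv Lw; rewrite !(ipL2C w) ipL2Dl. Qed.

Lemma ipL2Zr c u w : inL2 u -> inL2 w -> ipL2 w (cscaleL2 c u) = c * ipL2 w u.
Proof. by move=> Lu Lw; rewrite !(ipL2C w) ipL2Zl. Qed.

Lemma ipL2Bl u v w : inL2 u -> inL2 v -> inL2 w ->
  ipL2 (csubL2 u v) w = ipL2 u w - ipL2 v w.
Proof.
move=> Lu Lv Lw.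
by rewrite /csubL2 coppE ipL2Dl ?ipL2Zl ?mulN1r//; exact: inL2Z.
Qed.

Lemma ipL2Br u v w : inL2 u -> inL2 v -> inL2 w ->
  ipL2 w (csubL2 u v) = ipL2 w u - ipL2 w v.
Proof. by move=> Lu Lv Lw; rewrite !(ipL2C w) ipL2Bl. Qed.

Lemma ipL2_CS u v : inL2 u -> inL2 v -> `|ipL2 u v| <= normL2 u * normL2 v.
Proof.
move=> Lu Lv; apply: le_of_sqr_le; first by rewrite mulr_ge0// normL2_ge0.
rewrite real_normK ?num_real// exprMn !normL2_sqr.
apply: quadratic_discriminant; [exact: ipL2_ge0|exact: ipL2_ge0|] => a b.
have := ipL2_ge0 (caddL2 (cscaleL2 a u) (cscaleL2 b v)).
have La := inL2Z a Lu; have Lb := inL2Z b Lv; have Lab := inL2D La Lb.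
rewrite ipL2Dl// !ipL2Dr// !ipL2Zl// !ipL2Zr// (ipL2C v u).
by congr (_ <= _); ring.
Qed.

Lemma normL2D u v : inL2 u -> inL2 v -> normL2 (caddL2 u v) <= normL2 u + normL2 v.
Proof.
move=> Lu Lv; apply: le_of_sqr_le; first by rewrite addr_ge0// normL2_ge0.
rewrite normL2_sqr ipL2Dl ?ipL2Dr//; try exact: inL2D.
rewrite -!normL2_sqr (ipL2C v u).
have := ipL2_CS Lu Lv; rewrite ler_norml => /andP[_ h].
rewrite (_ : (_ + _) ^+ 2 = normL2 u ^+ 2 + normL2 u * normL2 v +
  (normL2 u * normL2 v + normL2 v ^+ 2)); last by ring.
by apply: lerD; rewrite ?lerD2l ?lerD2r.
Qed.

Lemma normL2Z c u : inL2 u -> normL2 (cscaleL2 c u) = `|c| * normL2 u.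
Proof.
move=> Lu; rewrite /normL2 ipL2Zl ?ipL2Zr//; last exact: inL2Z.
by rewrite mulrA -expr2 sqrtrM ?sqr_ge0// sqrtr_sqr.
Qed.

Lemma normL2N u : inL2 u -> normL2 (coppL2 u) = normL2 u.
Proof. by move=> Lu; rewrite coppE normL2Z// normrN1 mul1r. Qed.

Lemma normL2_subC u v : inL2 u -> inL2 v -> normL2 (csubL2 u v) = normL2 (csubL2 v u).
Proof.
move=> Lu Lv; rewrite -normL2N; last exact: inL2B.
by congr normL2; apply: ctrl_ext => s i; rewrite !mxE; ring.
Qed.

Lemma normL2_sub_triangle w u v : inL2 u -> inL2 v -> inL2 w ->
  normL2 (csubL2 u v) <= normL2 (csubL2 u w) + normL2 (csubL2 w v).
Proof.
move=> Lu Lv Lw; apply: le_trans (normL2D (inL2B Lu Lw) (inL2B Lw Lv)).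
rewrite le_eqVlt; apply/orP; left; apply/eqP; congr normL2.
by apply: ctrl_ext => s i; rewrite !mxE; ring.
Qed.

Lemma normL2_dist u v : inL2 u -> inL2 v ->
  `|normL2 u - normL2 v| <= normL2 (csubL2 u v).
Proof.
move=> Lu Lv; rewrite ler_norml; apply/andP; split.
  have := normL2D Lu (inL2B Lv Lu); rewrite (normL2_subC Lu Lv).
  rewrite (_ : caddL2 u (csubL2 v u) = v); first by move=> ?; lra.
  by apply: ctrl_ext => s i; rewrite !mxE; ring.
have := normL2D Lv (inL2B Lu Lv).
rewrite (_ : caddL2 v (csubL2 u v) = u); first by move=> ?; lra.
by apply: ctrl_ext => s i; rewrite !mxE; ring.
Qed.

(** Converts sup bounds on the field into L^2 bounds. The factor k is a weakening of its square root
    and reappears in the Lipschitz constants of the flow. *)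
Lemma normL2_le_sup u c : inL2 u -> 0 <= c ->
  (forall s, 0 <= s <= 1 -> `|u s| <= c) -> normL2 u <= k%:R * c.
Proof.
move=> Lu c0 uc; apply: le_of_sqr_le; first by rewrite mulr_ge0.
rewrite normL2_sqr; apply: (@le_trans _ _ (int01 (fun=> k%:R * c ^+ 2))).
  apply: le_int01; [exact: L1_dot|exact: L1_cst|] => s s01.
  apply: (@le_trans _ _ (\sum_(i < k) c ^+ 2)); last first.
    by rewrite sumr_const card_ord mulr_natl.
  apply: ler_sum => i _; rewrite -expr2 -[leLHS]real_normK ?num_real//.
  rewrite ler_pXn2r ?nnegrE//; exact: le_trans (mx_entry_le _ _ _) (uc s s01).
rewrite int01_cst exprMn; apply: ler_wpM2r; first exact: sqr_ge0.
by rewrite -natrX ler_nat; case: (k) => // p; rewrite expnS expn1 leq_pmulr.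
Qed.

Lemma inL2_continuous u : continuous u -> inL2 u.
Proof.
by move=> cu i; apply/bmeas_L2/bmeas_continuous; exact: continuous_entry.
Qed.

End CtrlL2.

Section VectorIntegral.
Variables (R : realType) (n k : nat).

Lemma L1_ker b (t : R) (q : R -> R) : L1 q -> L1 (fun s => ker b t s * q s).
Proof. by move=> Lq; apply: bmeas_L1 => //; exact: bmeas_ker. Qed.

Lemma int01_ker_le b (t : R) (q : R -> R) : L1 q -> (forall s, 0 <= s <= 1 -> 0 <= q s) ->
  int01 (fun s => ker b t s * q s) <= int01 q.
Proof.
move=> Lq q0; apply: le_int01 => // [|s s01]; first exact: L1_ker.
by rewrite ler_piMl ?ker_le1// q0.
Qed.

Lemma col_int01_le b (t : R) (f : R -> 'cV[R]_n) (g : R -> R) :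
  (forall i, L1 (fun s => f s i 0)) -> L1 g ->
  (forall s, 0 <= s <= 1 -> 0 <= g s) ->
  (forall s i, 0 <= s <= 1 -> `|f s i 0| <= g s) ->
  `|\col_i int01 (fun s => ker b t s * f s i 0)| <= int01 (fun s => ker b t s * g s).
Proof.
move=> Lf Lg g0 fg; apply: cV_norm_le => [|i].
  by apply: int01_ge0 => s s01; rewrite mulr_ge0 ?ker_ge0 ?g0.
rewrite mxE; apply: int01_abs_le; [exact: L1_ker|exact: L1_ker|] => s s01.
by rewrite normrM (ger0_norm (ker_ge0 _ _ _)) ler_wpM2l ?ker_ge0// fg.
Qed.

Lemma bmeas_norm (x : R -> 'cV[R]_n) : continuous x -> bmeas (fun s => `|x s|).
Proof. by move=> cx; apply: bmeas_continuous => s; apply: cvg_norm; exact: cx. Qed.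

Lemma L1_mul_bmeas (f g : R -> R) : L1 f -> bmeas g -> L1 (fun s => f s * g s).
Proof.
by move=> Lf bg; apply: eq_L1 (bmeas_L1 bg Lf) => s _; rewrite mulrC.
Qed.

(** The common form of the a priori estimates: bounds and Lipschitz dependence, for states and for
    adjoint states, are instances with suitable [f], [g] and [c]. The kernel c |u|_1 has squared
    norm at most (c k r)^2, so [C] is fixed before the control. *)
Lemma gronwall_ctrl b (c r : R) : 0 <= c -> exists2 C : R, 0 <= C &
  forall (u : ctrl R k) (z f : R -> 'cV[R]_n) (z0 : 'cV[R]_n) (g : R -> R) (A : R),
  inL2 u -> normL2 u <= r -> continuous z ->
  (forall i, L1 (fun s => f s i 0)) -> L1 g -> (forall s, 0 <= s <= 1 -> 0 <= g s) ->
  (forall s i, 0 <= s <= 1 -> `|f s i 0| <= g s + c * en (u s) * `|z s|) ->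
  (forall t, 0 <= t <= 1 -> z t = z0 + \col_i int01 (fun s => ker b t s * f s i 0)) ->
  `|z0| + int01 g <= A ->
  forall t, 0 <= t <= 1 -> `|z t| <= C * A.
Proof.
move=> c0; have [C C0 HC] := gronwall b (sqr_ge0 (c * (k%:R * r))).
exists C => // u z f z0 g A Lu ur cz Lf Lg g0 fg zE zA t t01.
have n2m : n2 (fun s => c * en (u s)) <= (c * (k%:R * r)) ^+ 2.
  rewrite exprMn; apply: (@le_trans _ _ (c ^+ 2 * n2 (fun s => en (u s)))).
    rewrite -int01Z; last exact/L2_sq/L2_en.
    by rewrite le_eqVlt; apply/orP; left; apply/eqP/eq_int01 => s _; rewrite exprMn.
  apply: ler_wpM2l; first exact: sqr_ge0.
  apply: (le_trans (n2_en Lu)); rewrite !exprMn ler_wpM2l ?sqr_ge0//.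
  by rewrite ler_pXn2r ?nnegrE ?normL2_ge0// (le_trans _ ur)// normL2_ge0.
have Le := L2_L1 (L2_en Lu).
have Lz : L1 (fun s => c * en (u s) * `|z s|).
  by apply: L1_mul_bmeas; [exact: L1Z|exact: bmeas_norm].
apply: (HC (fun s => c * en (u s)) (fun t => `|z t|) A) => //.
- exact/L2Z/L2_en.
- by move=> s _; rewrite mulr_ge0// en_ge0.
- by move=> s; apply: cvg_norm; exact: cz.
- by apply: le_trans zA; rewrite addr_ge0// int01_ge0.
move=> {t01} {}t t01; rewrite zE//; apply: (le_trans (ler_normD _ _)).
apply: le_trans (lerD zA (lexx _)); rewrite -addrA lerD2l.
apply: (@le_trans _ _ (int01 (fun s => ker b t s * (g s + c * en (u s) * `|z s|)))).
  apply: col_int01_le => //; first exact: L1D.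
  by move=> s s01; rewrite addr_ge0 ?g0// !mulr_ge0// en_ge0.
rewrite (@eq_int01 _ _ (fun s => ker b t s * g s + ker b t s * (c * en (u s) * `|z s|))).
  by rewrite int01D; [|exact: L1_ker..]; rewrite lerD2r int01_ker_le.
by move=> s _; rewrite mulrDr.
Qed.

End VectorIntegral.

Section Trajectory.
Variables (R : realType) (n k : nat).
Variables (F : 'cV[R]_n -> 'M[R]_(n, k)) (x0 : 'cV[R]_n) (L : R).
Hypothesis L0 : 0 <= L.
Hypothesis FL : forall x y, `|F x - F y| <= L * `|x - y|.
Implicit Types (u v : ctrl R k) (x y : R -> 'cV[R]_n).

Local Notation volt := (volterra true (fun=> F)).

(** The working form of [is_traj]: continuity on the whole line, so that no subspace topology is
    carried along, while the equation is still asked on [0, 1] only. *)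
Definition traj u x := continuous x /\ forall t, 0 <= t <= 1 -> x t = volt u x0 x t.

Lemma lip_bmeas_mx x : continuous x -> bmeas_mx (fun=> F) x.
Proof.
move=> cx i j; apply/bmeas_continuous/continuous_distP => t e e0.
have L1 : 0 < L + 1 by rewrite ltr_wpDl.
have [d d0 Hd] := (continuous_distP x).1 cx t (e / (L + 1)) (divr_gt0 e0 L1).
exists d => // s st.
have := mx_entry_le (F (x s) - F (x t)) i j; rewrite !mxE => /le_trans; apply.
apply: (le_trans (FL _ _)); apply: (@le_trans _ _ ((L + 1) * `|x s - x t|)).
  by rewrite ler_wpM2r// lerDl.
by rewrite mulrC -ler_pdivlMr// Hd.
Qed.

Lemma traj_exists u : inL2 u -> exists x, traj u x.
Proof.
move=> Lu; have [x cx Hx] := @volterra_exists R k n true (fun=> F) u Lu L x0 L0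
  (fun _ p q _ => FL p q) lip_bmeas_mx.
by exists x.
Qed.

Lemma F_growth (y : 'cV[R]_n) (r : R) : `|y| <= r -> `|F y| <= `|F 0| + L * r.
Proof.
move=> yr; have := ler_normD (F y - F 0) (F 0); rewrite subrK => /le_trans; apply.
by rewrite addrC lerD2l (le_trans (FL _ _))// subr0 ler_wpM2l.
Qed.

Lemma traj_col u x t : continuous x -> 0 <= t <= 1 ->
  volt u x0 x t = x0 + \col_i int01 (fun s => ker true t s * (F (x s) *m u s) i 0).
Proof. by move=> cx t01; apply/matrixP => i j; rewrite !mxE clamp_id// (ord1 j). Qed.

Lemma traj_bounded (r : R) : exists2 C : R, 0 <= C &
  forall u x, inL2 u -> normL2 u <= r -> traj u x ->
  forall t, 0 <= t <= 1 -> `|x t| <= C.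
Proof.
have [C C0 HC] := @gronwall_ctrl R n k true L r L0.
exists (C * (`|x0| + `|F 0| * (k%:R * `|r|))).
  by rewrite !(mulr_ge0, addr_ge0).
move=> u x Lu ur [cx Hx].
have Le := L2_L1 (L2_en Lu).
apply: (HC u x (fun s => F (x s) *m u s) x0 (fun s => `|F 0| * en (u s))) => //.
- by move=> i; apply: L2_L1; exact: (L2_mulmx Lu i (lip_bmeas_mx cx)).
- exact: L1Z.
- by move=> s _; rewrite mulr_ge0// en_ge0.
- move=> s i _; apply: (le_trans (mulmx_le _ _ _)).
  rewrite [L * _ * _]mulrAC -mulrDl ler_wpM2r ?en_ge0//; exact: F_growth.
- by move=> t t01; rewrite Hx// traj_col.
rewrite lerD2l int01Z// ler_wpM2l// (le_trans (int01_en Lu))// ler_wpM2l//.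
by rewrite (le_trans ur)// ler_norm.
Qed.

Lemma traj_F_bounded (r : R) : exists2 C : R, 0 <= C &
  forall u x, inL2 u -> normL2 u <= r -> traj u x ->
  forall t, 0 <= t <= 1 -> `|F (x t)| <= C.
Proof.
have [C C0 HC] := traj_bounded r; exists (`|F 0| + L * C).
  by rewrite addr_ge0// mulr_ge0.
by move=> u x Lu ur xu t t01; apply: F_growth; exact: (HC u).
Qed.

Lemma traj_lip (r : R) : exists2 C : R, 0 <= C &
  forall u v x y, inL2 u -> normL2 u <= r -> traj u x ->
    inL2 v -> normL2 v <= r -> traj v y ->
  forall t, 0 <= t <= 1 -> `|x t - y t| <= C * normL2 (csubL2 u v).
Proof.
have [C C0 HC] := @gronwall_ctrl R n k true L r L0.
have [D D0 HD] := traj_F_bounded r.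
exists (C * (D * k%:R)); first by rewrite !mulr_ge0.
move=> u v x y Lu ur xu Lv vr yv.
have [cx Hx] := xu; have [cy Hy] := yv.
have Luv := inL2B Lu Lv.
have bx := lip_bmeas_mx cx; have by_ := lip_bmeas_mx cy.
have Leuv := L2_L1 (L2_en Luv).
have Fu i := L2_L1 (L2_mulmx Lu i bx); have Fv i := L2_L1 (L2_mulmx Lv i by_).
have fE s i : (F (x s) *m u s - F (y s) *m v s) i 0 =
  (F (x s) *m u s) i 0 - (F (y s) *m v s) i 0 by rewrite mx_subE.
rewrite -[C * _ * _]mulrA -[D * _ * _]mulrA; apply: (HC u (fun t => x t - y t)
  (fun s => F (x s) *m u s - F (y s) *m v s) 0 (fun s => D * en (csubL2 u v s))) => //.
- by move=> s; apply: cvgB; [exact: cx|exact: cy].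
- by move=> i; apply: eq_L1 (L1B (Fu i) (Fv i)) => s _; rewrite fE.
- exact: L1Z.
- by move=> s _; rewrite mulr_ge0// en_ge0.
- move=> s i s01.
  (* Split so that F(x) - F(y) meets [u], which is the Gronwall term, and u - v meets the bounded
     factor F(y), which is the source term. *)
  have -> : F (x s) *m u s - F (y s) *m v s =
      F (y s) *m (csubL2 u v s) + (F (x s) - F (y s)) *m u s.
    by rewrite /csubL2 /caddL2 /coppL2 mulmxBl mulmxBr [RHS]addrC addrA subrK.
  rewrite mxE (le_trans (ler_normD _ _))// lerD//.
    apply: (le_trans (mulmx_le _ _ _)); rewrite ler_wpM2r ?en_ge0//.
    exact: (HD v).
  by apply: (le_trans (mulmx_le _ _ _)); rewrite mulrAC ler_wpM2r ?en_ge0// FL.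
- move=> t t01; rewrite Hx// Hy// !traj_col//; apply/matrixP => i j.
  rewrite !mxE opprD addrACA subrr -int01B; [|exact: L1_ker..].
  by congr (_ + _); apply: eq_int01 => s _; rewrite -mulrBr fE.
by rewrite normr0 add0r int01Z// ler_wpM2l// int01_en.
Qed.

Lemma traj_unique u x y : inL2 u -> traj u x -> traj u y ->
  forall t, 0 <= t <= 1 -> x t = y t.
Proof.
move=> Lu xu yu t t01; have [C C0 HC] := traj_lip (normL2 u).
have := HC u u x y Lu (lexx _) xu Lu (lexx _) yu t t01.
rewrite (_ : csubL2 u u = cscaleL2 0 u); last first.
  by apply: ctrl_ext => s i; rewrite !mxE; ring.
by rewrite normL2Z// normr0 mul0r mulr0 normr_le0 subr_eq0 => /eqP.
Qed.

Lemma traj_holder (r : R) : exists2 C : R, 0 <= C &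
  forall u x, inL2 u -> normL2 u <= r -> traj u x ->
  forall t s, 0 <= t <= 1 -> 0 <= s <= 1 -> `|x t - x s| <= C * Num.sqrt `|t - s|.
Proof.
have [D D0 HD] := traj_F_bounded r.
exists (D * (k%:R * `|r|)); first by rewrite !mulr_ge0.
move=> u x Lu ur xu t s t01 s01; have [cx Hx] := xu; rewrite Hx// [x s]Hx//.
apply: (le_trans (volterra_holder true Lu x0 (lip_bmeas_mx cx) D0 (HD u x Lu ur xu) t s)).
rewrite ler_wpM2r ?sqrtr_ge0// ler_wpM2l// ler_wpM2l//.
by rewrite (le_trans ur)// ler_norm.
Qed.

(** Precomposition with [clamp] turns continuity within [0, 1] into continuity on the line and
    changes nothing on [0, 1]. *)
Lemma is_traj_traj u x : is_traj F x0 u x -> traj u (fun t => x (clamp t)).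
Proof.
move=> [cx Hx]; split.
  apply/continuous_distP => t e e0.
  have ct : `[0, 1]%classic (clamp t) by rewrite /= in_itv; exact: clamp01.
  have /cvgrPdistC_le/(_ e e0)/nbhs_ballP[d /= d0 Hd] := (subspace_continuousP _ _).1 cx _ ct.
  exists d => // s st; apply: Hd; last by rewrite /= in_itv; exact: clamp01.
  by rewrite -ball_normE /ball_/= distrC (le_lt_trans (clamp_lip _ _)).
move=> t t01; rewrite clamp_id// Hx//; apply/matrixP => i j.
rewrite !mxE ?(ord1 j) clamp_id// (int01_ker true)//; congr (_ + _).
apply: eq_Rintegral => s /set_mem; rewrite /= in_itv/= => /andP[s0 st].
by rewrite clamp_id// s0 (le_trans st)//; case/andP: t01.
Qed.

Lemma traj_is_traj u x : traj u x -> is_traj F x0 u x.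
Proof.
move=> [cx Hx]; split; first exact: continuous_subspaceT.
move=> t t01; rewrite Hx//; apply/matrixP => i j.
by rewrite !mxE ?(ord1 j) clamp_id// (int01_ker true).
Qed.

(** The choice in [xend] is harmless: existence rules out the default value and uniqueness
    identifies the endpoint. *)
Lemma xendE u x : inL2 u -> traj u x -> xend F x0 u = x 1.
Proof.
move=> Lu xu; rewrite /xend; case: xgetP => [y _ [x' [/is_traj_traj xu' <-]]|/(_ (x 1))].
  have := traj_unique Lu xu' xu; rewrite /= => /(_ 1).
  by rewrite clamp_id ?ler01 ?lexx//; apply.
by move=> H; exfalso; apply: H; exists x; split => //; exact: traj_is_traj.
Qed.

End Trajectory.

(** * Local consequences of C^2 regularity *)

Section SmoothData.
Variables (R : realType) (n : nat).
Local Notation E := 'cV[R]_n.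
Implicit Types (x y h : E).

Lemma trmx_norm_le p q (A : 'M[R]_(p, q)) : `|A^T| <= `|A|.
Proof. by apply: mx_norm_le => // i j; rewrite mxE mx_entry_le. Qed.

(** Compactness of closed balls, obtained for row vectors and carried over by transposition, which
    does not increase the norm. *)
Lemma continuous_bounded_ball (g : E -> R) (r : R) : continuous g ->
  exists2 C : R, 0 <= C & forall x, `|x| <= r -> `|g x| <= C.
Proof.
move=> cg; pose A := [set v : 'rV[R]_n | `|v| <= r].
have ctr : continuous (fun v : 'rV[R]_n => g v^T).
  apply/continuous_distP => v e e0.
  have [d d0 Hd] := (continuous_distP g).1 cg v^T e e0.
  exists d => // w wv; apply: Hd; rewrite -linearB/=.
  exact: le_lt_trans (trmx_norm_le _) wv.
have cA : compact A.
  apply: bounded_closed_compact.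
    exists r; split; first exact: num_real.
    by move=> M rM v /= vr; rewrite (le_trans vr)// ltW.
  rewrite (_ : A = closed_ball_ Num.norm (0 : 'rV[R]_n) r).
    exact: closed_closed_ball_.
  by apply/seteqP; split => v; rewrite /A /closed_ball_/= sub0r normrN.
have /compact_bounded[M [_ HM]] : compact ((fun v : 'rV[R]_n => g v^T) @` A).
  by apply: continuous_compact => //; exact: continuous_subspaceT.
exists (`|M| + 1); first by rewrite addr_ge0.
move=> x xr; apply: HM; first by rewrite (le_lt_trans (ler_norm _))// ltrDl.
exists x^T; last by rewrite trmxK.
by rewrite /A/= (le_trans (trmx_norm_le _)).
Qed.

Lemma is_derive_line (g : E -> R) x h (t d : R) :
  is_derive (x + t *: h) h g d -> is_derive t 1 (fun t : R => g (x + t *: h)) d.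
Proof.
have E : (fun s : R => s^-1 *: ((g \o shift (x + t *: h)) (s *: h) - g (x + t *: h))) =
  (fun s : R => s^-1 *: (((fun t : R => g (x + t *: h)) \o shift t) (s *: (1 : R)) -
     g (x + t *: h))).
  apply/funext => s; congr (_ *: (g _ - _)).
  have -> : s *: (1 : R) = s by rewrite /GRing.scale/= mulr1.
  by rewrite /shift/= scalerDl addrCA.
move=> [dg gd]; split; first by rewrite /derivable -E.
by rewrite -gd /derive -E.
Qed.

Lemma diff_is_derive (g : E -> R) x h : differentiable g x -> is_derive x h g ('d g x h).
Proof. by move=> dg; split; [exact: diff_derivable|rewrite deriveE]. Qed.

Lemma mvt_bound (f df : R -> R) (C : R) :
  (forall t : R, is_derive t 1 f (df t)) -> (forall t, 0 <= t <= 1 -> `|df t| <= C) ->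
  `|f 1 - f 0| <= C.
Proof.
move=> fd dC.
have cf : {within `[0, 1], continuous f}.
  apply: continuous_subspaceT => t; apply: differentiable_continuous.
  by apply/derivable1_diffP; have [] := fd t.
have [c] := @MVT_segment R f df 0 1 ler01 (fun t _ => fd t) cf.
by rewrite in_itv/= subr0 mulr1 => c01 ->; exact: dC.
Qed.

(** Mean value theorem for g - c t along the segment. With c = 0 it yields a Lipschitz bound, with c
    the differential at x a Taylor remainder. *)
Lemma mvt_segment_affine (g dg : E -> R) x y (c C : R) :
  (forall z, is_derive z (y - x) g (dg z)) ->
  (forall t, 0 <= t <= 1 -> `|dg (x + t *: (y - x)) - c| <= C) ->
  `|g y - g x - c| <= C.
Proof.
move=> gd dC.
have := @mvt_bound (fun t : R => g (x + t *: (y - x)) + (- c) * t)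
  (fun t : R => dg (x + t *: (y - x)) - c) C.
rewrite scale1r scale0r addr0 mulr1 mulr0 addr0 addrAC [x + _]addrC subrK; apply => //.
move=> t; apply: is_deriveD; first by apply: is_derive_line; exact: gd.
have : is_derive t 1 ((- c) *: (@id R)) ((- c) *: (1 : R)) by apply: is_deriveZ.
by rewrite {2}/GRing.scale/= mulr1.
Qed.

Definition grad (f : E -> R) x : E := \col_i 'd f x (delta_mx i 0).

Lemma diff_grad (f : E -> R) x h : 'd f x h = \sum_i grad f x i 0 * h i 0.
Proof.
rewrite {1}(matrix_sum_delta h) linear_sum/=; apply: eq_bigr => i _.
by rewrite big_ord1 linearZ/= mxE mulrC.
Qed.

Lemma segment_norm_le x y (r t : R) : `|x| <= r -> `|y| <= r -> 0 <= t <= 1 ->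
  `|x + t *: (y - x)| <= r.
Proof.
move=> xr yr /andP[t0 t1].
have -> : x + t *: (y - x) = (1 - t) *: x + t *: y.
  by rewrite scalerBr scalerBl scale1r addrA addrAC.
rewrite (le_trans (ler_normD _ _))// !normrZ (ger0_norm t0) ger0_norm ?subr_ge0//.
by have := normr_ge0 x; have := normr_ge0 y; nra.
Qed.

Lemma sum_mul_le (c h : 'I_n -> R) (a b : R) :
  (forall i, `|c i| <= a) -> (forall i, `|h i| <= b) ->
  `|\sum_i c i * h i| <= n%:R * (a * b).
Proof.
move=> ca hb; rewrite (le_trans (ler_norm_sum _ _ _))//.
apply: (@le_trans _ _ (\sum_(i < n) a * b)).
  by apply: ler_sum => i _; rewrite normrM ler_pM.
by rewrite sumr_const card_ord mulr_natl.
Qed.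

(** For each pair of basis vectors the second derivative is continuous, hence bounded on the ball;
    the mean value theorem is applied to each partial derivative. *)
Lemma C2_grad_lip (f : E -> R) (r : R) : isC2 f -> exists2 C : R, 0 <= C &
  forall x y, `|x| <= r -> `|y| <= r -> `|grad f y - grad f x| <= C * `|y - x|.
Proof.
move=> [_ f2].
have /choice[C HC] (ij : 'I_n * 'I_n) : exists C : R, 0 <= C /\ forall x, `|x| <= r ->
    `|'d (fun x => 'd f x (delta_mx ij.1 0)) x (delta_mx ij.2 0)| <= C.
  have [_ /(_ (delta_mx ij.2 0)) c2] := f2 (delta_mx ij.1 0).
  by have [C C0 HC] := continuous_bounded_ball r c2; exists C.
pose K := \sum_ij C ij.
have K0 : 0 <= K by apply: sumr_ge0 => ij _; case: (HC ij).
exists (n%:R * K) => [|x y xr yr]; first by rewrite mulr_ge0.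
apply: cV_norm_le => [|i]; first by rewrite !mulr_ge0.
rewrite 4!mxE; set g := fun x => 'd f x (delta_mx i 0).
have dg z : differentiable g z by have [+ _] := f2 (delta_mx i 0); exact.
rewrite -[X in `|X|]subr0.
apply: (@mvt_segment_affine g (fun z => 'd g z (y - x))) => [z|].
  exact: diff_is_derive.
move=> t t01; rewrite subr0 diff_grad -mulrA; apply: sum_mul_le => j; last exact: mx_entry_le.
rewrite mxE.
apply: (le_trans ((HC (i, j)).2 _ (segment_norm_le xr yr t01))).
by rewrite /K (bigD1 (i, j))//= lerDl sumr_ge0// => ij _; case: (HC ij).
Qed.

Lemma C2_taylor (f : E -> R) (r : R) : isC2 f -> exists2 C : R, 0 <= C &
  forall x y, `|x| <= r -> `|y| <= r ->
    `|f y - f x - \sum_i grad f x i 0 * (y - x) i 0| <= C * `|y - x| ^+ 2.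
Proof.
move=> f2; have [C C0 HC] := C2_grad_lip r f2.
have [[df _] _] := f2.
exists (n%:R * C) => [|x y xr yr]; first by rewrite mulr_ge0.
apply: (@mvt_segment_affine f (fun z => 'd f z (y - x))) => [z|].
  exact: diff_is_derive.
move=> t t01; rewrite diff_grad -sumrB.
have := HC _ _ xr (segment_norm_le xr yr t01).
move: (grad f (x + t *: (y - x))) (grad f x) => A B AB.
rewrite (_ : \sum_i _ = \sum_i (A - B) i 0 * (y - x) i 0); last first.
  by apply: eq_bigr => i _; rewrite -mulrBl [(A - B) i 0]mxE [(- B) i 0]mxE.
rewrite expr2 -!mulrA (mulrA C); apply: sum_mul_le => i; last exact: mx_entry_le.
apply: (le_trans (mx_entry_le _ _ _)); apply: (le_trans AB); rewrite addrC addKr ler_wpM2l// normrZ; case/andP: t01 => t0 t1.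
by rewrite ger0_norm// ler_piMl.
Qed.

Lemma diff_coord p (g : E -> 'cV[R]_p) l x : differentiable g x ->
  differentiable (fun x => g x l 0 : R) x /\
  forall v, 'd (fun x => g x l 0 : R) x v = 'd g x v l 0.
Proof.
move=> dg.
pose c0 := (fun A : 'cV[R]_p => A l 0 : R).
have c0lin : linear c0 by move=> a A B; rewrite /c0 !mxE.
pose cM := GRing.isLinear.Build _ _ _ _ _ c0lin.
pose c : {linear 'cV[R]_p -> R} := HB.pack c0 cM.
have cc : continuous c by exact: coord_continuous.
have E : (fun x => g x l 0 : R) = c \o g by [].
have dc (y : 'cV[R]_p) : differentiable (c : 'cV[R]_p -> R) y by exact: linear_differentiable.
split; first by rewrite E; exact: differentiable_comp.
by move=> v; rewrite E (diff_comp dg (dc _)) diff_lin.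
Qed.

Lemma isC1_coord p (g : E -> 'cV[R]_p) l : isC1 g -> isC1 (fun x => g x l 0 : R).
Proof.
move=> [dg cg]; split=> [x|v]; first by have [] := diff_coord l (dg x).
have -> : (fun x => 'd (fun x => g x l 0 : R) x v) = (fun x => 'd g x v l 0).
  by apply/funext => x; have [_ ->] := diff_coord l (dg x).
exact: (@continuous_entry R 'cV[R]_n p (fun x => 'd g x v) l (cg v)).
Qed.

Lemma isC2_coord p (g : E -> 'cV[R]_p) l : isC2 g -> isC2 (fun x => g x l 0 : R).
Proof.
move=> [g1 g2]; split=> [|v]; first exact: isC1_coord.
have -> : (fun x => 'd (fun x => g x l 0 : R) x v) = (fun x => 'd g x v l 0).
  by apply/funext => x; have [_ ->] := diff_coord l (g1.1 x).
by apply: isC1_coord; exact: g2.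
Qed.

(** Together with [C2_partials], all that the adjoint calculus takes from C^2 regularity; the
    existential hides how the gradient was obtained. *)
Lemma C2_gradient (f : E -> R) : isC2 f -> exists g : E -> E,
  forall r : R, exists2 C : R, 0 <= C & forall p q, `|p| <= r -> `|q| <= r ->
    `|g q - g p| <= C * `|q - p| /\
    `|f q - f p - \sum_i g p i 0 * (q - p) i 0| <= C * `|q - p| ^+ 2.
Proof.
move=> f2; exists (grad f) => r.
have [C C0 HC] := C2_grad_lip r f2; have [D D0 HD] := C2_taylor r f2.
exists (C + D) => [|p q pr qr]; first by rewrite addr_ge0.
split; first by apply: (le_trans (HC p q pr qr)); rewrite ler_wpM2r// lerDl.
by apply: (le_trans (HD p q pr qr)); rewrite ler_wpM2r ?sqr_ge0// lerDr.
Qed.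

(** [P i] is the i-th partial derivative, assembled entry by entry from the gradients of the
    components; the constant is the sum over all entries. *)
Lemma C2_partials p (F : E -> 'M[R]_(n, p)) : (forall j, isC2 (fun x => col j (F x))) ->
  exists P : 'I_n -> E -> 'M[R]_(n, p),
  forall r : R, exists2 C : R, 0 <= C & forall x y, `|x| <= r -> `|y| <= r ->
    (forall i, `|P i y - P i x| <= C * `|y - x|) /\
    `|F y - F x - \sum_i (y - x) i 0 *: P i x| <= C * `|y - x| ^+ 2.
Proof.
move=> F2.
have F2' l j : isC2 (fun x => F x l j).
  have := isC2_coord l (F2 j).
  rewrite (_ : (fun x : E => col j (F x) l 0) = (fun x => F x l j))//.
  by apply/funext => x; rewrite mxE.
have /choice[g Hg] (lj : 'I_n * 'I_p) := C2_gradient (F2' lj.1 lj.2).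
exists (fun i x => \matrix_(l, j) g (l, j) x i 0) => r.
have /choice[C HC] (lj : 'I_n * 'I_p) : exists C : R, 0 <= C /\
    forall x y, `|x| <= r -> `|y| <= r -> `|g lj y - g lj x| <= C * `|y - x| /\
    `|F y lj.1 lj.2 - F x lj.1 lj.2 - \sum_i g lj x i 0 * (y - x) i 0|
      <= C * `|y - x| ^+ 2.
  by have [C] := Hg lj r; exists C.
pose K := \sum_lj C lj.
have K0 : 0 <= K by apply: sumr_ge0 => lj _; case: (HC lj).
have KC lj : C lj <= K.
  by rewrite /K (bigD1 lj)//= lerDl sumr_ge0// => lj' _; case: (HC lj').
exists K => // x y xr yr; split=> [i|].
  apply: mx_norm_le => [|l j]; first by rewrite mulr_ge0.
  apply: (@le_trans _ _ (C (l, j) * `|y - x|)); last by rewrite ler_wpM2r.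
  apply: le_trans ((HC (l, j)).2 x y xr yr).1.
  by have := mx_entry_le (g (l, j) y - g (l, j) x) i 0; rewrite !mxE.
apply: mx_norm_le => [|l j]; first by rewrite mulr_ge0// sqr_ge0.
apply: (@le_trans _ _ (C (l, j) * `|y - x| ^+ 2)); last by rewrite ler_wpM2r ?sqr_ge0.
apply: le_trans ((HC (l, j)).2 x y xr yr).2.
rewrite le_eqVlt; apply/orP; left; apply/eqP; congr `|_|.
rewrite !mxE summxE; congr (_ - _).
by apply: eq_bigr => i _; rewrite !mxE mulrC.
Qed.

End SmoothData.

(** * The adjoint state *)

Section Adjoint.
Variables (R : realType) (n k : nat).
Variables (F : 'cV[R]_n -> 'M[R]_(n, k)) (x0 : 'cV[R]_n) (a : 'cV[R]_n -> R) (L : R).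
Hypothesis L0 : 0 <= L.
Hypothesis FL : forall x y, `|F x - F y| <= L * `|x - y|.
(* Fpart i is the i-th partial derivative of F, and grad the gradient of a *)
Variables (Fpart : 'I_n -> 'cV[R]_n -> 'M[R]_(n, k)) (grad : 'cV[R]_n -> 'cV[R]_n).
Hypothesis F_local : forall r : R, exists2 C : R, 0 <= C &
  forall p q, `|p| <= r -> `|q| <= r ->
  (forall i, `|Fpart i q - Fpart i p| <= C * `|q - p|) /\
  `|F q - F p - \sum_i (q - p) i 0 *: Fpart i p| <= C * `|q - p| ^+ 2.
Hypothesis a_local : forall r : R, exists2 C : R, 0 <= C &
  forall p q, `|p| <= r -> `|q| <= r ->
  `|grad q - grad p| <= C * `|q - p| /\
  `|a q - a p - \sum_i grad p i 0 * (q - p) i 0| <= C * `|q - p| ^+ 2.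
Implicit Types (u v : ctrl R k) (x y lam mu : R -> 'cV[R]_n) (p q : 'cV[R]_n).

Local Notation traj := (traj F x0).

Lemma continuous_Fpart x i l j : continuous x -> continuous (fun s => Fpart i (x s) l j).
Proof.
move=> cx; apply/continuous_distP => t e e0.
(* The Lipschitz constant is only local: the radius leaves room 1 around x(t), and x(s) stays within
   it for s near t. *)
have [C C0 HC] := F_local (`|x t| + 1).
have [d d0 Hd] := (continuous_distP x).1 cx t _ (@ltr01 R).
have C1 : 0 < C + 1 by rewrite ltr_wpDl.
have [d' d'0 Hd'] := (continuous_distP x).1 cx t (e / (C + 1)) (divr_gt0 e0 C1).
exists (Num.min d d'); first by rewrite lt_min d0.
move=> s; rewrite lt_min => /andP[/Hd h1 /Hd' h2].
have xt : `|x t| <= `|x t| + 1 by rewrite lerDl.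
have xs : `|x s| <= `|x t| + 1.
  by have := ler_normD (x s - x t) (x t); rewrite subrK; lra.
have [/(_ i) h _] := HC _ _ xt xs.
have := mx_entry_le (Fpart i (x s) - Fpart i (x t)) l j.
rewrite mx_subE => /le_trans; apply; apply: (le_trans h).
apply: (@le_trans _ _ ((C + 1) * `|x s - x t|)); first by rewrite ler_wpM2r// lerDl.
by rewrite mulrC -ler_pdivlMr.
Qed.

Lemma traj_data (r : R) : exists2 C : R, 0 <= C &
  forall u x, inL2 u -> normL2 u <= r -> traj u x -> forall t, 0 <= t <= 1 ->
  [/\ `|F (x t)| <= C, forall i, `|Fpart i (x t)| <= C & `|grad (x t)| <= C].
Proof.
have [X X0 HX] := traj_bounded x0 L0 FL r.
have [D D0 HD] := F_local X.
have [G G0 HG] := a_local X.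
pose M := \sum_i `|Fpart i 0|.
have M0 : 0 <= M by exact: sumr_ge0.
exists ((`|F 0| + L * X) + (M + D * X) + (`|grad 0| + G * X)).
  by rewrite !addr_ge0// mulr_ge0.
move=> u x Lu ur xu t t01; have xX := HX u x Lu ur xu t t01.
have z0 : `|0 : 'cV[R]_n| <= X by rewrite normr0.
have b1 : 0 <= `|F 0| + L * X by rewrite addr_ge0// mulr_ge0.
have b2 : 0 <= M + D * X by rewrite addr_ge0// mulr_ge0.
have b3 : 0 <= `|grad 0| + G * X by rewrite addr_ge0// mulr_ge0.
split.
- by have := F_growth L0 FL xX; lra.
- move=> i; have [/(_ i) h _] := HD 0 (x t) z0 xX; rewrite subr0 in h.
  have := ler_normD (Fpart i (x t) - Fpart i 0) (Fpart i 0); rewrite subrK.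
  have : `|Fpart i 0| <= M by rewrite /M (bigD1 i)//= lerDl sumr_ge0.
  have : D * `|x t| <= D * X by rewrite ler_wpM2l.
  by lra.
- have [h _] := HG 0 (x t) z0 xX; rewrite subr0 in h.
  have := ler_normD (grad (x t) - grad 0) (grad 0); rewrite subrK.
  have : G * `|x t| <= G * X by rewrite ler_wpM2l.
  by lra.
Qed.

(** Local estimates composed with the Lipschitz dependence of the trajectory. The first three bounds
    are linear in d, the last two are Taylor remainders; the factor Z + Z^2 in the constant serves
    both powers. *)
Lemma traj_pair (r : R) : exists2 C : R, 0 <= C &
  forall u v x y, inL2 u -> normL2 u <= r -> traj u x ->
    inL2 v -> normL2 v <= r -> traj v y ->
  forall t, 0 <= t <= 1 -> let d := normL2 (csubL2 u v) in
  [/\ `|F (x t) - F (y t)| <= C * d,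
      forall i, `|Fpart i (x t) - Fpart i (y t)| <= C * d,
      `|grad (x t) - grad (y t)| <= C * d,
      `|F (x t) - F (y t) - \sum_i (x t - y t) i 0 *: Fpart i (y t)| <= C * d ^+ 2 &
      `|a (x t) - a (y t) - \sum_i grad (y t) i 0 * (x t - y t) i 0| <= C * d ^+ 2].
Proof.
have [X X0 HX] := traj_bounded x0 L0 FL r.
have [Z Z0 HZ] := traj_lip x0 L0 FL r.
have [D D0 HD] := F_local X.
have [G G0 HG] := a_local X.
pose S := L + D + G.
have S0 : 0 <= S by rewrite !addr_ge0.
have [LS DS GS] : [/\ L <= S, D <= S & G <= S].
  by rewrite /S; split; [rewrite -addrA lerDl addr_ge0|rewrite addrAC lerDr addr_ge0|rewrite lerDr addr_ge0].
pose C := S * (Z + Z ^+ 2).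
have C1 : S * Z <= C by rewrite ler_wpM2l// lerDl sqr_ge0.
have C2 : S * Z ^+ 2 <= C by rewrite ler_wpM2l// lerDr.
exists C; first by rewrite mulr_ge0// addr_ge0// sqr_ge0.
move=> u v x y Lu ur xu Lv vr yv t t01 d.
have xX := HX u x Lu ur xu t t01; have yX := HX v y Lv vr yv t t01.
have d0 : 0 <= d by exact: normL2_ge0.
have xy : `|x t - y t| <= Z * d by exact: (HZ u v).
have le1 c (w : R) : 0 <= c -> c <= S -> w <= c * `|x t - y t| -> w <= C * d.
  move=> c0 cS wc; apply: (le_trans wc); apply: (@le_trans _ _ (S * (Z * d))).
    by rewrite ler_pM.
  by rewrite mulrA ler_wpM2r.
have le2 c (w : R) : 0 <= c -> c <= S -> w <= c * `|x t - y t| ^+ 2 -> w <= C * d ^+ 2.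
  move=> c0 cS wc; apply: (le_trans wc); apply: (@le_trans _ _ (S * (Z * d) ^+ 2)).
    by rewrite ler_pM ?sqr_ge0// ler_pXn2r ?nnegrE ?mulr_ge0.
  by rewrite exprMn mulrA ler_wpM2r ?sqr_ge0.
have [H1 H2] := HD (y t) (x t) yX xX; have [H3 H4] := HG (y t) (x t) yX xX.
split.
- by apply: (le1 L).
- by move=> i; apply: (le1 D).
- by apply: (le1 G).
- by apply: (le2 D).
- by apply: (le2 G).
Qed.

(** [Madj x s p *m u] is (DF(x) u)^T p. The matrix carries p and not u so that the adjoint equation
    takes the form M(s, y) u of [volterra]. *)
Definition Madj x (s : R) p : 'M[R]_(n, k) :=
  \matrix_(i, j) \sum_l p l 0 * Fpart i (x s) l j.

Lemma Madj_le x s p (D : R) : 0 <= D -> (forall i, `|Fpart i (x s)| <= D) ->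
  `|Madj x s p| <= n%:R * (`|p| * D).
Proof.
move=> D0 HD; apply: mx_norm_le => [|i j]; first by rewrite !mulr_ge0.
rewrite mxE; apply: sum_mul_le => l; first exact: mx_entry_le.
exact: le_trans (mx_entry_le _ _ _) (HD i).
Qed.

Lemma MadjB x s p q : Madj x s (p - q) = Madj x s p - Madj x s q.
Proof.
apply/matrixP => i j; rewrite mx_subE !mxE -sumrB; apply: eq_bigr => l _.
by rewrite mx_subE mulrBl.
Qed.

Lemma Madj_diff_le x y s p (D : R) : 0 <= D ->
  (forall i, `|Fpart i (x s) - Fpart i (y s)| <= D) ->
  `|Madj x s p - Madj y s p| <= n%:R * (`|p| * D).
Proof.
move=> D0 HD; apply: mx_norm_le => [|i j]; first by rewrite !mulr_ge0.
rewrite mx_subE !mxE -sumrB.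
under eq_bigr do rewrite -mulrBr.
apply: sum_mul_le => l; first exact: mx_entry_le.
apply: le_trans (HD i).
by have := mx_entry_le (Fpart i (x s) - Fpart i (y s)) l j; rewrite mx_subE.
Qed.

(** The transposition rule <(DF(x) w)^T p, z> = <p, (DF(x) z) w>, which makes the adjoint equation
    cancel the linear part of the variation. *)
Lemma Madj_pairing x s p (z : 'cV[R]_n) (w : 'cV[R]_k) :
  \sum_i (Madj x s p *m w) i 0 * z i 0 =
  \sum_l p l 0 * ((\sum_i z i 0 *: Fpart i (x s)) *m w) l 0.
Proof.
transitivity (\sum_i \sum_l \sum_j p l 0 * (z i 0 * Fpart i (x s) l j * w j 0)).
  apply: eq_bigr => i _; rewrite mxE mulr_suml exchange_big/=; apply: eq_bigr => j _.
  rewrite [Madj x s p i j]mxE -mulrA mulr_suml; apply: eq_bigr => l _; ring.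
rewrite exchange_big/=; apply: eq_bigr => l _; rewrite mxE mulr_sumr exchange_big/=.
apply: eq_bigr => j _; rewrite summxE mulr_suml mulr_sumr; apply: eq_bigr => i _.
by rewrite !mxE.
Qed.

Definition adj x u lam := continuous lam /\
  forall t, 0 <= t <= 1 -> lam t = volterra false (Madj x) u (grad (x 1)) lam t.

Lemma bmeas_mx_Madj x lam : continuous x -> continuous lam -> bmeas_mx (Madj x) lam.
Proof.
move=> cx cl i j.
rewrite (_ : (fun s => _) = (fun s => \sum_l lam s l 0 * Fpart i (x s) l j)).
  apply: bmeas_sum => l; apply: bmeasM; apply: bmeas_continuous.
    exact: continuous_entry.
  exact: continuous_Fpart.
by apply/funext => s; rewrite mxE.
Qed.

(** [Madj] is linear in p with coefficients bounded along the trajectory, hence globally Lipschitz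
    in p. *)
Lemma adj_exists u x : inL2 u -> traj u x -> exists lam, adj x u lam.
Proof.
move=> Lu xu; have [cx _] := xu.
have [C C0 HC] := traj_data (normL2 u).
have Mlip s p q : 0 <= s <= 1 -> `|Madj x s p - Madj x s q| <= n%:R * C * `|p - q|.
  move=> s01; rewrite -MadjB -mulrA [C * _]mulrC; apply: Madj_le => //.
  by case: (HC u x Lu (lexx _) xu s s01).
have [lam cl lamE] := volterra_exists false Lu (grad (x 1)) (mulr_ge0 (ler0n _ _) C0)
  Mlip (fun lam => bmeas_mx_Madj cx).
by exists lam.
Qed.

Lemma adj_col x u lam t : 0 <= t <= 1 ->
  volterra false (Madj x) u (grad (x 1)) lam t =
  grad (x 1) + \col_i int01 (fun s => ker false t s * (Madj x s (lam s) *m u s) i 0).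
Proof.
move=> t01; apply/matrixP => i j; rewrite mxE [RHS]mxE [(\col_i _) i j]mxE.
by rewrite (ord1 j) clamp_id.
Qed.

Lemma I01_1 : 0 <= (1 : R) <= 1. Proof. by rewrite ler01 lexx. Qed.

Lemma adj_bounded (r : R) : exists2 C : R, 0 <= C &
  forall u x lam, inL2 u -> normL2 u <= r -> traj u x -> adj x u lam ->
  forall t, 0 <= t <= 1 -> `|lam t| <= C.
Proof.
have [D D0 HD] := traj_data r.
have [C C0 HC] := @gronwall_ctrl R n k false (n%:R * D) r (mulr_ge0 (ler0n _ _) D0).
exists (C * D); first by rewrite mulr_ge0.
move=> u x lam Lu ur xu [cl lamE]; have [cx _] := xu.
apply: (HC u lam (fun s => Madj x s (lam s) *m u s) (grad (x 1)) (fun=> 0)) => //.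
- by move=> i; apply: L2_L1; exact: (L2_mulmx Lu i (bmeas_mx_Madj cx cl)).
- exact: L1_cst.
- move=> s i s01; rewrite add0r; apply: (le_trans (mulmx_le _ _ _)).
  rewrite mulrAC ler_wpM2r ?en_ge0// -mulrA [D * _]mulrC Madj_le//.
  by case: (HD u x Lu ur xu s s01).
- by move=> t t01; rewrite lamE// adj_col.
by rewrite int01_cst addr0; case: (HD u x Lu ur xu 1 I01_1).
Qed.

Lemma adj_lip (r : R) : exists2 C : R, 0 <= C &
  forall u v x y lam mu,
    inL2 u -> normL2 u <= r -> traj u x -> adj x u lam ->
    inL2 v -> normL2 v <= r -> traj v y -> adj y v mu ->
  forall t, 0 <= t <= 1 -> `|lam t - mu t| <= C * normL2 (csubL2 u v).
Proof.
have [D D0 HD] := traj_data r.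
have [P P0 HP] := traj_pair r.
have [A A0 HA] := adj_bounded r.
have [C C0 HC] := @gronwall_ctrl R n k false (n%:R * D) r (mulr_ge0 (ler0n _ _) D0).
exists (C * (P + n%:R * (A * P) * (k%:R * `|r|) + n%:R * (A * D) * k%:R)).
  by rewrite !(mulr_ge0, addr_ge0).
move=> u v x y lam mu Lu ur xu lamu Lv vr yv muv.
have [cx _] := xu; have [cy _] := yv; have [cl lamE] := lamu; have [cm muE] := muv.
set d := normL2 (csubL2 u v); have d0 : 0 <= d by exact: normL2_ge0.
have Luv := inL2B Lu Lv.
have Leu := L2_L1 (L2_en Lu); have Leuv := L2_L1 (L2_en Luv).
have Fu i := L2_L1 (L2_mulmx Lu i (bmeas_mx_Madj cx cl)).
have Fv i := L2_L1 (L2_mulmx Lv i (bmeas_mx_Madj cy cm)).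
pose g s := n%:R * (A * (P * d)) * en (u s) + n%:R * (A * D) * en (csubL2 u v s).
have ig : int01 g <= (n%:R * (A * P) * (k%:R * `|r|) + n%:R * (A * D) * k%:R) * d.
  rewrite /g int01D; [|exact: L1Z..]; rewrite !int01Z// [leRHS]mulrDl; apply: lerD.
    have -> : n%:R * (A * P) * (k%:R * `|r|) * d = n%:R * (A * (P * d)) * (k%:R * `|r|).
      by ring.
    rewrite ler_wpM2l ?mulr_ge0// (le_trans (int01_en Lu))// ler_wpM2l//.
    by rewrite (le_trans ur)// ler_norm.
  by rewrite -[leRHS]mulrA ler_wpM2l ?mulr_ge0// int01_en.
rewrite -[C * _ * d]mulrA; apply: (HC u (fun t => lam t - mu t)
  (fun s => Madj x s (lam s) *m u s - Madj y s (mu s) *m v s)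
  (grad (x 1) - grad (y 1)) g) => //.
- by move=> s; apply: cvgB; [exact: cl|exact: cm].
- by move=> i; apply: eq_L1 (L1B (Fu i) (Fv i)) => s _; rewrite mx_subE.
- by apply: L1D; exact: L1Z.
- by move=> s _; rewrite addr_ge0// !mulr_ge0// en_ge0.
- move=> s i s01.
  have [_ HPs _ _ _] := HP u v x y Lu ur xu Lv vr yv s s01.
  have [_ HDx _] := HD u x Lu ur xu s s01.
  have [_ HDy _] := HD v y Lv vr yv s s01.
  have mA := HA v y mu Lv vr yv muv s s01.
  (* Three sources of difference: coefficients, control, adjoint state. The first two make up [g],
     the third is the Gronwall term. *)
  have -> : Madj x s (lam s) *m u s - Madj y s (mu s) *m v s =
      (Madj x s (mu s) - Madj y s (mu s)) *m u s + Madj y s (mu s) *m (csubL2 u v s) +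
      Madj x s (lam s - mu s) *m u s.
    rewrite MadjB /csubL2 /caddL2 /coppL2 !mulmxBl mulmxBr.
    by rewrite [RHS]addrC !addrA !subrK.
  rewrite mxE (le_trans (ler_normD _ _))// lerD//.
    rewrite mxE (le_trans (ler_normD _ _))// lerD//.
      apply: (le_trans (mulmx_le _ _ _)); rewrite ler_wpM2r ?en_ge0//.
      apply: (le_trans (Madj_diff_le _ (mulr_ge0 P0 d0) HPs)).
      by rewrite ler_wpM2l// ler_wpM2r// mulr_ge0.
    apply: (le_trans (mulmx_le _ _ _)); rewrite ler_wpM2r ?en_ge0//.
    apply: (le_trans (Madj_le _ D0 HDy)).
    by rewrite ler_wpM2l// ler_wpM2r.
  apply: (le_trans (mulmx_le _ _ _)).
  by rewrite mulrAC ler_wpM2r ?en_ge0// -mulrA [D * _]mulrC Madj_le.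
- move=> t t01; rewrite lamE// muE// !adj_col//; apply/matrixP => i j.
  rewrite (ord1 j) mx_subE mxE [(grad (y 1) + _) i 0]mxE [RHS]mxE mx_subE.
  rewrite !(mxE _ (fun i _ => int01 _)) opprD addrACA -int01B; [|exact: L1_ker..].
  by congr (_ + _); apply: eq_int01 => s _; rewrite -mulrBr mx_subE.
have [_ _ h _ _] := HP u v x y Lu ur xu Lv vr yv 1 I01_1.
by rewrite -addrA [leRHS]mulrDl lerD.
Qed.

Lemma adj_holder (r : R) : exists2 C : R, 0 <= C &
  forall u x lam, inL2 u -> normL2 u <= r -> traj u x -> adj x u lam ->
  forall t s, 0 <= t <= 1 -> 0 <= s <= 1 -> `|lam t - lam s| <= C * Num.sqrt `|t - s|.
Proof.
have [D D0 HD] := traj_data r.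
have [A A0 HA] := adj_bounded r.
have C0 : 0 <= n%:R * (A * D) by rewrite !mulr_ge0.
exists (n%:R * (A * D) * (k%:R * `|r|)); first by rewrite !mulr_ge0.
move=> u x lam Lu ur xu lamu t s t01 s01; have [cl lamE] := lamu; have [cx _] := xu.
rewrite lamE// [lam s]lamE//.
apply: (le_trans (volterra_holder false Lu _ (bmeas_mx_Madj cx cl) C0 _ t s)).
  move=> s' s'01; apply: (le_trans (Madj_le _ D0 _)).
    by case: (HD u x Lu ur xu s' s'01).
  by rewrite ler_wpM2l// ler_wpM2r//; exact: (HA u x).
rewrite ler_wpM2r ?sqrtr_ge0// ler_wpM2l// ler_wpM2l//.
by rewrite (le_trans ur)// ler_norm.
Qed.

Definition xtraj u : R -> 'cV[R]_n := xget (fun=> 0) [set x | traj u x].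

Lemma xtrajP u : inL2 u -> traj u (xtraj u).
Proof.
move=> Lu; have [x xu] := traj_exists x0 L0 FL Lu.
by apply: (@xgetPex _ (fun=> 0) [set x | traj u x]); exists x.
Qed.

Definition atraj u : R -> 'cV[R]_n := xget (fun=> 0) [set lam | adj (xtraj u) u lam].

Lemma atrajP u : inL2 u -> adj (xtraj u) u (atraj u).
Proof.
move=> Lu; have [lam Hlam] := adj_exists Lu (xtrajP Lu).
by apply: (@xgetPex _ (fun=> 0) [set lam | adj (xtraj u) u lam]); exists lam.
Qed.

(* The Riesz representative of the differential of u |-> a (x_u(1)). *)
Definition endgrad u : ctrl R k := fun s =>
  (F (xtraj u (clamp s)))^T *m atraj u (clamp s).

Lemma trmx_mul_le (A : 'M[R]_(n, k)) p (b c : R) : `|A| <= b -> `|p| <= c ->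
  `|A^T *m p| <= n%:R * (b * c).
Proof.
move=> Ab pc; have b0 := le_trans (normr_ge0 _) Ab; have c0 := le_trans (normr_ge0 _) pc.
apply: cV_norm_le => [|j]; first by rewrite !mulr_ge0.
rewrite mxE (le_trans (ler_norm_sum _ _ _))//.
apply: (@le_trans _ _ (\sum_(i < n) b * c)).
  apply: ler_sum => i _; rewrite normrM ler_pM//.
    by rewrite mxE (le_trans (mx_entry_le _ _ _)).
  by rewrite (le_trans (mx_entry_le _ _ _)).
by rewrite sumr_const card_ord mulr_natl.
Qed.

Lemma trmx_mul_diff_le (A B : 'M[R]_(n, k)) p q (b c d e : R) :
  `|A - B| <= b -> `|p| <= c -> `|B| <= d -> `|p - q| <= e ->
  `|A^T *m p - B^T *m q| <= n%:R * (b * c) + n%:R * (d * e).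
Proof.
move=> AB pc Bd pq.
have -> : A^T *m p - B^T *m q = (A - B)^T *m p + B^T *m (p - q).
  by rewrite linearB/= mulmxBl mulmxBr addrA subrK.
by rewrite (le_trans (ler_normD _ _))// lerD// trmx_mul_le.
Qed.

(** The three properties that the flow construction asks of a field. They hold for every real s
    because [endgrad] evaluates at [clamp s]. *)
Lemma endgrad_bounds (r : R) : exists2 C : R, 0 <= C &
  forall u, inL2 u -> normL2 u <= r ->
  [/\ forall s, `|endgrad u s| <= C,
      forall s t, `|endgrad u s - endgrad u t| <= C * Num.sqrt `|s - t| &
      forall v, inL2 v -> normL2 v <= r ->
        forall s, `|endgrad u s - endgrad v s| <= C * normL2 (csubL2 u v)].
Proof.
have [D D0 HD] := traj_data r.
have [P P0 HP] := traj_pair r.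
have [H H0 HH] := traj_holder x0 L0 FL r.
have [A A0 HA] := adj_bounded r.
have [AL AL0 HAL] := adj_lip r.
have [AH AH0 HAH] := adj_holder r.
pose C1 := n%:R * (D * A); pose C2 := n%:R * (L * H * A) + n%:R * (D * AH).
pose C3 := n%:R * (P * A) + n%:R * (D * AL).
have [C10 C20 C30] : [/\ 0 <= C1, 0 <= C2 & 0 <= C3].
  by rewrite /C1 /C2 /C3 !(mulr_ge0, addr_ge0).
have [C1le C2le C3le] : [/\ C1 <= C1 + C2 + C3, C2 <= C1 + C2 + C3 & C3 <= C1 + C2 + C3].
  by split; lra.
exists (C1 + C2 + C3); first by lra.
move=> u Lu ur.
have xu := xtrajP Lu; have au := atrajP Lu.
split=> [s|s t|v Lv vr s].
- have [h _ _] := HD u _ Lu ur xu _ (clamp01 s).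
  have := trmx_mul_le h (HA u _ _ Lu ur xu au _ (clamp01 s)).
  by rewrite -/C1 => /le_trans; apply; exact: C1le.
- have h := HH u _ Lu ur xu _ _ (clamp01 s) (clamp01 t).
  have hc : Num.sqrt `|clamp s - clamp t| <= Num.sqrt `|s - t|.
    by rewrite ler_wsqrtr// clamp_lip.
  have hF : `|F (xtraj u (clamp s)) - F (xtraj u (clamp t))| <= L * H * Num.sqrt `|s - t|.
    rewrite (le_trans (FL _ _))// -mulrA ler_wpM2l// (le_trans h)// ler_wpM2l//.
  have hA : `|atraj u (clamp s) - atraj u (clamp t)| <= AH * Num.sqrt `|s - t|.
    rewrite (le_trans (HAH u _ _ Lu ur xu au _ _ (clamp01 s) (clamp01 t)))// ler_wpM2l//.
  have [hD _ _] := HD u _ Lu ur xu _ (clamp01 t).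
  have := trmx_mul_diff_le hF (HA u _ _ Lu ur xu au _ (clamp01 s)) hD hA.
  rewrite /endgrad => /le_trans; apply.
  have -> : n%:R * (L * H * Num.sqrt `|s - t| * A) + n%:R * (D * (AH * Num.sqrt `|s - t|)) =
    C2 * Num.sqrt `|s - t| by rewrite /C2; ring.
  by apply: ler_wpM2r; [exact: sqrtr_ge0|exact: C2le].
- have xv := xtrajP Lv; have av := atrajP Lv.
  have [hF _ _ _ _] := HP u v _ _ Lu ur xu Lv vr xv _ (clamp01 s).
  have hA := HAL u v _ _ _ _ Lu ur xu au Lv vr xv av _ (clamp01 s).
  have [hD _ _] := HD v _ Lv vr xv _ (clamp01 s).
  have := trmx_mul_diff_le hF (HA u _ _ Lu ur xu au _ (clamp01 s)) hD hA.
  rewrite /endgrad => /le_trans; apply.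
  set d := normL2 _; have -> : n%:R * (P * d * A) + n%:R * (D * (AL * d)) = C3 * d.
    by rewrite /C3; ring.
  by apply: ler_wpM2r; [exact: normL2_ge0|exact: C3le].
Qed.

Lemma inL2_endgrad u : inL2 u -> inL2 (endgrad u).
Proof.
move=> Lu; have [C C0 HC] := endgrad_bounds (normL2 u).
have [_ h _] := HC u Lu (lexx _).
exact/inL2_continuous/(holder_continuous h).
Qed.

(* Pairing the adjoint state with the variation z of the trajectory: the
   double integral over the triangle s <= t is evaluated in both orders. *)
Lemma adj_duality (f g lam z : R -> 'cV[R]_n) (c : 'cV[R]_n) :
  continuous lam -> continuous z ->
  (forall i, L1 (fun s => f s i 0)) -> (forall i, L1 (fun s => g s i 0)) ->
  (forall t i, 0 <= t <= 1 -> lam t i 0 = c i 0 + int01 (fun s => ker false t s * f s i 0)) ->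
  (forall t i, 0 <= t <= 1 -> z t i 0 = int01 (fun s => ker true t s * g s i 0)) ->
  \sum_i c i 0 * z 1 i 0 =
  int01 (fun s => \sum_i lam s i 0 * g s i 0 - \sum_i f s i 0 * z s i 0).
Proof.
move=> cl cz Lf Lg lamE zE.
have i1 i : L1 (fun s => lam s i 0 * g s i 0).
  by apply: bmeas_L1 => //; exact/bmeas_continuous/continuous_entry.
have i2 i : L1 (fun s => f s i 0 * z s i 0).
  by apply: L1_mul_bmeas => //; exact/bmeas_continuous/continuous_entry.
rewrite int01B; [|exact: L1_sum..]; rewrite !int01_sum// -sumrB.
apply: eq_bigr => i _.
have i3 : L1 (fun s => g s i 0 * int01 (fun t => ker false s t * f t i 0)).
  apply: (eq_L1 _ (L1B (i1 i) (L1Z (c i 0) (Lg i)))) => s s01.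
  by rewrite lamE//; ring.
rewrite (@eq_int01 _ _ (fun s => c i 0 * g s i 0 +
  g s i 0 * int01 (fun t => ker false s t * f t i 0))); last first.
  by move=> s s01; rewrite lamE//; ring.
rewrite int01D//; last exact: L1Z.
rewrite int01Z// -int01_triangle//.
rewrite (@eq_int01 _ (fun t => f t i 0 * _) (fun t => f t i 0 * z t i 0)); last first.
  by move=> t t01; rewrite zE.
rewrite addrK zE ?I01_1//; congr (_ * _); apply: eq_int01 => s /andP[_ s1].
by rewrite /ker s1 mul1r.
Qed.

(** [lam] belongs to u alone, while z is the exact difference of the two trajectories; the duality
    identity is therefore exact, and all errors sit in the Taylor remainder of [a] and in one
    integrand [e]. *)
Lemma endpoint_expansion (r : R) : exists2 C : R, 0 <= C &
  forall u v, inL2 u -> normL2 u <= r -> inL2 v -> normL2 v <= 1 ->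
  `|a (xend F x0 (caddL2 u v)) - a (xend F x0 u) - ipL2 (endgrad u) v|
    <= C * normL2 v ^+ 2.
Proof.
(* A ball of radius |r| + 1 holds both u and u + v, since |v| <= 1. *)
have [P P0 HP] := traj_pair (`|r| + 1).
have [A A0 HA] := adj_bounded (`|r| + 1).
pose C := P + n%:R * A * (P * (k%:R * `|r|) + P * k%:R).
exists C; first by rewrite !(mulr_ge0, addr_ge0).
move=> u v Lu ur0 Lv v1.
have ur : normL2 u <= `|r| + 1 by have := ler_norm r; lra.
have Lw := inL2D Lu Lv; set w := caddL2 u v in Lw *.
have wr : normL2 w <= `|r| + 1.
  by have := normL2D Lu Lv; rewrite -/w; have := ler_norm r; lra.
have xu := xtrajP Lu; have yw := xtrajP Lw; have au := atrajP Lu.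
have xE := xendE L0 FL Lu xu; have yE := xendE L0 FL Lw yw.
rewrite xE yE /endgrad {xE yE}.
move: (xtraj u) (atraj u) (xtraj w) xu au yw => x lam y xu lamu yw.
have dE : normL2 (csubL2 w u) = normL2 v.
  by congr normL2; apply: ctrl_ext => s i; rewrite !mxE; ring.
pose d := normL2 v; have d0 : 0 <= d by exact: normL2_ge0.
have HPt t (t01 : 0 <= t <= 1) := HP w u y x Lw wr yw Lu ur xu t t01.
rewrite dE -/d in HPt *.
have lamA t : 0 <= t <= 1 -> `|lam t| <= A by exact: (HA u x).
have [cx xE] := xu; have [cy yE] := yw; have [cl lamE] := lamu.
pose z t := y t - x t.
have cz : continuous z by move=> t; apply: cvgB; [exact: cy|exact: cx].
have bx := lip_bmeas_mx L0 FL cx; have by_ := lip_bmeas_mx L0 FL cy.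
pose g s := F (y s) *m w s - F (x s) *m u s.
pose f s := Madj x s (lam s) *m u s.
have Lg i : L1 (fun s => g s i 0).
  apply: eq_L1 (L1B (L2_L1 (L2_mulmx Lw i by_)) (L2_L1 (L2_mulmx Lu i bx))) => s _.
  by rewrite mx_subE.
have Lf i : L1 (fun s => f s i 0).
  exact: L2_L1 (L2_mulmx Lu i (bmeas_mx_Madj cx cl)).
have zE t i : 0 <= t <= 1 -> z t i 0 = int01 (fun s => ker true t s * g s i 0).
  move=> t01; rewrite mx_subE xE// yE// !mxE opprD addrACA subrr add0r clamp_id//.
  rewrite -int01B; [|exact: (L1_ker_mulmx true Lw t i by_)|exact: (L1_ker_mulmx true Lu t i bx)].
  by apply: eq_int01 => s _; rewrite mx_subE mulrBr.
have lE t i : 0 <= t <= 1 -> lam t i 0 = grad (x 1) i 0 + int01 (fun s => ker false t s * f s i 0).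
  by move=> t01; rewrite lamE// mxE clamp_id.
(* Removing from F(y) (u + v) - F(x) u the linear part (DF(x) z) u and the wanted term F(x) v leaves
   exactly the two products in [e]. *)
pose rem s := F (y s) - F (x s) - \sum_i z s i 0 *: Fpart i (x s).
pose e s := \sum_l lam s l 0 * (rem s *m u s + (F (y s) - F (x s)) *m v s) l 0.
have pt s : \sum_i lam s i 0 * g s i 0 - \sum_i f s i 0 * z s i 0 =
    e s + \sum_l lam s l 0 * (F (x s) *m v s) l 0.
  rewrite Madj_pairing /e -big_split/= -sumrB; apply: eq_bigr => l _.
  rewrite -mulrDr -mulrBr; congr (_ * _).
  have addE (p q : 'cV[R]_n) : p l 0 + q l 0 = (p + q) l 0 by rewrite mxE.
  rewrite -mx_subE addE; congr (fun_of_matrix _ l 0).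
  rewrite /g /rem /w /caddL2 mulmxDr !mulmxBl -[RHS]addrA subrK.
  have comm4 (A1 A2 A3 A4 : 'cV[R]_n) : A1 + A2 - A3 - A4 = A1 - A3 - A4 + A2.
    by apply/matrixP => i j; rewrite !mxE; ring.
  exact: comm4.
have ipE : ipL2 (fun s => (F (x (clamp s)))^T *m lam (clamp s)) v =
    int01 (fun s => \sum_l lam s l 0 * (F (x s) *m v s) l 0).
  apply: eq_int01 => s s01; rewrite /dotv clamp_id//.
  transitivity (\sum_j \sum_l lam s l 0 * (F (x s) l j * v s j 0)).
    apply: eq_bigr => j _; rewrite mxE mulr_suml; apply: eq_bigr => l _.
    by rewrite mxE; ring.
  rewrite exchange_big/=; apply: eq_bigr => l _.
  by rewrite mxE mulr_sumr.
have Li : L1 (fun s => \sum_l lam s l 0 * (F (x s) *m v s) l 0).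
  apply: L1_sum => l; apply: bmeas_L1; first exact/bmeas_continuous/continuous_entry.
  exact: L2_L1 (L2_mulmx Lv l bx).
have LI : L1 (fun s => \sum_i lam s i 0 * g s i 0 - \sum_i f s i 0 * z s i 0).
  apply: L1B; apply: L1_sum => i.
    by apply: bmeas_L1 => //; exact/bmeas_continuous/continuous_entry.
  by apply: L1_mul_bmeas => //; exact/bmeas_continuous/continuous_entry.
have Le : L1 e by apply: eq_L1 (L1B LI Li) => s _; rewrite pt addrK.
have dual : \sum_i grad (x 1) i 0 * z 1 i 0 =
    int01 e + int01 (fun s => \sum_l lam s l 0 * (F (x s) *m v s) l 0).
  rewrite (adj_duality cl cz Lf Lg lE zE) -int01D//.
  by apply: eq_int01 => s _; exact: pt.
have main : a (y 1) - a (x 1) - ipL2 (fun s => (F (x (clamp s)))^T *m lam (clamp s)) v =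
  (a (y 1) - a (x 1) - \sum_i grad (x 1) i 0 * z 1 i 0) + int01 e.
  by rewrite dual ipE; ring.
rewrite main; apply: (le_trans (ler_normD _ _)); rewrite /C mulrDl; apply: lerD.
  by have [_ _ _ _ h] := HPt 1 I01_1.
have Leu := L2_L1 (L2_en Lu); have Lev := L2_L1 (L2_en Lv).
(* The first product brings d^2 against |u|; the second brings only d, but the integral of |v|
   supplies the other factor. *)
apply: (@le_trans _ _ (int01 (fun s => n%:R * A * (P * d ^+ 2) * en (u s) +
   n%:R * A * (P * d) * en (v s)))).
  apply: int01_abs_le => //; first by apply: L1D; exact: L1Z.
  move=> s s01; have [h1 _ _ h2 _] := HPt s s01.
  apply: (le_trans (@sum_mul_le _ _ _ _ `|lam s| (P * d ^+ 2 * en (u s) + P * d * en (v s)) _ _)) => [l|l|].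
  - exact: mx_entry_le.
  - rewrite mxE (le_trans (ler_normD _ _))// lerD//.
      by apply: (le_trans (mulmx_le _ _ _)); rewrite ler_wpM2r ?en_ge0.
    by apply: (le_trans (mulmx_le _ _ _)); rewrite ler_wpM2r ?en_ge0.
  rewrite -[leRHS]addr0; apply: (@le_trans _ _ (n%:R * (A * (P * d ^+ 2 * en (u s) + P * d * en (v s))))).
    rewrite ler_wpM2l// ler_wpM2r ?lamA//.
    by rewrite addr_ge0// !mulr_ge0// ?en_ge0// sqr_ge0.
  by rewrite addr0 le_eqVlt; apply/orP; left; apply/eqP; ring.
rewrite int01D; [|exact: L1Z..]; rewrite !int01Z//.
have -> : n%:R * A * (P * (k%:R * `|r|) + P * k%:R) * d ^+ 2 =
  n%:R * A * (P * d ^+ 2) * (k%:R * `|r|) + n%:R * A * (P * d) * (k%:R * d) by ring.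
apply: lerD.
  rewrite ler_wpM2l ?mulr_ge0 ?sqr_ge0// (le_trans (int01_en Lu))// ler_wpM2l//.
  by rewrite (le_trans ur0)// ler_norm.
by rewrite ler_wpM2l ?mulr_ge0// int01_en.
Qed.

End Adjoint.

(** * Time derivatives and primitives *)

Section RealDifferentialInequality.
Variable R : realType.
Implicit Types (f df : R -> R) (t : R).

(** Differentiability relative to [0, +oo), hence one-sided at 0. Nothing is divided by h, so h = 0
    needs no exclusion. *)
Definition diff_ge0 f t (d : R) := forall e : R, 0 < e -> exists2 del : R, 0 < del &
  forall h, `|h| < del -> 0 <= t + h -> `|f (t + h) - f t - h * d| <= e * `|h|.

Lemma diff_ge0_is_derive f t (d : R) : 0 < t -> diff_ge0 f t d -> is_derive t 1 f d.
Proof.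
move=> t0 fd.
have cv : (fun h => h^-1 *: ((f \o shift t) (h *: 1) - f t)) @ 0^' --> d.
  apply/cvgrPdistC_le => e e0; have [del del0 Hd] := fd e e0.
  rewrite near_withinE; apply/nbhs_ballP; exists (Num.min del t) => /=; first by rewrite lt_min del0.
  move=> h; rewrite -ball_normE /ball_/= sub0r normrN lt_min => /andP[hd ht] h0.
  have th : 0 <= t + h by move: ht; rewrite ltr_norml => /andP[? _]; lra.
  have := Hd h hd th; rewrite /shift/= /GRing.scale/= mulr1 [h + t]addrC => H.
  have -> : h^-1 * (f (t + h) - f t) - d = h^-1 * (f (t + h) - f t - h * d).
    by rewrite [RHS]mulrBr mulKf.
  by rewrite normrM normfV mulrC ler_pdivrMr ?normr_gt0.
by split; [apply/cvg_ex; exists d|exact: cvg_lim].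
Qed.

Lemma diff_ge0_continuous f df (T : R) :
  (forall t, 0 <= t <= T -> diff_ge0 f t (df t)) -> {within `[0, T], continuous f}.
Proof.
move=> fd; apply/subspace_continuousP => t; rewrite /= in_itv/= => t0T.
apply/cvgrPdistC_le => e e0; have [del del0 Hd] := fd t t0T 1 ltr01.
have c0 : 0 < 1 + `|df t| by rewrite ltr_wpDr.
rewrite near_withinE; apply/nbhs_ballP.
exists (Num.min del (e / (1 + `|df t|))) => /=; first by rewrite lt_min del0 divr_gt0.
move=> s; rewrite -ball_normE /ball_/= distrC lt_min => /andP[sd se].
rewrite /= in_itv/= => /andP[s0 _].
have := Hd (s - t) sd; rewrite addrC subrK => /(_ s0) H.
have h1 := ler_normD (f s - f t - (s - t) * df t) ((s - t) * df t).
rewrite subrK normrM in h1.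
have h2 : `|s - t| * (1 + `|df t|) <= e by rewrite -ler_pdivlMr// ltW.
by move: H h1 h2; rewrite mulrDr mulr1 mul1r => *; lra.
Qed.

Lemma diff_le_exp f df (c T : R) : 0 <= T ->
  (forall t, 0 <= t <= T -> diff_ge0 f t (df t)) ->
  (forall t, 0 < t < T -> df t <= c * f t) -> f T <= expR (c * T) * f 0.
Proof.
move=> T0 fd dfc; pose g t := expR (- c * t + 0) * f t.
have gd t : t \in `]0, T[ ->
    is_derive t 1 g (expR (- c * t + 0) *: df t + f t *: (- c * expR (- c * t + 0))).
  rewrite in_itv/= => /andP[t0 tT].
  have h1 : is_derive t 1 f (df t).
    by apply: diff_ge0_is_derive => //; apply: fd; rewrite !ltW.
  have h2 := is_derive_expR_affine (- c) 0 t.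
  exact: (is_deriveM h2 h1).
have cf := diff_ge0_continuous fd.
have cg : {within `[0, T], continuous g}.
  move=> t; apply: cvgM; last exact: cf.
  by apply: continuous_subspaceT; exact: continuous_expR_affine.
suff : g T <= g 0.
  by rewrite /g mulr0 !addr0 expR0 mul1r mulNr expRN ler_pdivrMl ?expR_gt0.
apply: (@ler0_derive1_nincr R g 0 T _ _ cg 0 T (lexx _) T0 (lexx _)) => t tT;
  have dg := gd t tT.
- by case: dg.
rewrite derive1E; have -> : 'D_1 g t = _ := derive_val.
have : df t <= c * f t by apply: dfc; move: tT; rewrite in_itv.
have := expR_gt0 (- c * t + 0); rewrite /GRing.scale/=; nra.
Qed.

End RealDifferentialInequality.

(** * Curves of controls and Frechet differentials *)

Section Curves.
Variables (R : realType) (k : nat).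
Implicit Types (u v g : ctrl R k) (U V : R -> ctrl R k) (Phi : ctrl R k -> R).

Definition frechet Phi u g := forall e : R, 0 < e -> exists2 d : R, 0 < d &
  forall v, inL2 v -> normL2 v < d ->
    `|Phi (caddL2 u v) - Phi u - ipL2 g v| <= e * normL2 v.

Definition inL2_curve U := forall t, 0 <= t -> inL2 (U t).

Definition curve_deriv U V := forall t, 0 <= t ->
  forall e : R, 0 < e -> exists2 d : R, 0 < d &
  forall h, h != 0 -> `|h| < d -> 0 <= t + h ->
    normL2 (csubL2 (cscaleL2 h^-1 (csubL2 (U (t + h)) (U t))) (V t)) <= e.

Lemma curve_deriv_increment U V t : inL2_curve U -> inL2_curve V -> curve_deriv U V ->
  0 <= t -> forall e : R, 0 < e -> exists2 d : R, 0 < d &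
  forall h, `|h| < d -> 0 <= t + h ->
    normL2 (csubL2 (csubL2 (U (t + h)) (U t)) (cscaleL2 h (V t))) <= e * `|h|.
Proof.
move=> LU LV UV t0 e e0; have [d d0 Hd] := UV t t0 e e0; exists d => // h hd th.
have Lw := inL2B (LU _ th) (LU _ t0); have LVt := LV _ t0.
have [->|h0] := eqVneq h 0.
  rewrite addr0 normr0 mulr0 (_ : csubL2 _ _ = cscaleL2 0 (V t)).
    by rewrite normL2Z// normr0 mul0r.
  by apply: ctrl_ext => s i; rewrite !mxE; ring.
rewrite (_ : csubL2 _ _ = cscaleL2 h
    (csubL2 (cscaleL2 h^-1 (csubL2 (U (t + h)) (U t))) (V t))).
  rewrite normL2Z; last by apply: inL2B => //; exact: inL2Z.
  by rewrite mulrC ler_wpM2r// Hd.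
by apply: ctrl_ext => s i; rewrite !mxE; field.
Qed.

Lemma curve_chain_rule Phi U V g t : inL2_curve U -> inL2_curve V -> curve_deriv U V ->
  0 <= t -> inL2 g -> frechet Phi (U t) g ->
  diff_ge0 (fun s => Phi (U s)) t (ipL2 g (V t)).
Proof.
move=> LU LV UV t0 Lg fr e e0.
have LVt := LV _ t0.
have [V0 g0] := (normL2_ge0 (V t), normL2_ge0 g).
set NV := normL2 (V t) in V0 *; set Ng := normL2 g in g0 *.
have NV1 : 0 < NV + 1 by lra. have Ng1 : 0 < Ng + 1 by lra.
have e1 : 0 < e / 2 / (NV + 1) by rewrite !divr_gt0.
have e2 : 0 < e / 2 / (Ng + 1) by rewrite !divr_gt0.
have [d1 d10 H1] := fr _ e1.
have [d2 d20 H2] := curve_deriv_increment LU LV UV t0 e2.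
(* Tolerance 1 bounds the increment itself, |w| <= (NV + 1) |h|, which turns the Frechet error in
   |w| into one in |h|. *)
have [d3 d30 H3] := curve_deriv_increment LU LV UV t0 (@ltr01 R).
exists (Num.min (d1 / (NV + 1)) (Num.min d2 d3)).
  by rewrite !lt_min divr_gt0 ?d20.
move=> h; rewrite !lt_min => /and3P[hd1 hd2 hd3] th.
have Lw := inL2B (LU _ th) (LU _ t0); set w := csubL2 (U (t + h)) (U t) in Lw H2 H3 *.
have LhV := inL2Z h LVt.
have LwV := inL2B Lw LhV.
have h2 := H2 h hd2 th; have h3 := H3 h hd3 th; rewrite mul1r in h3.
have wh : normL2 w <= (NV + 1) * `|h|.
  have := normL2D LwV LhV; rewrite normL2Z// (_ : caddL2 _ _ = w).
    by rewrite -/NV -/w in h3 *; lra.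
  by apply: ctrl_ext => s i; rewrite !mxE; ring.
have UE : U (t + h) = caddL2 (U t) w by apply: ctrl_ext => s i; rewrite !mxE; ring.
have wd : normL2 w < d1.
  by rewrite (le_lt_trans wh)// mulrC -ltr_pdivlMr.
have h1 := H1 w Lw wd; rewrite -UE in h1.
have h4 : `|ipL2 g w - h * ipL2 g (V t)| <= e / 2 * `|h|.
  rewrite -ipL2Zr// -ipL2Br//; apply: (le_trans (ipL2_CS Lg LwV)).
  apply: (@le_trans _ _ (Ng * (e / 2 / (Ng + 1) * `|h|))); first by rewrite ler_wpM2l.
  rewrite mulrA ler_wpM2r// mulrCA -[leRHS]mulr1 ler_wpM2l ?divr_ge0 ?ltW//.
  by rewrite ltr_pdivrMr// mul1r ltrDl.
have h5 : e / 2 / (NV + 1) * normL2 w <= e / 2 * `|h|.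
  by apply: (le_trans (ler_wpM2l (ltW e1) wh)); rewrite mulrA divfK ?gt_eqF.
have := ler_normD (Phi (U (t + h)) - Phi (U t) - ipL2 g w)
   (ipL2 g w - h * ipL2 g (V t)); rewrite addrA subrK.
by lra.
Qed.

Lemma frechet_sqnorm u : inL2 u -> frechet (fun u => ipL2 u u) u (cscaleL2 2 u).
Proof.
move=> Lu e e0; exists e => // v Lv ve.
have Luv := inL2D Lu Lv.
rewrite ipL2Zl// ipL2Dl// !ipL2Dr// (ipL2C v u).
have -> : ipL2 u u + ipL2 u v + (ipL2 u v + ipL2 v v) - ipL2 u u - 2 * ipL2 u v = ipL2 v v.
  by ring.
by rewrite ger0_norm ?ipL2_ge0// -normL2_sqr expr2 ler_wpM2r ?normL2_ge0// ltW.
Qed.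

(** Both expansions are tested on c w with w = g - g' and c > 0 small enough for both radii; this
    gives c |w|^2 <= e c |w|, that is |w| <= e, for every e > 0. *)
Lemma frechet_unique Phi u g g' : inL2 g -> inL2 g' ->
  frechet Phi u g -> frechet Phi u g' -> eqL2 g g'.
Proof.
move=> Lg Lg' fg fg'; apply/eqP; rewrite -normr_le0 ger0_norm ?normL2_ge0//.
have Lw := inL2B Lg Lg'; rewrite -/(csubL2 g g'); set w := csubL2 g g' in Lw *.
rewrite leNgt; apply/negP => N0.
suff key e : 0 < e -> normL2 w <= e.
  by have := key (normL2 w / 2) (divr_gt0 N0 (ltr0n _ 2)); lra.
move=> e0.
have e2 : 0 < e / 2 by rewrite divr_gt0.
have [d d0 H] := fg _ e2; have [d' d'0 H'] := fg' _ e2.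
pose m := Num.min d d'; have m0 : 0 < m by rewrite lt_min d0.
pose c := m / 2 / normL2 w; have c0 : 0 < c by rewrite !divr_gt0.
have Lc := inL2Z c Lw.
have Nc : normL2 (cscaleL2 c w) = m / 2 by rewrite normL2Z// gtr0_norm// divfK ?gt_eqF.
have md : m / 2 < d /\ m / 2 < d'.
  have m1 : m <= d by rewrite ge_min lexx.
  have m2 : m <= d' by rewrite ge_min lexx orbT.
  by split; lra.
have h := H _ Lc; have h' := H' _ Lc; rewrite Nc in h h'.
have {}h := h md.1; have {}h' := h' md.2.
have : `|ipL2 g (cscaleL2 c w) - ipL2 g' (cscaleL2 c w)| <= e * (m / 2).
  set A := Phi _ - Phi u in h h'.
  have := ler_normB (A - ipL2 g' (cscaleL2 c w)) (A - ipL2 g (cscaleL2 c w)).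
  rewrite (_ : A - ipL2 g' (cscaleL2 c w) - (A - ipL2 g (cscaleL2 c w)) =
    ipL2 g (cscaleL2 c w) - ipL2 g' (cscaleL2 c w)); last by ring.
  by lra.
rewrite -ipL2Bl// -/w ipL2Zr// -normL2_sqr ger0_norm; last first.
  by rewrite mulr_ge0 ?sqr_ge0 ?ltW.
have -> : c * normL2 w ^+ 2 = (m / 2) * normL2 w by rewrite /c; field; rewrite gt_eqF.
by rewrite [leRHS]mulrC ler_pM2l// divr_gt0.
Qed.

End Curves.

Section Primitive.
Variable R : realType.
Local Notation mu := (@lebesgue_measure R).
Implicit Types (f g : R -> R) (t : R).

Definition prim g t : R := Rintegral mu `[0, t]%classic g.

Lemma continuous_integrable_itv g (x y : R) : continuous g ->
  mu.-integrable `[x, y]%classic (EFin \o g).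
Proof.
move=> cg; apply: continuous_compact_integrable; first exact: segment_compact.
exact: continuous_subspaceT.
Qed.

Lemma prim_neg g t : t <= 0 -> prim g t = 0.
Proof.
rewrite le_eqVlt /prim => /predU1P[->|t0]; first by rewrite set_itv1 Rintegral_set1.
by rewrite set_itv_ge ?Rintegral_set0// -leNgt bnd_simp.
Qed.

Lemma primB f g t : continuous f -> continuous g ->
  prim f t - prim g t = prim (fun s => f s - g s) t.
Proof.
move=> cf cg; rewrite -[LHS]RintegralB//; exact: continuous_integrable_itv.
Qed.

(** One estimate for two uses: c = 0 gives Lipschitz bounds in time, c the value at an endpoint
    gives the derivative with a rate. *)
Lemma prim_increment g (x y c e : R) : continuous g -> 0 <= x -> x <= y ->
  (forall s, x <= s <= y -> `|g s - c| <= e) ->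
  `|prim g y - prim g x - c * (y - x)| <= e * (y - x).
Proof.
move=> cg x0 xy gc.
have -> : prim g y - prim g x = Rintegral mu `[x, y]%classic g.
  rewrite /prim Rintegral_itvB//; last exact: continuous_integrable_itv.
  rewrite Rintegral_itv_obnd_cbnd//.
  apply: (@integrableS _ _ _ mu `[x, y]%classic) => //; first exact: subset_itv_oc_cc.
  exact: continuous_integrable_itv.
have cst (d : R) : Rintegral mu `[x, y]%classic (fun=> d) = d * (y - x).
  transitivity (d * fine (mu `[x, y]%classic)); first exact: Rintegral_cst.
  rewrite lebesgue_measure_itv/= lte_fin; case: ltP => //= yx.
  by congr (_ * _); apply/eqP; rewrite eq_sym subr_eq0 eq_le yx.
have cc (d : R) : continuous (fun _ : R => d) by move=> ?; exact: cvg_cst.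
have cgc : continuous (fun s => g s - c) by move=> s; apply: cvgB; [exact: cg|exact: cc].
rewrite -!cst -[X in `|X|]RintegralB//; try exact: continuous_integrable_itv.
apply: (le_trans (le_normr_Rintegral _ (continuous_integrable_itv _ _ cgc))) => //.
apply: le_Rintegral => //; try exact: continuous_integrable_itv.
by apply: continuous_integrable_itv => s; apply: cvg_norm; exact: cgc.
Qed.

Lemma prim_exp_bound g (lam a b t : R) : continuous g -> 0 < lam -> 0 <= t ->
  (forall s, 0 <= s <= t -> `|g s| <= a * expR (lam * s) + b) ->
  `|prim g t| <= a / lam * (expR (lam * t) - 1) + b * t.
Proof.
move=> cg l0 t0 gab.
have ce : continuous (fun s => expR (lam * s + 0)) by exact: continuous_expR_affine.
have cae : continuous (fun s => a * expR (lam * s + 0)).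
  by move=> s; apply: cvgMr; exact: ce.
have cc (d : R) : continuous (fun _ : R => d) by move=> ?; exact: cvg_cst.
have caeb : continuous (fun s => a * expR (lam * s + 0) + b).
  by move=> s; apply: cvgD; [exact: cae|exact: cc].
apply: (le_trans (le_normr_Rintegral _ (continuous_integrable_itv _ _ cg))) => //.
apply: (@le_trans _ _ (Rintegral mu `[0, t]%classic (fun s => a * expR (lam * s + 0) + b))).
  apply: le_Rintegral => //; try exact: continuous_integrable_itv.
    by apply: continuous_integrable_itv => s; apply: cvg_norm; exact: cg.
  by move=> s; rewrite /= in_itv addr0; exact: gab.
rewrite RintegralD//; try exact: continuous_integrable_itv.
rewrite RintegralZl//; try exact: continuous_integrable_itv.
rewrite Rintegral_expR_affine ?gt_eqF// mulr0 !addr0 expR0 mulrA lerD2l.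
have -> : Rintegral mu `[0, t]%classic (fun=> b) = b * fine (mu `[0, t]%classic).
  exact: Rintegral_cst.
rewrite lebesgue_measure_itv/= lte_fin; case: ltP => /= [_|]; first by rewrite subr0.
by move=> t0'; rewrite (_ : t = 0) ?mulr0//; apply/eqP; rewrite eq_le t0' t0.
Qed.

(** Projection onto [0, +oo): curves are controlled for t >= 0 only, whereas integrands are required
    to be continuous on the line. *)
Definition posp t : R := Num.max 0 t.

Lemma posp_ge0 t : 0 <= posp t. Proof. by rewrite le_max lexx. Qed.

Lemma posp_id t : 0 <= t -> posp t = t. Proof. by move=> t0; rewrite /posp max_r. Qed.

Lemma posp_lip t s : `|posp t - posp s| <= `|t - s|.
Proof.
rewrite /posp /Num.max.
have H1 := ler_norm (t - s); have H2 := ler_norm (- (t - s)); rewrite normrN in H2.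
by case: (ltP 0 t) => ?; case: (ltP 0 s) => ?; rewrite ler_norml; apply/andP; split; lra.
Qed.

Lemma expRN_lip t s : 0 <= t -> t <= s -> `|expR (- s) - expR (- t)| <= s - t.
Proof.
move=> t0 ts; have e1 : expR (- t) <= 1 by rewrite -expR0 ler_expR oppr_le0.
have e0 := expR_gt0 (- t).
have h : 1 + (t - s) <= expR (t - s) by exact: expR_ge1Dx.
have es : expR (- s) = expR (- t) * expR (t - s) by rewrite -expRD; congr expR; ring.
have h1 : expR (t - s) <= 1 by rewrite -expR0 ler_expR subr_le0.
rewrite es ler_norml; apply/andP; split; nra.
Qed.

(** From 1 - h <= exp(-h) <= 1/(1 + h), the excess exp(-h) - 1 + h lies between 0 and h^2/(1 + h); h
    >= -1/2 gives the factor 2. *)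
Lemma expRN_quadratic t h : 0 <= t -> `|h| <= 2^-1 ->
  `|expR (- (t + h)) - expR (- t) + h * expR (- t)| <= 2 * `|h| ^+ 2.
Proof.
move=> t0; rewrite ler_norml => /andP[h1 h2].
have e1 : expR (- t) <= 1 by rewrite -expR0 ler_expR oppr_le0.
have e0 := expR_gt0 (- t).
have E : expR (- (t + h)) = expR (- t) * expR (- h) by rewrite -expRD; congr expR; ring.
have lo : 1 - h <= expR (- h) by exact: expR_ge1Dx.
have up : expR (- h) * (1 + h) <= 1.
  rewrite -[leRHS]expR0 -[in leRHS](addNr h) expRD ler_wpM2l ?expR_ge0//.
  exact: expR_ge1Dx.
rewrite E (_ : _ + _ = expR (- t) * (expR (- h) - 1 + h)); last by ring.
rewrite real_normK ?num_real// normrM gtr0_norm// ger0_norm; last by lra.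
have : expR (- h) - 1 + h <= 2 * h ^+ 2 by nra.
have : 0 <= h ^+ 2 by exact: sqr_ge0.
have : 0 <= expR (- h) - 1 + h by lra.
by move: (expR (- h) - 1 + h) (h ^+ 2) => p q *; nra.
Qed.

End Primitive.

(** * Global flow of a Lipschitz field *)

Section LipschitzFlow.
Variables (R : realType) (k : nat).
Variables (A : ctrl R k -> ctrl R k) (C : R) (u0 : ctrl R k).
Hypothesis C0 : 0 <= C.
Hypothesis A_bounds : forall u, inL2 u ->
  [/\ forall s, `|A u s| <= C,
      forall s t, `|A u s - A u t| <= C * Num.sqrt `|s - t| &
      forall v, inL2 v -> forall s, `|A u s - A v s| <= C * normL2 (csubL2 u v)].
Hypothesis Lu0 : inL2 u0.
Implicit Types (Y Z : R * R -> 'cV[R]_k) (s t : R).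

Let cz : 0 <= normL2 u0 := normL2_ge0 u0.

(* The solution is sought as U_t = e^-t u0 + Y_t, where Y_t is a continuous
   function of s: time integrals then reduce to pointwise ones. *)
Definition curve_of Y t : ctrl R k := fun s => expR (- t) *: u0 s + Y (t, s).

(** Substituting U = e^-t u0 + Y into U' = -U - A(U) cancels the terms in u0 and leaves Y' = -(Y +
    A(U)): the rough part is solved explicitly. *)
Definition rhs Y s t : 'cV[R]_k := Y (t, s) + A (curve_of Y t) s.

Definition picard Y (p : R * R) : 'cV[R]_k :=
  \col_i (- prim (fun t => rhs Y p.2 (posp t) i 0) p.1).

(** The rate exp(2 t) lets [picard] preserve the three bounds with unchanged constants. The Hoelder
    bound makes Y(t, .) continuous, hence square integrable; being inequalities between values at
    one or two points, all three survive pointwise limits. *)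
Definition regular Y := [/\
  forall t s, 0 <= t -> `|Y (t, s)| <= C * expR (2 * t),
  forall t s s', 0 <= t -> `|Y (t, s) - Y (t, s')| <= C * expR (2 * t) * Num.sqrt `|s - s'| &
  forall t t' s, 0 <= t -> t <= t' -> `|Y (t', s) - Y (t, s)| <= 2 * C * expR (2 * t') * (t' - t)].

Lemma regular_continuous Y t : regular Y -> 0 <= t -> continuous (fun s => Y (t, s)).
Proof. by move=> [_ h _] t0; apply: holder_continuous => s s'; exact: h. Qed.

Lemma inL2_curve_of Y t : regular Y -> 0 <= t -> inL2 (curve_of Y t).
Proof.
move=> rY t0; apply: (@inL2D _ _ (cscaleL2 (expR (- t)) u0)); first exact: inL2Z.
exact/inL2_continuous/regular_continuous.
Qed.

Lemma curve_of_lip Y (M t t' : R) : regular Y -> 0 <= t -> t <= t' -> t' <= M ->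
  normL2 (csubL2 (curve_of Y t') (curve_of Y t)) <=
  (normL2 u0 + k%:R * (2 * C * expR (2 * M))) * (t' - t).
Proof.
move=> rY t0 tt' t'M; have [_ _ hY] := rY.
have t'0 : 0 <= t' by exact: le_trans tt'.
have tt0 : 0 <= t' - t by rewrite subr_ge0.
have LY : inL2 (fun s => Y (t', s) - Y (t, s)).
  apply/inL2_continuous => s.
  by apply: cvgB; [exact: (regular_continuous rY t'0)|exact: (regular_continuous rY t0)].
have -> : csubL2 (curve_of Y t') (curve_of Y t) =
    caddL2 (cscaleL2 (expR (- t') - expR (- t)) u0) (fun s => Y (t', s) - Y (t, s)).
  by apply: ctrl_ext => s i; rewrite !mxE; ring.
apply: (le_trans (normL2D (inL2Z _ Lu0) LY)); rewrite mulrDl; apply: lerD.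
  by rewrite normL2Z// mulrC ler_wpM2l// expRN_lip.
rewrite -mulrA; apply: normL2_le_sup => // [|s _].
  by rewrite !mulr_ge0// expR_ge0.
apply: (le_trans (hY t t' s t0 tt')); rewrite ler_wpM2r// ler_wpM2l ?mulr_ge0//.
by rewrite ler_expR ler_wpM2l.
Qed.

Definition rhs_lip (M : R) : R :=
  2 * C * expR (2 * M) + C * (normL2 u0 + k%:R * (2 * C * expR (2 * M))).

Lemma rhs_lip_ge0 M : 0 <= rhs_lip M.
Proof. by rewrite /rhs_lip !(mulr_ge0, addr_ge0)// expR_ge0. Qed.

Lemma rhs_time_lip Y (M t t' s : R) : regular Y -> 0 <= t <= M -> 0 <= t' <= M ->
  `|rhs Y s t' - rhs Y s t| <= rhs_lip M * `|t' - t|.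
Proof.
move=> rY; wlog tt' : t t' / t <= t' => [H tM t'M|/andP[t0 tM] /andP[t'0 t'M]].
  have [tt'|/ltW tt'] := leP t t'; first exact: H.
  by rewrite distrC (distrC t'); exact: H.
rewrite (ger0_norm (_ : 0 <= t' - t)) ?subr_ge0//.
have [_ _ hY] := rY.
have [_ _ hA] := A_bounds (inL2_curve_of rY t'0).
have -> : rhs Y s t' - rhs Y s t =
  (Y (t', s) - Y (t, s)) + (A (curve_of Y t') s - A (curve_of Y t) s).
  by rewrite /rhs opprD addrACA.
apply: (le_trans (ler_normD _ _)); rewrite /rhs_lip mulrDl; apply: lerD.
  apply: (le_trans (hY t t' s t0 tt')); rewrite ler_wpM2r ?subr_ge0//.
  by rewrite ler_wpM2l ?mulr_ge0// ler_expR ler_wpM2l.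
apply: (le_trans (hA _ (inL2_curve_of rY t0) s)); rewrite -mulrA ler_wpM2l//.
exact: curve_of_lip.
Qed.

Lemma rhs_continuous Y s i : regular Y -> continuous (fun t => rhs Y s (posp t) i 0 : R).
Proof.
move=> rY; apply/continuous_distP => t e e0.
set M := posp t + 1; have K0 := rhs_lip_ge0 M; set K := rhs_lip M in K0 *.
have K1 : 0 < K + 1 by rewrite ltr_wpDl.
exists (Num.min 1 (e / (K + 1))); first by rewrite lt_min ltr01 divr_gt0.
move=> t'; rewrite lt_min => /andP[h1 h2].
have h3 := posp_lip t' t.
have pM : 0 <= posp t <= M by rewrite posp_ge0 /M lerDl ler01.
have p'M : 0 <= posp t' <= M.
  by rewrite posp_ge0 /M; have := ler_norm (posp t' - posp t); lra.
have := mx_entry_le (rhs Y s (posp t') - rhs Y s (posp t)) i 0.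
rewrite mx_subE => /le_trans; apply.
apply: (le_trans (rhs_time_lip s rY pM p'M)).
have : (K + 1) * `|t' - t| <= e by rewrite mulrC -ler_pdivlMr// ltW.
have : K * `|posp t' - posp t| <= K * `|t' - t| by rewrite ler_wpM2l.
by have := normr_ge0 (t' - t); rewrite -/K; clearbody K => *; lra.
Qed.

Lemma rhs_bound Y s t : regular Y -> 0 <= t -> `|rhs Y s t| <= C * expR (2 * t) + C.
Proof.
move=> rY t0; have [hY _ _] := rY; have [hA _ _] := A_bounds (inL2_curve_of rY t0).
by rewrite (le_trans (ler_normD _ _))// lerD// hY.
Qed.

Lemma rhs_holder Y s s' t : regular Y -> 0 <= t ->
  `|rhs Y s t - rhs Y s' t| <= (C * expR (2 * t) + C) * Num.sqrt `|s - s'|.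
Proof.
move=> rY t0; have [_ hY _] := rY; have [_ hA _] := A_bounds (inL2_curve_of rY t0).
rewrite /rhs opprD addrACA (le_trans (ler_normD _ _))// mulrDl lerD ?hY ?hA//.
Qed.

(** The integral of c exp(2 r) + c over [0, t] falls back below c exp(2 t), because 1 + 2 t <= exp(2
    t); with rate 1 this would fail for t > 1. *)
Lemma half_exp_le t c : 0 <= t -> 0 <= c -> c / 2 * (expR (2 * t) - 1) + c * t <= c * expR (2 * t).
Proof.
move=> t0 c0; have := expR_ge1Dx (2 * t) => h.
have : 0 <= c * (expR (2 * t) - 1 - 2 * t) by rewrite mulr_ge0//; lra.
by lra.
Qed.

Lemma regular_picard Y : regular Y -> regular (picard Y).
Proof.
move=> rY.
have ce s i := @rhs_continuous Y s i rY.
split=> [t s t0|t s s' t0|t t' s t0 tt'].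
- have b0 : 0 <= C * expR (2 * t) by rewrite mulr_ge0// expR_ge0.
  apply: cV_norm_le => // i; rewrite mxE normrN/=.
  apply: (le_trans _ (half_exp_le t0 C0)); apply: prim_exp_bound => // r /andP[r0 _].
  rewrite posp_id//; exact: le_trans (mx_entry_le _ _ _) (rhs_bound s rY r0).
- have b0 : 0 <= C * expR (2 * t) * Num.sqrt `|s - s'|.
    by rewrite !mulr_ge0// ?expR_ge0// sqrtr_ge0.
  apply: cV_norm_le => // i; rewrite mx_subE !mxE/= -opprD normrN primB//.
  have c0 : 0 <= C * Num.sqrt `|s - s'| by rewrite mulr_ge0// sqrtr_ge0.
  rewrite mulrAC; apply: (le_trans _ (half_exp_le t0 c0)).
  apply: prim_exp_bound => // [r|r /andP[r0 _]]; first by apply: cvgB; exact: ce.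
  rewrite !posp_id// -mx_subE.
  apply: (le_trans (le_trans (mx_entry_le _ _ _) (rhs_holder s s' rY r0))).
  by rewrite mulrDl [C * expR _ * _]mulrAC.
- have t'0 := le_trans t0 tt'.
  apply: cV_norm_le => [|i].
    by rewrite !mulr_ge0// ?expR_ge0// subr_ge0.
  rewrite mx_subE !mxE/= -opprD normrN -[X in `|X|]subr0.
  have := @prim_increment R (fun t => rhs Y s (posp t) i 0) t t' 0
    (2 * C * expR (2 * t')) (ce s i) t0 tt'.
  rewrite mul0r; apply => r /andP[tr rt']; rewrite subr0.
  have r0 := le_trans t0 tr; rewrite posp_id//.
  apply: (le_trans (le_trans (mx_entry_le _ _ _) (rhs_bound s rY r0))).
  have h1 : expR (2 * r) <= expR (2 * t') by rewrite ler_expR ler_wpM2l.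
  have h2 : 1 <= expR (2 * t') by rewrite -expR0 ler_expR mulr_ge0.
  have := ler_wpM2l C0 h1; have := ler_wpM2l C0 h2; lra.
Qed.

(** [rhs] has Lipschitz constant 1 + C k for the weighted distance, so lam >= 2 (1 + C k) makes
    [picard] a 1/2-contraction; lam >= 2 lets the weight dominate exp(2 t) for t >= 0. *)
Let lam : R := 2 * (1 + C * k%:R) + 2.

Lemma picard_contraction Y Z (c : R) : 0 <= c -> regular Y -> regular Z ->
  (forall p, `|Y p - Z p| <= c * expR (lam * p.1)) ->
  forall p, `|picard Y p - picard Z p| <= c / 2 * expR (lam * p.1).
Proof.
move=> c0 rY rZ YZ [t s] /=.
have Ck0 : 0 <= C * k%:R by rewrite mulr_ge0.
have lam0 : 0 < lam by rewrite /lam; lra.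
have b0 : 0 <= c / 2 * expR (lam * t) by rewrite !mulr_ge0// expR_ge0.
apply: cV_norm_le => // i; rewrite mx_subE !mxE/= -opprD normrN.
(* For t <= 0 both iterates vanish; the estimate has content only for t >= 0. *)
have [t0|/ltW t0] := leP t 0; first by rewrite !prim_neg// subrr normr0.
have ceY := @rhs_continuous Y s i rY; have ceZ := @rhs_continuous Z s i rZ.
rewrite primB//.
have h : forall r, 0 <= r <= t ->
    `|rhs Y s (posp r) i 0 - rhs Z s (posp r) i 0| <= c * (1 + C * k%:R) * expR (lam * r) + 0.
  move=> r /andP[r0 _]; rewrite posp_id// addr0 -mx_subE.
  apply: (le_trans (mx_entry_le _ _ _)).
  have [_ _ hA] := A_bounds (inL2_curve_of rY r0).
  rewrite /rhs opprD addrACA (le_trans (ler_normD _ _))//.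
  have -> : c * (1 + C * k%:R) * expR (lam * r) =
    c * expR (lam * r) + C * (k%:R * (c * expR (lam * r))) by ring.
  apply: lerD; first exact: (YZ (r, s)).
  apply: (le_trans (hA _ (inL2_curve_of rZ r0) s)); rewrite ler_wpM2l//.
  apply: normL2_le_sup.
  - by apply: inL2B; exact: inL2_curve_of.
  - by rewrite mulr_ge0// expR_ge0.
  move=> s' _; rewrite (_ : csubL2 _ _ s' = Y (r, s') - Z (r, s')); first exact: (YZ (r, s')).
  by apply/matrixP => i' j'; rewrite !mxE; ring.
have cc : continuous (fun r => rhs Y s (posp r) i 0 - rhs Z s (posp r) i 0 : R).
  by move=> r; apply: cvgB; [exact: ceY|exact: ceZ].
apply: (le_trans (prim_exp_bound cc lam0 t0 h)); rewrite mul0r addr0.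
have e1 := expR_gt0 (lam * t).
have cl : c * (1 + C * k%:R) / lam <= c / 2.
  rewrite -mulrA ler_wpM2l// ler_pdivrMr// /lam; lra.
apply: (@le_trans _ _ (c / 2 * (expR (lam * t) - 1))).
  by rewrite ler_wpM2r// subr_ge0 -expR0 ler_expR mulr_ge0// ltW.
by rewrite ler_wpM2l ?divr_ge0// lerBlDr lerDl.
Qed.

(** With [norm_closed], this makes [regular] closed for the weighted distance: the tolerance is
    divided by w p + w q to control both points at once. *)
Lemma dist_closed (w : R * R -> R) Y (p q : R * R) (b : R) : (forall p, 0 < w p) ->
  (forall e : R, 0 < e -> exists2 Z, `|Z p - Z q| <= b & forall p, `|Z p - Y p| <= e * w p) ->
  `|Y p - Y q| <= b.
Proof.
move=> w0 H; apply/ler_addgt0Pr => e e0.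
have wpq : 0 < w p + w q by rewrite addr_gt0.
have [Z Zb ZY] := H _ (divr_gt0 e0 wpq).
have h1 := ZY p; have h2 := ZY q.
have h3 : e / (w p + w q) * w p + e / (w p + w q) * w q = e.
  by rewrite -mulrDr divfK// gt_eqF.
have := ler_distD (Z p) (Y p) (Y q); have := ler_distD (Z q) (Z p) (Y q).
by rewrite (distrC (Y p) (Z p)) => *; lra.
Qed.

Lemma norm_closed (w : R * R -> R) Y (p : R * R) (b : R) : (forall p, 0 < w p) ->
  (forall e : R, 0 < e -> exists2 Z, `|Z p| <= b & forall p, `|Z p - Y p| <= e * w p) ->
  `|Y p| <= b.
Proof.
move=> w0 H; apply/ler_addgt0Pr => e e0.
have [Z Zb ZY] := H _ (divr_gt0 e0 (w0 p)).
have := ZY p; rewrite divfK ?gt_eqF// => h.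
by have := ler_normB (Z p) (Z p - Y p); rewrite subKr => *; lra.
Qed.

Lemma picard_fixpoint : exists2 Y, regular Y & forall p, picard Y p = Y p.
Proof.
have Ck0 : 0 <= C * k%:R by rewrite mulr_ge0.
have w0 (p : R * R) : 0 < expR (lam * p.1) by exact: expR_gt0.
have r0 : regular (fun=> 0).
  split=> *; rewrite ?subrr normr0 !mulr_ge0// ?expR_ge0// ?sqrtr_ge0// subr_ge0//.
apply: (@weighted_fixpoint R (R * R)%type k (fun p => expR (lam * p.1)) regular
  picard (fun=> 0) C w0 C0 r0 regular_picard).
- move=> [t s] /=; rewrite subr0; have [t0|/ltW t0] := leP t 0.
    rewrite (_ : picard _ _ = 0) ?normr0 ?mulr_ge0 ?expR_ge0//.
    by apply/matrixP => i j; rewrite !mxE prim_neg// oppr0.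
  have [h _ _] := regular_picard r0; apply: (le_trans (h t s t0)).
  by rewrite ler_wpM2l// ler_expR ler_wpM2r// /lam; lra.
- exact: picard_contraction.
- move=> Y HY; split=> [t s t0|t s s' t0|t t' s t0 tt'].
  + apply: (norm_closed w0) => e /HY[Z [h _ _] ZY]; exists Z => //; exact: h.
  + apply: (dist_closed w0) => e /HY[Z [_ h _] ZY]; exists Z => //; exact: h.
  + apply: (dist_closed w0) => e /HY[Z [_ _ h] ZY]; exists Z => //; exact: h.
Qed.

(** The fixed point solves its equation pointwise in s, with an increment error K h^2 uniform in s;
    [normL2_le_sup] turns this into a strong derivative. *)
Theorem lipschitz_flow : exists U V : R -> ctrl R k,
  [/\ inL2_curve U, inL2_curve V, curve_deriv U V,
      forall t, 0 <= t -> forall e : R, 0 < e -> exists2 d : R, 0 < d &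
        forall t', 0 <= t' -> `|t' - t| < d -> normL2 (csubL2 (V t') (V t)) <= e &
      U 0 = u0 /\ forall t, V t = coppL2 (caddL2 (U t) (A (U t)))].
Proof.
have [Y rY YE] := picard_fixpoint.
pose U := curve_of Y; pose V t := coppL2 (caddL2 (U t) (A (U t))).
have LU : inL2_curve U by move=> t; exact: inL2_curve_of.
have LA t : 0 <= t -> inL2 (A (U t)).
  move=> t0; have [_ h _] := A_bounds (LU _ t0).
  exact/inL2_continuous/(holder_continuous h).
have LV : inL2_curve V by move=> t t0; apply/inL2N/inL2D; [exact: LU|exact: LA].
have U_lip t t' M : 0 <= t <= M -> 0 <= t' <= M ->
    normL2 (csubL2 (U t') (U t)) <= (normL2 u0 + k%:R * (2 * C * expR (2 * M))) * `|t' - t|.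
  move=> /andP[t0 tM] /andP[t'0 t'M]; have [tt'|/ltW tt'] := leP t t'.
    by rewrite ger0_norm ?subr_ge0//; exact: curve_of_lip.
  rewrite normL2_subC; [|exact: LU..].
  by rewrite distrC ger0_norm ?subr_ge0//; exact: curve_of_lip.
exists U, V; split => //; last first.
- split=> //; apply/funext => s; rewrite /U /curve_of oppr0 expR0 scale1r.
  rewrite -YE (_ : picard Y (0, s) = 0) ?addr0//.
  by apply/matrixP => i j; rewrite !mxE prim_neg// oppr0.
- move=> t t0 e e0; set M := t + 1.
  set K := normL2 u0 + k%:R * (2 * C * expR (2 * M)).
  have K0 : 0 <= K by rewrite /K !(mulr_ge0, addr_ge0)// expR_ge0.
  pose Q := (1 + k%:R * C) * K + 1.
  have Q0 : 0 < Q by rewrite /Q ltr_wpDl// mulr_ge0// addr_ge0// mulr_ge0.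
  exists (Num.min 1 (e / Q)); first by rewrite lt_min ltr01 divr_gt0.
  move=> t' t'0; rewrite lt_min => /andP[h1 h2].
  have tM : 0 <= t <= M by rewrite t0 /M lerDl ler01.
  have t'M : 0 <= t' <= M by rewrite t'0 /M; have := ler_norm (t' - t); lra.
  have UU := U_lip t t' M tM t'M; rewrite -/K in UU.
  have [_ _ hA] := A_bounds (LU _ t'0).
  have AA : normL2 (csubL2 (A (U t')) (A (U t))) <=
      k%:R * (C * normL2 (csubL2 (U t') (U t))).
    apply: normL2_le_sup => [||s _]; first by apply: inL2B; exact: LA.
      by rewrite mulr_ge0// normL2_ge0.
    exact: (hA _ (LU _ t0) s).
  have -> : csubL2 (V t') (V t) =
    coppL2 (caddL2 (csubL2 (U t') (U t)) (csubL2 (A (U t')) (A (U t)))).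
    by apply: ctrl_ext => s i; rewrite !mxE; ring.
  have LUU : inL2 (csubL2 (U t') (U t)) by apply: inL2B; exact: LU.
  have LAA : inL2 (csubL2 (A (U t')) (A (U t))) by apply: inL2B; exact: LA.
  rewrite normL2N; last exact: inL2D.
  apply: (le_trans (normL2D LUU LAA)).
  have hQ : Q * `|t' - t| <= e by rewrite mulrC -ler_pdivlMr// ltW.
  have hK : (1 + k%:R * C) * normL2 (csubL2 (U t') (U t)) <=
      (1 + k%:R * C) * (K * `|t' - t|).
    by rewrite ler_wpM2l// addr_ge0// mulr_ge0.
  have := normr_ge0 (t' - t); move: hQ hK AA; rewrite /Q.
  set a1 := normL2 _; set b1 := `|t' - t|; set c1 := normL2 _ => *.
  have -> : a1 + c1 = c1 + a1 by rewrite addrC.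
  by move: (k%:R * C) => *; nra.
move=> t t0 e e0; set M := t + 1.
have K0 := rhs_lip_ge0 M; set K := rhs_lip M in K0.
(* 2 |u0| comes from the expansion of e^-t and k K from the increment of Y; the final 1 keeps Q
   positive. *)
pose Q := 2 * normL2 u0 + k%:R * K + 1.
have Q0 : 0 < Q by rewrite /Q ltr_wpDl// addr_ge0// mulr_ge0.
exists (Num.min 2^-1 (e / Q)); first by rewrite lt_min invr_gt0 ltr0n divr_gt0.
move=> h h0; rewrite lt_min => /andP[h1 h2] th.
have tM : 0 <= t <= M by rewrite t0 /M lerDl ler01.
have thM : 0 <= t + h <= M by rewrite th /M; have := ler_norm h; lra.
have incr s : `|Y (t + h, s) - Y (t, s) + h *: rhs Y s t| <= K * `|h| ^+ 2.
  apply: cV_norm_le => [|i]; first by rewrite mulr_ge0// sqr_ge0.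
  have ce := @rhs_continuous Y s i rY.
  have near r : Num.min t (t + h) <= r <= Num.max t (t + h) ->
      `|rhs Y s (posp r) i 0 - rhs Y s t i 0| <= K * `|h|.
    move=> /andP[r1 r2].
    have [r0 rM rh] : [/\ 0 <= r, r <= M & `|r - t| <= `|h|].
      move: r1 r2 (ler_norm h) (ler_norm (- h)); rewrite normrN /Num.min /Num.max.
      move: thM tM => /andP[? ?] /andP[? ?].
      by case: ltP => ? ? ? ? ?; split; rewrite ?ler_norml; try apply/andP; try split; lra.
    rewrite posp_id// -mx_subE; apply: (le_trans (mx_entry_le _ _ _)).
    apply: (le_trans (@rhs_time_lip Y M t r s rY tM _)); first by rewrite r0.
    by rewrite ler_wpM2l.
  pose G r : R := rhs Y s (posp r) i 0; pose c : R := rhs Y s t i 0.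
  have YG r : Y (r, s) i 0 = - prim G r by rewrite -YE mxE.
  have entryE (p q w : 'cV[R]_k) : (p - q + h *: w) i 0 = p i 0 - q i 0 + h * w i 0.
    by rewrite !mxE.
  rewrite entryE !YG -/c expr2 mulrA.
  (* [prim_increment] wants ordered endpoints: for negative h the increment is taken over
     [t + h, t], with c the value at its right end. *)
  have [hp|/ltW hn] := leP 0 h.
    have tth : t <= t + h by rewrite lerDl.
    have H := @prim_increment R G t (t + h) c (K * `|h|) ce t0 tth.
    rewrite (_ : t + h - t = h) in H; last by ring.
    have -> : - prim G (t + h) - - prim G t + h * c =
        - (prim G (t + h) - prim G t - c * h) by ring.
    rewrite normrN.
    rewrite {2}(ger0_norm hp); apply: H => r rr; apply: near.
    by rewrite min_l// max_r.
  have tth : t + h <= t by rewrite gerDl.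
  have H := @prim_increment R G (t + h) t c (K * `|h|) ce th tth.
  rewrite (_ : t - (t + h) = - h) in H; last by ring.
  have -> : - prim G (t + h) - - prim G t + h * c =
      prim G t - prim G (t + h) - c * - h by ring.
  rewrite {2}(ler0_norm hn); apply: H => r rr; apply: near.
  by rewrite min_r// max_l.
have LU1 : inL2 (cscaleL2 (expR (- (t + h)) - expR (- t) + h * expR (- t)) u0) by exact: inL2Z.
pose P := fun s => Y (t + h, s) - Y (t, s) + h *: rhs Y s t.
have E : csubL2 (csubL2 (U (t + h)) (U t)) (cscaleL2 h (V t)) =
    caddL2 (cscaleL2 (expR (- (t + h)) - expR (- t) + h * expR (- t)) u0) P.
  by apply: ctrl_ext => s i; rewrite !mxE; ring.
have LL : inL2 (csubL2 (csubL2 (U (t + h)) (U t)) (cscaleL2 h (V t))).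
  by apply: inL2B; [apply: inL2B; exact: LU|apply/inL2Z/LV].
have LP : inL2 P.
  rewrite (_ : P = csubL2 (csubL2 (csubL2 (U (t + h)) (U t)) (cscaleL2 h (V t)))
    (cscaleL2 (expR (- (t + h)) - expR (- t) + h * expR (- t)) u0)).
    exact: inL2B.
  by rewrite E; apply: ctrl_ext => s i; rewrite !mxE; ring.
have NP : normL2 P <= k%:R * (K * `|h| ^+ 2).
  by apply: normL2_le_sup => // [|s _]; [rewrite mulr_ge0// sqr_ge0|exact: incr].
have N1 : normL2 (csubL2 (csubL2 (U (t + h)) (U t)) (cscaleL2 h (V t))) <= Q * `|h| ^+ 2.
  rewrite E (le_trans (normL2D LU1 LP))// normL2Z//.
  have e2 := expRN_quadratic t0 (ltW h1).
  have := ler_wpM2r cz e2; have := sqr_ge0 `|h|; move: NP; rewrite /Q.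
  set a1 := normL2 P; set b1 := `|h| ^+ 2; set c1 := normL2 u0; set d1 := `|_| => *.
  have -> : (2 * c1 + k%:R * K + 1) * b1 = 2 * b1 * c1 + k%:R * (K * b1) + b1 by ring.
  by lra.
have -> : csubL2 (cscaleL2 h^-1 (csubL2 (U (t + h)) (U t))) (V t) =
    cscaleL2 h^-1 (csubL2 (csubL2 (U (t + h)) (U t)) (cscaleL2 h (V t))).
  by apply: ctrl_ext => s i; rewrite !mxE; field.
rewrite normL2Z// normfV mulrC ler_pdivrMr ?normr_gt0//.
apply: (le_trans N1); rewrite expr2 mulrA ler_wpM2r// mulrC -ler_pdivlMr//; exact: ltW.
Qed.

End LipschitzFlow.

(** * The gradient flow *)

Section GradientFlow.
Variables (R : realType) (k : nat).
Variables (B : ctrl R k -> ctrl R k) (E : ctrl R k -> R).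
Implicit Types (u v : ctrl R k) (U V : R -> ctrl R k).

Definition flow_field u := caddL2 u (B u).

Hypothesis B_bounds : forall r : R, exists2 C : R, 0 <= C &
  forall u, inL2 u -> normL2 u <= r ->
  [/\ forall s, `|B u s| <= C,
      forall s t, `|B u s - B u t| <= C * Num.sqrt `|s - t| &
      forall v, inL2 v -> normL2 v <= r ->
        forall s, `|B u s - B v s| <= C * normL2 (csubL2 u v)].
Hypothesis E_coercive : forall u, inL2 u -> 2^-1 * normL2 u ^+ 2 <= E u.
Hypothesis E_grad : forall u, inL2 u -> frechet E u (flow_field u).

Lemma inL2_B u : inL2 u -> inL2 (B u).
Proof.
move=> Lu; have [C C0 HC] := B_bounds (normL2 u); have [_ h _] := HC u Lu (lexx _).
exact/inL2_continuous/(holder_continuous h).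
Qed.

Lemma inL2_flow_field u : inL2 u -> inL2 (flow_field u).
Proof. by move=> Lu; apply: inL2D => //; exact: inL2_B. Qed.

Lemma eqL2_ip u v w : inL2 u -> inL2 v -> inL2 w -> eqL2 u v -> ipL2 w u = ipL2 w v.
Proof.
move=> Lu Lv Lw uv; apply/eqP; rewrite -subr_eq0 -ipL2Br// -normr_le0.
by rewrite (le_trans (ipL2_CS Lw (inL2B Lu Lv)))// [normL2 (csubL2 u v)]uv mulr0.
Qed.

(** By the chain rule, E(U) has derivative -|[flow_field] U|^2. The equation is asked on the open
    interval only, so the lemma reaches up to a first exit time at which it is not yet known. *)
Lemma energy_nonincreasing U V (T : R) : 0 <= T ->
  inL2_curve U -> inL2_curve V -> curve_deriv U V ->
  (forall t, 0 < t < T -> eqL2 (V t) (coppL2 (flow_field (U t)))) -> E (U T) <= E (U 0).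
Proof.
move=> T0 LU LV UV VE.
have := @diff_le_exp R (fun t => E (U t)) (fun t => ipL2 (flow_field (U t)) (V t)) 0 T T0.
rewrite mul0r expR0 mul1r; apply => [t /andP[t0 _]|t tT].
  have Lf := inL2_flow_field (LU _ t0).
  exact: (curve_chain_rule LU LV UV t0 Lf (E_grad (LU _ t0))).
have /andP[/ltW t0 _] := tT; have Lf := inL2_flow_field (LU _ t0).
rewrite mul0r (eqL2_ip (LV _ t0) (inL2N Lf) Lf (VE t tT)) coppE ipL2Zr// mulN1r.
by rewrite oppr_le0 ipL2_ge0.
Qed.

Lemma coercive_bound u (e : R) : inL2 u -> E u <= e -> normL2 u <= Num.sqrt (2 * e).
Proof.
move=> Lu ue; have h := E_coercive Lu.
rewrite -[leLHS](ger0_norm (normL2_ge0 u)) -sqrtr_sqr ler_wsqrtr//.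
lra.
Qed.

(** Energy decay keeps both curves in one ball, where B is Lipschitz with constant k C; the
    derivative of |D|^2 is then -2 |D|^2 - 2 <D, B(U) - B(U')> <= 2 k C |D|^2, and D(0) has norm
    zero. *)
Lemma flow_unique U V U' V' :
  inL2_curve U -> inL2_curve V -> curve_deriv U V ->
  (forall t, 0 <= t -> eqL2 (V t) (coppL2 (flow_field (U t)))) ->
  inL2_curve U' -> inL2_curve V' -> curve_deriv U' V' ->
  (forall t, 0 <= t -> eqL2 (V' t) (coppL2 (flow_field (U' t)))) ->
  eqL2 (U 0) (U' 0) -> forall t, 0 <= t -> eqL2 (U t) (U' t).
Proof.
move=> LU LV UV VE LU' LV' UV' VE' U0 T T0.
pose r := Num.max (Num.sqrt (2 * E (U 0))) (Num.sqrt (2 * E (U' 0))).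
have Ur t : 0 <= t -> normL2 (U t) <= r.
  move=> t0; rewrite le_max coercive_bound//; first exact: LU.
  by apply: (energy_nonincreasing t0 LU LV UV) => s /andP[/ltW s0 _]; exact: VE.
have Ur' t : 0 <= t -> normL2 (U' t) <= r.
  move=> t0; rewrite le_max orbC coercive_bound//; first exact: LU'.
  by apply: (energy_nonincreasing t0 LU' LV' UV') => s /andP[/ltW s0 _]; exact: VE'.
have [C C0 HC] := B_bounds r.
pose D t := csubL2 (U t) (U' t); pose W t := csubL2 (V t) (V' t).
have LD : inL2_curve D by move=> t t0; apply: inL2B; [exact: LU|exact: LU'].
have LW : inL2_curve W by move=> t t0; apply: inL2B; [exact: LV|exact: LV'].
have DW : curve_deriv D W.
  move=> t t0 e e0; have e2 : 0 < e / 2 by rewrite divr_gt0.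
  have [d d0 H] := UV t t0 _ e2; have [d' d'0 H'] := UV' t t0 _ e2.
  exists (Num.min d d'); first by rewrite lt_min d0.
  move=> h h0; rewrite lt_min => /andP[hd hd'] th.
  have L1 : inL2 (csubL2 (cscaleL2 h^-1 (csubL2 (U (t + h)) (U t))) (V t)).
    by apply: inL2B; [apply/inL2Z/inL2B; exact: LU|exact: LV].
  have L2 : inL2 (csubL2 (cscaleL2 h^-1 (csubL2 (U' (t + h)) (U' t))) (V' t)).
    by apply: inL2B; [apply/inL2Z/inL2B; exact: LU'|exact: LV'].
  have := normL2D L1 (inL2N L2); rewrite normL2N//.
  have := H h h0 hd th; have := H' h h0 hd' th.
  rewrite (_ : caddL2 _ _ = csubL2 (cscaleL2 h^-1 (csubL2 (D (t + h)) (D t))) (W t)).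
    by move=> *; lra.
  by apply: ctrl_ext => s i; rewrite !mxE; ring.
have := @diff_le_exp R (fun t => ipL2 (D t) (D t)) (fun t => ipL2 (cscaleL2 2 (D t)) (W t))
  (2 * (k%:R * C)) T T0.
rewrite -!normL2_sqr [normL2 (D 0)]U0 expr0n mulr0 => H.
suff : normL2 (D T) ^+ 2 <= 0.
  by move=> h; apply/eqP; rewrite -[_ == _]sqrf_eq0 eq_le h sqr_ge0.
apply: H => [t /andP[t0 _]|t /andP[/ltW t0 _]].
  exact: (curve_chain_rule LD LW DW t0 (inL2Z 2 (LD _ t0)) (frechet_sqnorm (LD _ t0))).
have Lf := inL2_flow_field (LU _ t0); have Lf' := inL2_flow_field (LU' _ t0).
have LDt := LD _ t0.
rewrite ipL2Zl//; last exact: LW.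
rewrite -mulrA; apply: ler_wpM2l => //.
have -> : ipL2 (D t) (W t) = - ipL2 (D t) (D t) - ipL2 (D t) (csubL2 (B (U t)) (B (U' t))).
  rewrite /W ipL2Br//; [|exact: LV|exact: LV'].
  rewrite (eqL2_ip (LV _ t0) (inL2N Lf) LDt (VE _ t0)).
  rewrite (eqL2_ip (LV' _ t0) (inL2N Lf') LDt (VE' _ t0)).
  have [Lu Lu' LBu LBu'] : [/\ inL2 (U t), inL2 (U' t), inL2 (B (U t)) & inL2 (B (U' t))].
    by split; [exact: LU|exact: LU'|exact: inL2_B (LU _ t0)|exact: inL2_B (LU' _ t0)].
  rewrite !coppE !ipL2Zr// (ipL2Dr Lu LBu LDt) (ipL2Dr Lu' LBu' LDt).
  by rewrite (ipL2Br LBu LBu' LDt) [in - ipL2 (D t) (D t)](ipL2Br Lu Lu' LDt); ring.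
have LB : inL2 (csubL2 (B (U t)) (B (U' t))).
  by apply: inL2B; [exact: inL2_B (LU _ t0)|exact: inL2_B (LU' _ t0)].
have := ipL2_CS LDt LB; rewrite ler_norml => /andP[h _].
have BD : normL2 (csubL2 (B (U t)) (B (U' t))) <= k%:R * (C * normL2 (D t)).
  apply: normL2_le_sup => //; first by rewrite mulr_ge0// normL2_ge0.
  move=> s _; have [_ _ hl] := HC _ (LU _ t0) (Ur _ t0).
  exact: (hl (U' t) (LU' _ t0) (Ur' _ t0) s).
have := ler_wpM2l (normL2_ge0 (D t)) BD; have := ipL2_ge0 (D t).
have -> : normL2 (D t) * (k%:R * (C * normL2 (D t))) = k%:R * C * ipL2 (D t) (D t).
  by rewrite -normL2_sqr; ring.
by move=> *; lra.
Qed.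

(** The factor is 1 for |u| <= r - 1, 0 for |u| >= r, and 1-Lipschitz in u. *)
Definition cut_field (r : R) u := cscaleL2 (clamp (r - normL2 u)) (B u).

(** The constant 2 C adds one C for the variation of the factor against the bound on B and one C for
    the variation of B. *)
Lemma cut_field_bounds (r : R) : exists2 C : R, 0 <= C & forall u, inL2 u ->
  [/\ forall s, `|cut_field r u s| <= C,
      forall s t, `|cut_field r u s - cut_field r u t| <= C * Num.sqrt `|s - t| &
      forall v, inL2 v ->
        forall s, `|cut_field r u s - cut_field r v s| <= C * normL2 (csubL2 u v)].
Proof.
have [C C0 HC] := B_bounds r; exists (2 * C); first by rewrite mulr_ge0.
have clip (x : R) : `|clamp x| <= 1 by case/andP: (clamp01 x) => h1 h2; rewrite ger0_norm.
have C2 : C <= 2 * C by lra.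
have cut0 u s : r < normL2 u -> cut_field r u s = 0.
  move=> ru; rewrite /cut_field /cscaleL2 (_ : clamp _ = 0) ?scale0r//.
  by rewrite /clamp max_l ?min_r//; lra.
have cutl u v : inL2 u -> inL2 v ->
    `|clamp (r - normL2 u) - clamp (r - normL2 v)| <= normL2 (csubL2 u v).
  move=> Lu Lv; apply: (le_trans (clamp_lip _ _)).
  by rewrite opprB addrC addrA subrK distrC normL2_dist.
(* Outside the ball nothing is known of B(v); but the factor vanishes there, so its own Lipschitz
   bound against the bound on B(u) suffices. *)
have half u v s : inL2 u -> inL2 v -> normL2 u <= r -> r < normL2 v ->
    `|cut_field r u s - cut_field r v s| <= 2 * C * normL2 (csubL2 u v).
  move=> Lu Lv ur rv; have := cutl u v Lu Lv.
  rewrite (cut0 v)// subr0 (_ : clamp (r - normL2 v) = 0); last first.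
    by rewrite /clamp max_l ?min_r//; lra.
  rewrite subr0 => h; have [hB _ _] := HC u Lu ur.
  rewrite normrZ; have := ler_pM (normr_ge0 _) (normr_ge0 _) h (hB s).
  have : 0 <= C * normL2 (csubL2 u v) by rewrite mulr_ge0// normL2_ge0.
  by move=> *; lra.
move=> u Lu; have [ur|ru] := leP (normL2 u) r; last first.
  split=> [s|s t|v Lv s].
  - by rewrite cut0// normr0 mulr_ge0.
  - by rewrite !cut0// subrr normr0 !mulr_ge0// sqrtr_ge0.
  have [vr|rv] := leP (normL2 v) r; first by rewrite distrC normL2_subC//; exact: half.
  by rewrite !cut0// subrr normr0 !mulr_ge0// normL2_ge0.
have [hB hH hL] := HC u Lu ur.
split=> [s|s t|v Lv s].
- rewrite normrZ (le_trans _ C2)//.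
  by rewrite -[leRHS]mul1r ler_pM.
- rewrite /cut_field /cscaleL2 -scalerBr normrZ.
  apply: (@le_trans _ _ (C * Num.sqrt `|s - t|)); last first.
    by rewrite ler_wpM2r// sqrtr_ge0.
  by rewrite -[leRHS]mul1r ler_pM.
have [vr|rv] := leP (normL2 v) r; last exact: half.
have -> : cut_field r u s - cut_field r v s =
  (clamp (r - normL2 u) - clamp (r - normL2 v)) *: B u s +
  clamp (r - normL2 v) *: (B u s - B v s).
  by rewrite scalerBl scalerBr addrA subrK.
apply: (le_trans (ler_normD _ _)); rewrite !normrZ.
have h1 := ler_pM (normr_ge0 _) (normr_ge0 _) (cutl u v Lu Lv) (hB s).
have h2 := ler_pM (normr_ge0 _) (normr_ge0 _) (clip (r - normL2 v)) (hL v Lv vr s).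
by move: h1 h2; rewrite mul1r => *; lra.
Qed.

Theorem gradient_flow_exists (u0 : ctrl R k) : inL2 u0 -> exists U V : R -> ctrl R k,
  [/\ inL2_curve U, inL2_curve V, curve_deriv U V,
      forall t, 0 <= t -> forall e : R, 0 < e -> exists2 d : R, 0 < d &
        forall t', 0 <= t' -> `|t' - t| < d -> normL2 (csubL2 (V t') (V t)) <= e &
      U 0 = u0 /\ forall t, 0 <= t -> V t = coppL2 (flow_field (U t))].
Proof.
move=> Lu0; pose rho := Num.sqrt (2 * E u0).
(* With radius rho + 2 the field is unchanged for |u| <= rho + 1, while energy decay confines the
   curve to |u| <= rho; the gap produces the contradiction at an exit time. *)
have [C C0 HC] := cut_field_bounds (rho + 2).
have [U [V [LU LV UV cV [U0 VE]]]] := lipschitz_flow C0 HC Lu0.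
have field t : 0 <= t -> normL2 (U t) < rho + 1 -> V t = coppL2 (flow_field (U t)).
  move=> t0 Ut; rewrite VE /cut_field; congr (coppL2 (caddL2 _ _)).
  apply/funext => s; rewrite /cscaleL2 (_ : clamp _ = 1) ?scale1r//.
  by rewrite /clamp max_r ?min_l//; lra.
suff inside t : 0 <= t -> normL2 (U t) < rho + 1.
  by exists U, V; split => //; split=> // t t0; apply: field => //; exact: inside.
move=> t0; rewrite ltNge; apply/negP => Ut.
(* The infimum tau is the first time at which the norm is at least rho + 1; it belongs to [S] by
   continuity of the norm along the curve. *)
pose S := [set s : R | 0 <= s /\ rho + 1 <= normL2 (U s)].
have hS : has_inf S by split; [exists t|exists 0 => s []].
pose tau := inf S.
have tau0 : 0 <= tau by apply: lb_le_inf; [case: hS|move=> s []].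
have Ncont s : 0 <= s -> forall e : R, 0 < e -> exists2 d : R, 0 < d &
    forall s', 0 <= s' -> `|s' - s| < d -> `|normL2 (U s') - normL2 (U s)| <= e.
  move=> s0 e e0; have [d d0 Hd] := curve_deriv_increment LU LV UV s0 (@ltr01 R).
  have v0 : 0 < normL2 (V s) + 1 by rewrite ltr_wpDl// normL2_ge0.
  exists (Num.min d (e / (normL2 (V s) + 1))); first by rewrite lt_min d0 divr_gt0.
  move=> s' s'0; rewrite lt_min => /andP[h1 h2].
  have := Hd (s' - s) h1; rewrite addrC subrK => /(_ s'0) h3.
  apply: (le_trans (normL2_dist (LU _ s'0) (LU _ s0))).
  have LUU := inL2B (LU _ s'0) (LU _ s0); have LsV := inL2Z (s' - s) (LV _ s0).
  have := normL2D (inL2B LUU LsV) LsV; rewrite normL2Z; last exact: LV.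
  rewrite (_ : caddL2 _ _ = csubL2 (U s') (U s)); last first.
    by apply: ctrl_ext => r i; rewrite !mxE; ring.
  have : (normL2 (V s) + 1) * `|s' - s| <= e by rewrite mulrC -ler_pdivlMr// ltW.
  by move: h3; rewrite mul1r => *; lra.
have Ntau : rho + 1 <= normL2 (U tau).
  rewrite leNgt; apply/negP => lt.
  have e0 : 0 < (rho + 1 - normL2 (U tau)) / 2 by rewrite divr_gt0// subr_gt0.
  have [d d0 Hd] := Ncont tau tau0 _ e0.
  have [s [s0 Us] sd] := inf_adherent d0 hS.
  have ts : tau <= s by apply: ge_inf; [case: hS|].
  have st : `|s - tau| < d by rewrite ger0_norm ?subr_ge0// ltrBlDl.
  by have := Hd s s0 st; rewrite ler_norml => /andP[_ h]; lra.
have before s : 0 <= s -> s < tau -> normL2 (U s) < rho + 1.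
  move=> s0 st; rewrite ltNge; apply/negP => Us.
  have : tau <= s by apply: ge_inf; [case: hS|].
  by rewrite leNgt st.
have E0 (w : ctrl R k) : inL2 w -> eqL2 w w.
  move=> Lw; rewrite /eqL2 (_ : caddL2 _ _ = cscaleL2 0 w); last first.
    by apply: ctrl_ext => s i; rewrite !mxE; ring.
  by rewrite normL2Z// normr0 mul0r.
(* Before tau the cut-off is inactive, so the energy decays up to tau; coercivity then gives
   |U(tau)| <= rho, against the choice of tau. *)
have : E (U tau) <= E (U 0).
  apply: (energy_nonincreasing tau0 LU LV UV) => s /andP[/ltW s0 st]; rewrite field//; last exact: before.
  exact/E0/inL2N/inL2_flow_field/LU.
rewrite U0 => /(coercive_bound (LU _ tau0)); rewrite -/rho => ?; lra.
Qed.

End GradientFlow.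

Theorem mainTheorem6 (R : realType) (n k : nat)
    (F : 'cV[R]_n -> 'M[R]_(n, k)) (x0 : 'cV[R]_n) (a : 'cV[R]_n -> R)
    (beta : R) :
  (exists L : R, forall x y, `|F x - F y| <= L * `|x - y|) ->
  (forall x, 0 <= a x) ->
  (forall i : 'I_k, isC2 (fun x => col i (F x))) ->
  isC2 a ->
  0 < beta ->
  (exists G : ctrl R k -> ctrl R k, is_grad F x0 a beta G) /\
  forall G : ctrl R k -> ctrl R k, is_grad F x0 a beta G ->
  forall u0 : ctrl R k, inL2 u0 ->
    exists U : R -> ctrl R k,
      is_flow_solution G u0 U /\
      forall U' : R -> ctrl R k, is_flow_solution G u0 U' ->
        forall t, 0 <= t -> eqL2 (U t) (U' t).
Proof.
move=> [L' FL'] a0 F2 a2 b0.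
have L0 : 0 <= `|L'| by [].
have FL x y : `|F x - F y| <= `|L'| * `|x - y|.
  by rewrite (le_trans (FL' x y))// ler_wpM2r// ler_norm.
have [Fpart HF] := C2_partials F2; have [grad Ha] := C2_gradient a2.
pose B u := cscaleL2 beta (endgrad F x0 Fpart grad u).
have LB u : inL2 u -> inL2 (B u).
  by move=> Lu; apply/inL2Z; exact: (inL2_endgrad x0 L0 FL HF Ha Lu).
have B_bounds (r : R) : exists2 C : R, 0 <= C & forall u, inL2 u -> normL2 u <= r ->
    [/\ forall s, `|B u s| <= C,
        forall s t, `|B u s - B u t| <= C * Num.sqrt `|s - t| &
        forall v, inL2 v -> normL2 v <= r ->
          forall s, `|B u s - B v s| <= C * normL2 (csubL2 u v)].
  have [C C0 HC] := endgrad_bounds x0 L0 FL HF Ha r.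
  exists (beta * C) => [|u Lu ur]; first by rewrite mulr_ge0// ltW.
  have [h1 h2 h3] := HC u Lu ur.
  have scale (p : 'cV[R]_k) (c : R) : `|p| <= c -> `|beta *: p| <= beta * c.
    by move=> pc; rewrite normrZ gtr0_norm// ler_pM2l.
  split=> [s|s t|v Lv vr s]; first exact: scale.
    by rewrite /B /cscaleL2 -scalerBr -mulrA; exact: scale.
  by rewrite /B /cscaleL2 -scalerBr -mulrA; apply: scale; exact: h3.
pose E := Fbeta F x0 a beta.
have E_coercive u : inL2 u -> 2^-1 * normL2 u ^+ 2 <= E u.
  by move=> Lu; rewrite normL2_sqr /E /Fbeta lerDl mulr_ge0// ltW.
have E_grad u : inL2 u -> frechet E u (flow_field B u).
  move=> Lu e e0; have [C C0 HC] := endpoint_expansion x0 L0 FL HF Ha (normL2 u).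
  (* The remainder is |v|^2 / 2 plus beta times the quadratic endpoint error, and K |v|^2 <= e |v|
     as soon as |v| < e / K. *)
  pose K := 2^-1 + beta * C.
  have K0 : 0 < K by rewrite /K ltr_pwDl// mulr_ge0// ltW.
  exists (Num.min 1 (e / K)); first by rewrite lt_min ltr01 divr_gt0.
  move=> v Lv; rewrite lt_min => /andP[/ltW v1 ve].
  have := HC u v Lu (lexx _) Lv v1; set X := a _ - a _ - _ => hX.
  have LBu := LB u Lu; have Luv := inL2D Lu Lv.
  have -> : E (caddL2 u v) - E u - ipL2 (flow_field B u) v = 2^-1 * ipL2 v v + beta * X.
    rewrite /E /Fbeta /flow_field (ipL2Dl Lu LBu Lv) (ipL2Dl Lu Lv Luv).
    rewrite (ipL2Dr Lu Lv Lu) (ipL2Dr Lu Lv Lv) (ipL2C v u).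
    rewrite ipL2Zl//; last exact: (inL2_endgrad x0 L0 FL HF Ha Lu).
    by rewrite /X; field.
  have h1 : `|2^-1 * ipL2 v v + beta * X| <= K * normL2 v ^+ 2.
    rewrite (le_trans (ler_normD _ _))// /K mulrDl lerD//.
      by rewrite normL2_sqr ger0_norm ?mulr_ge0 ?ipL2_ge0.
    by rewrite normrM gtr0_norm// -mulrA ler_pM2l.
  apply: (le_trans h1); rewrite expr2 mulrA ler_wpM2r ?normL2_ge0//.
  by rewrite mulrC -ler_pdivlMr// ltW.
split.
  (* The explicit field is itself a gradient, so the quantification over [G] that follows is not
     vacuous. *)
  exists (flow_field B) => u Lu; split; last exact: E_grad.
  by apply: inL2D => //; exact: LB.
move=> G HG u0 Lu0.
(* Any gradient agrees with the explicit field in the sense of [eqL2], which is the only sense in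
   which [is_flow_solution] reads the equation. *)
have GE u : inL2 u -> eqL2 (flow_field B u) (G u).
  move=> Lu; have [LG fG] := HG u Lu.
  by apply: (frechet_unique _ LG (E_grad u Lu) fG); apply: inL2D => //; exact: LB.
have GNE u : inL2 u -> eqL2 (coppL2 (flow_field B u)) (coppL2 (G u)).
  move=> Lu; have [LG _] := HG u Lu.
  have LGx : inL2 (flow_field B u) by apply: inL2D => //; exact: LB.
  have := GE u Lu; rewrite /eqL2 -normL2N; last exact: inL2B.
  by move=> <-; congr normL2; apply: ctrl_ext => s i; rewrite !mxE; ring.
have [U [V [LU LV UV cV [U0 VE]]]] := gradient_flow_exists B_bounds E_coercive E_grad Lu0.
have eqL2_refl u : inL2 u -> eqL2 u u.
  move=> Lu; rewrite /eqL2 (_ : caddL2 _ _ = cscaleL2 0 u).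
    by rewrite normL2Z// normr0 mul0r.
  by apply: ctrl_ext => s i; rewrite !mxE; ring.
exists U; split.
  exists V; split; last first.
    split=> [|t t0]; first by rewrite U0; exact: eqL2_refl.
    by rewrite VE//; exact: GNE (LU _ t0).
  split; first by move=> t t0; split; [exact: LU|exact: LV].
  by split.
move=> U' [V' [[LUV' [UV' _]] [U'0 V'E]]].
have LU' : inL2_curve U' by move=> t t0; case: (LUV' t t0).
have LV' : inL2_curve V' by move=> t t0; case: (LUV' t t0).
apply: (flow_unique B_bounds E_coercive E_grad LU LV UV _ LU' LV' UV' _ _) => [t t0|t t0|].
- rewrite VE//; apply/eqL2_refl/inL2N/inL2D; [exact: LU|exact: LB (LU _ t0)].
(* A competitor satisfies the equation for [G]; the triangle inequality moves it to the explicit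
   field, for which uniqueness was proved. *)
- have Lu := LU' _ t0; have [LG _] := HG _ Lu.
  have LGx : inL2 (flow_field B (U' t)) by apply: inL2D => //; exact: LB.
  apply/eqP; rewrite -normr_le0 ger0_norm ?normL2_ge0//.
  apply: (le_trans (normL2_sub_triangle (LV' _ t0) (inL2N LGx) (inL2N LG))).
  rewrite [normL2 (csubL2 (V' t) _)](V'E t t0) add0r normL2_subC; try exact: inL2N.
  by rewrite [normL2 _](GNE _ Lu).
- apply/eqP; rewrite -normr_le0 ger0_norm ?normL2_ge0// U0.
  by rewrite normL2_subC ?[normL2 _]U'0//; exact: LU'.
Qed.
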